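(* There is $N_{\rm KB}$ such that, for every $N\ge N_{\rm KB}$ and every $N$-admissible atomic probability measure $\mu$ with $\widehat\mu(1)=0$, \[ 4d_{B,N}(\mu)\ \ge\ \frac14\,d_{3,N}(\mu)\ \ge\ 0. \] Moreover, $d_{3,N}(\mu)=0$ if and only if $\mu=\sigma_{N,\gamma}$ for some $\gamma$; hence $d_{B,N}(\mu)=0$ has the same equality case. Furthermore, whenever $B_N:=N^4d_{3,N}(\mu)\to0$ (along a sequence of such measures with $N\to\infty$), for all large $N$ the measure has exactly $N$ atoms and, after a common rotation and cyclic relabeling, writing $\theta_j=\gamma+jh+y_j$ with $\sum_jy_j=0$, $u_j=w_j-N^{-1}$, $h=2\pi/N$, one has, with an absolute constant $C$, \[ \sum_j|y_j|^2\le CB_N,\quad \max_j|y_j|\le C\sqrt{B_N/N},\quad \sum_j|u_j|^2\le \frac{CB_N}{N^2},\quad \max_j|u_j|\le \frac{CB_N^{1/2}}{N}. \]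
   Context: For $N\ge2$, an $N$-admissible atomic probability measure on $\mathbb R/2\pi\mathbb Z$ is $\mu=\sum_{\ell=1}^M w_\ell\delta_{\theta_\ell}$ with $1\le M\le N$, $w_\ell>0$, $\sum_\ell w_\ell=1$, and nodes distinct modulo $2\pi$; $\widehat\mu(k)=\sum_\ell w_\ell e^{-ik\theta_\ell}$. For $\gamma\in\mathbb R$, $\sigma_{N,\gamma}=\frac1N\sum_{j=0}^{N-1}\delta_{\gamma+2\pi j/N}$. Put \[ d_{3,N}(\mu)=\sum_{k\ge2}\frac{|\widehat\mu(k)|^2}{k^3}-\frac{\zeta(3)}{N^3}. \] Let $J_k$ be the Bessel functions of the first kind and $j=j_{0,1}$ the first positive zero of $J_0$. For $k\ge2$ put \[ \beta_k=1+j\frac{J_k'(j)}{J_k(j)},\qquad b_k=\frac{\beta_k}{k^4},\qquad d_{B,N}(\mu)=\sum_{k\ge2}b_k|\widehat\mu(k)|^2-\sum_{k\ge2}b_k|\widehat\sigma_{N,0}(k)|^2 . \] (These series converge absolutely, since $b_k=O(k^{-3})$.) *)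

(* Defs.v *)
From HB Require Import structures.
From mathcomp Require Import all_boot all_order all_algebra generic_quotient.
From mathcomp Require Import complex.
From mathcomp Require Import all_classical all_reals all_analysis.

Set Implicit Arguments.
Unset Strict Implicit.
Unset Printing Implicit Defensive.
Import Order.TTheory GRing.Theory Num.Theory.
Import numFieldNormedType.Exports.
Local Open Scope classical_set_scope.
Local Open Scope quotient_scope.
Local Open Scope complex_scope.
Local Open Scope ring_scope.

Section Circle.
Variable R : realType.

Definition eqmod2pi (x y : R) : bool :=
  `[< exists m : int, x - y = m%:~R * (2 * pi) >].

Lemma eqmod2pi_refl : reflexive eqmod2pi.
Proof. by move=> x; apply/asboolP; exists 0; rewrite subrr mul0r. Qed.

Lemma eqmod2pi_sym : symmetric eqmod2pi.
Proof.
have H x y : eqmod2pi x y -> eqmod2pi y x.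
  move=> /asboolP[m xy]; apply/asboolP; exists (- m).
  by rewrite -opprB xy mulrNz mulNr.
by move=> x y; apply/idP/idP; exact: H.
Qed.

Lemma eqmod2pi_trans : transitive eqmod2pi.
Proof.
move=> y x z /asboolP[m xy] /asboolP[n yz]; apply/asboolP; exists (m + n).
by rewrite mulrzDr mulrDl -xy -yz addrA subrK.
Qed.

Canonical eqmod2pi_equiv :=
  EquivRel eqmod2pi eqmod2pi_refl eqmod2pi_sym eqmod2pi_trans.

Definition circle : Type := {eq_quot eqmod2pi}.

HB.instance Definition _ := Choice.on circle.
HB.instance Definition _ := Quotient.on circle.
HB.instance Definition _ := EqQuotient.on circle.
HB.instance Definition _ := isPointed.Build circle (\pi_circle 0).

Definition to_circle (x : R) : circle := \pi_circle x.

(* The quotient sigma-algebra of the Borel sigma-algebra of R. *)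
Definition circle_measurable : set (set circle) :=
  [set A | measurable (to_circle @^-1` A)].

Lemma circle_measurable0 : circle_measurable set0.
Proof. by rewrite /circle_measurable/= preimage_set0. Qed.

Lemma circle_measurableC A : circle_measurable A -> circle_measurable (~` A).
Proof. by rewrite /circle_measurable/= preimage_setC; exact: measurableC. Qed.

Lemma circle_measurable_bigcup (F : (set circle)^nat) :
  (forall i, circle_measurable (F i)) -> circle_measurable (\bigcup_i F i).
Proof.
by move=> mF; rewrite /circle_measurable/= preimage_bigcup;
  exact: bigcupT_measurable.
Qed.

Definition circle_display : measure_display := default_measure_display.

HB.instance Definition _ := @isMeasurable.Build circle_display circle
  circle_measurable circle_measurable0 circle_measurableC
  circle_measurable_bigcup.

End Circle.

Section Atomic.
Variable R : realType.

(* A finite sum of weighted Dirac masses on the circle; the nodes are given by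
   real representatives. *)
Record atomic := Atomic {
  natoms : nat;
  weight : 'I_natoms -> R;
  node : 'I_natoms -> R }.

Definition atomic_measure (mu : atomic) (A : set (circle R)) : \bar R :=
  (\sum_(l < natoms mu) (weight l)%:E * \d_(to_circle (node l)) A)%E.

Definition same_measure (mu nu : atomic) : Prop :=
  forall A : set (circle R), measurable A ->
    atomic_measure mu A = atomic_measure nu A.

Definition admissible (N : nat) (mu : atomic) : Prop :=
  [/\ (1 <= natoms mu <= N)%N,
      forall l, 0 < weight (a := mu) l,
      \sum_(l < natoms mu) weight l = 1 &
      injective (fun l => to_circle (node (a := mu) l))].

Definition fourier (mu : atomic) (k : nat) : R[i] :=
  \sum_(l < natoms mu)
    (weight l)%:C * (cos (k%:R * node l) -i* sin (k%:R * node l)).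

Definition sigma (N : nat) (gamma : R) : atomic :=
  @Atomic N (fun=> N%:R^-1) (fun j => gamma + 2 * pi * j%:R / N%:R).

End Atomic.

Section Deficits.
Variable R : realType.

(* [limn] is a total operator; all the series below converge. *)
Definition sum_from (m : nat) (a : nat -> R) : R :=
  limn (fun n : nat => \sum_(m <= k < n) a k : R).

Definition zeta (s : nat) : R := sum_from 1 (fun k => (k%:R ^+ s)^-1).

Definition bessel (k : nat) (x : R) : R :=
  sum_from 0 (fun m =>
    (-1) ^+ m / (m`! * (m + k)`!)%N%:R * (x / 2) ^+ (2 * m + k)%N).

Definition is_first_positive_zero (f : R -> R) (x : R) : Prop :=
  [/\ 0 < x, f x = 0 & forall y, 0 < y -> y < x -> f y != 0].

(* The first positive zero of J_0, unique when it exists (as it does); the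
   default 0 of [xget] is never reached. *)
Definition j01 : R := xget 0 [set x | is_first_positive_zero (bessel 0) x].

Definition beta (k : nat) : R := 1 + j01 * derive1 (bessel k) j01 / bessel k j01.

Definition bcoef (k : nat) : R := beta k / k%:R ^+ 4.

Definition sqmod (mu : atomic R) (k : nat) : R :=
  Normc.normc (fourier mu k) ^+ 2.

Definition d3 (N : nat) (mu : atomic R) : R :=
  sum_from 2 (fun k => sqmod mu k / k%:R ^+ 3) - zeta 3 / N%:R ^+ 3.

Definition dB (N : nat) (mu : atomic R) : R :=
  sum_from 2 (fun k => bcoef k * sqmod mu k)
  - sum_from 2 (fun k => bcoef k * sqmod (sigma N 0) k).

(* The reals t_0 < ... < t_(N-1) < t_0 + 2 pi represent the nodes of mu,
   relabeled by s: each node once, in cyclic order. *)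
Definition cyclic_lift (mu : atomic R) (N : nat)
    (s : 'I_N -> 'I_(natoms mu)) (t : 'I_N -> R) : Prop :=
  [/\ bijective s,
      forall j, to_circle (node (s j)) = to_circle (t j),
      forall i j : 'I_N, (i < j)%N -> t i < t j &
      forall i j : 'I_N, t i < t j + 2 * pi].

End Deficits.

(* Main.v *)
(* Put V(k) = |mu^(k)|^2, c_k = V(k) - [N | k] and F(r) = sum_(k >= 1) c_k r^k.
   With K_N the Fejer kernel and P_r the Poisson kernel there is a constant
   kappa(r) such that (kappa - K_N) P_r is a cosine polynomial with nonnegative
   coefficients.  Summing it over pairs of nodes writes 2 kappa F(r) as the sum
   of three nonnegative terms: weighted low frequencies V(m) with m < N, the
   excess of sum w_l^2 over 1/N, and an off-diagonal energy in K_N.  Since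
   d_3 = sum c_k / k^3 is a triple integral of F, it is nonnegative, and the
   radii r at distance about 1/N from 1 show that it controls the three terms.
   If N^4 d_3 is small, the low frequencies exclude gaps between consecutive
   nodes longer than 1.6 h, the excess forces N atoms and nearly equal weights,
   and the energy, in which K_N vanishes at h exactly to second order, forces all
   gaps to be close to h; this is the stability statement and the equality case.

   For d_B, the coefficient b_k exceeds a combination of (k + i)^-3, 0 <= i <= 3,
   by at most O(k^-6).  The sum of c_k against that combination is the triple
   integral of F times a polynomial greater than 1/8 on (0, 1), hence at least
   d_3 / 8.  The remainder is negative only at multiples of N, where it is at
   least - C N^-6 (1 - V(N)), and 1 - V(N) = O(N^5 d_3) by stability. *)

Require Import Defs.
From HB Require Import structures.
From mathcomp Require Import all_boot all_order all_algebra generic_quotient.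
From mathcomp Require Import complex.
From mathcomp Require Import all_classical all_reals all_analysis.
From mathcomp Require Import ring lra zify.
Import Order.TTheory GRing.Theory Num.Theory.
Import numFieldNormedType.Exports.
Local Open Scope classical_set_scope.
Local Open Scope ring_scope.

(** * Series and generating functions *)

(** When N (1 - r) has order 1, kappa(r) is O(N^2), while the three terms carry weights of orders
    N^2, N^3 and N. So F(r) dominates (low frequencies) + N (excess) + (energy) / N, and each of the
    three integrations, over an interval of length about 1/N, costs a factor 1/N. This is why B =
    N^4 d_3 is the natural scale: it controls N (low frequencies), N^2 (excess) and the energy
    itself. The obstacle is that K_N vanishes at every multiple of h outside 2 pi Z, not only at h,
    so the energy alone cannot see a missing node: a gap 2h costs no energy. Gaps must first be kept
    below 2h, and 1.6 h leaves room for a quadratic lower bound on K_N around h. The frequencies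
    used for that stop at 4N/5, because the weight of V(m) decays as m approaches N. For d_B no
    smallness is assumed. When N^4 d_3 is not small, the bound 1 - V(N) = O(N^5 d_3) is trivial; its
    N^5 against the N^-6 of the remainder gains the factor 1/N that a large N absorbs. *)

Section Series.
Context {R : realType}.
Implicit Types (a b : nat -> R) (r x y L A C M e eta : R).

Lemma is_cvg_series_dominated a b :
  (forall k, `|a k| <= b k) -> cvgn (series b) -> cvgn (series a).
Proof.
move=> ab cb; apply: normed_cvg; apply: (@series_le_cvg _ _ b) => // n.
  exact: normr_ge0.
exact: le_trans (normr_ge0 _) (ab n).
Qed.

Lemma cvg_seriesM C a : cvgn (series a) ->
  series (fun k => C * a k) @ \oo --> C * limn (series a).
Proof.
move=> ca.
have -> : series (fun k => C * a k) = (fun n => C * series a n).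
  by apply/funext => n; rewrite /series/= mulr_sumr.
exact: cvgMl_tmp.
Qed.

Lemma is_cvg_seriesM C a : cvgn (series a) ->
  cvgn (series (fun k => C * a k)).
Proof. by move=> /(@cvg_seriesM C)/cvgP. Qed.

Lemma lim_seriesM C a : cvgn (series a) ->
  limn (series (fun k => C * a k)) = C * limn (series a).
Proof. by move=> /(@cvg_seriesM C)/cvg_lim; exact. Qed.

Lemma is_cvg_series_bounded a A :
  (forall k, 0 <= a k) -> (forall n, \sum_(0 <= k < n) a k <= A) ->
  cvgn (series a).
Proof.
move=> a0 aA; apply: nondecreasing_is_cvgn.
  exact: nondecreasing_series.
by exists A => _ [n _ <-]; exact: aA.
Qed.

Lemma series_le_bound a A : cvgn (series a) ->
  (forall n, \sum_(0 <= k < n) a k <= A) -> limn (series a) <= A.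
Proof. by move=> ca aA; apply: limr_le => //; near=> n; exact: aA.
Unshelve. all: by end_near. Qed.

Lemma invsqr_sum_le2 n : \sum_(0 <= k < n) (k%:R ^+ 2 : R)^-1 <= 2.
Proof.
(* Telescoping induction, from k^-2 <= 1/(k - 1) - 1/k; the term k = 0 is 0, the inverse of 0 being
   0. *)
suff H m : \sum_(0 <= k < m.+2) (k%:R ^+ 2 : R)^-1 <= 2 - m.+1%:R^-1.
  case: n => [|[|m]]; first by rewrite big_geq.
    by rewrite big_nat1 expr0n/= invr0.
  by apply: le_trans (H m) _; rewrite lerBlDr lerDl invr_ge0.
elim: m => [|m IH].
  by rewrite !big_nat_recr//= big_geq// expr0n/= invr0 !add0r; lra.
rewrite big_nat_recr//=; apply: le_trans (lerD IH (lexx _)) _.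
have m0 : 0 < m.+1%:R :> R by [].
have -> : m.+2%:R = m.+1%:R + 1 :> R by rewrite -natr1.
set x := m.+1%:R in m0 *.
have x1 : 0 < x + 1 by lra.
have -> : 2 - x^-1 + ((x+1) ^+ 2)^-1 = 2 - (x+1)^-1 - (x * (x+1)^+2)^-1.
  by field; rewrite !gt_eqF.
by rewrite gerBl invr_ge0 mulr_ge0 ?sqr_ge0// ltW.
Qed.

Lemma is_cvg_invsqr : cvgn (series (fun k => (k%:R ^+ 2 : R)^-1)).
Proof.
apply: (@is_cvg_series_bounded _ 2) => [k|]; last exact: invsqr_sum_le2.
by rewrite invr_ge0 sqr_ge0.
Qed.

Lemma is_cvg_dom2 a C : (forall k, `|a k| <= C * (k%:R ^+ 2)^-1) ->
  cvgn (series a).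
Proof.
move=> aC; apply: is_cvg_series_dominated aC _.
exact: is_cvg_seriesM is_cvg_invsqr.
Qed.

Lemma lim_dom2_le a C : 0 <= C -> (forall k, `|a k| <= C * (k%:R ^+ 2)^-1) ->
  `|limn (series a)| <= C * 2.
Proof.
move=> C0 aC; have cn : cvgn [normed series a].
  apply: (@is_cvg_dom2 _ C) => k; rewrite normr_id; exact: aC.
apply: le_trans (lim_series_norm cn) _; apply: series_le_bound => // n.
apply: (@le_trans _ _ (\sum_(0 <= k < n) C * (k%:R ^+ 2)^-1)).
  by apply: ler_sum => k _; exact: aC.
by rewrite -mulr_sumr ler_wpM2l// invsqr_sum_le2.
Qed.

Lemma sumlin_geo x n : \sum_(0 <= k < n) k.+1%:R * x ^+ k * (1 - x) ^+ 2 =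
  1 - n.+1%:R * x ^+ n + n%:R * x ^+ n.+1.
Proof.
elim: n => [|n IH]; first by rewrite big_geq// expr0; ring.
by rewrite big_nat_recr//= IH -[n.+2%:R]natr1 -!natr1 !exprS; ring.
Qed.

Lemma is_cvg_pseries_lin a A x : (forall k, `|a k| <= A * k.+1%:R) ->
  `|x| < 1 -> cvgn (pseries a x).
Proof.
move=> aA x1; have A0 : 0 <= A.
  by have := aA 0%N; rewrite mulr1; apply: le_trans.
apply: (@is_cvg_series_dominated _ (fun k => A * (k.+1%:R * `|x| ^+ k))).
  by move=> k; rewrite normrM normrX mulrA ler_wpM2r// exprn_ge0.
apply: is_cvg_seriesM.
apply: (@is_cvg_series_bounded _ ((1 - `|x|) ^- 2)) => [k|n].
  by rewrite mulr_ge0// exprn_ge0.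
have x2 : 0 < (1 - `|x|) ^+ 2 by rewrite exprn_gt0// subr_gt0.
rewrite -[_^-1]mul1r ler_pdivlMr// mulr_suml sumlin_geo.
rewrite -addrA gerDl exprS mulrA.
rewrite addrC subr_le0 ler_wpM2r ?exprn_ge0//.
apply: (@le_trans _ _ (n%:R * 1)); first by rewrite ler_wpM2l// ltW.
by rewrite mulr1 ler_nat.
Qed.

Lemma is_cvg_pseries_bnd a A x : (forall k, `|a k| <= A) ->
  `|x| < 1 -> cvgn (pseries a x).
Proof.
move=> aA; apply: (@is_cvg_pseries_lin _ A) => k; apply: le_trans (aA k) _.
rewrite ler_peMr// ?ler1n//; exact: le_trans (aA 0%N).
Qed.

(** On generating functions this is integration against dr/r; the value at k = 0 is 0, since
    division by 0 gives 0. *)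
Definition pdiv a : nat -> R := fun k => a k / k%:R.

Lemma pdiv_bound a A : (forall k, `|a k| <= A) -> forall k, `|pdiv a k| <= A.
Proof.
move=> aA [|k]; rewrite /pdiv.
  by rewrite invr0 mulr0 normr0; apply: le_trans (aA 0%N).
rewrite normrM normfV [`|k.+1%:R|]ger0_norm// ler_pdivrMr//.
by apply: le_trans (aA _) _; rewrite ler_peMr ?ler1n//; exact: le_trans (aA 0%N).
Qed.

Lemma pseries_recl a x : a 0%N = 0 ->
  cvgn (pseries a x) ->
  limn (pseries a x) = x * limn (pseries (fun k => a k.+1) x).
Proof.
move=> a0 ca.
have E n : pseries a x n.+1 = x * pseries (fun k => a k.+1) x n.
  rewrite /pseries/series/= big_nat_recl// a0 mul0r add0r mulr_sumr.
  by apply: eq_bigr => i _; rewrite exprS mulrCA.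
have [->|x0] := eqVneq x 0.
  rewrite mul0r; apply/cvg_lim => //; apply: cvg_near_cst.
  apply: nearW => n; rewrite /pseries/series/= big1_seq// => -[|i] _.
    by rewrite a0 mul0r.
  by rewrite expr0n mulr0.
have ca' : cvgn (pseries (fun k => a k.+1) x).
  have -> : pseries (fun k => a k.+1) x = (fun n => x^-1 * pseries a x n.+1).
    by apply/funext => n; rewrite E mulKf.
  apply: is_cvgMl_tmp; apply/cvg_ex; exists (limn (pseries a x)).
  by rewrite cvg_shiftS.
apply/cvg_lim => //; rewrite -cvg_shiftS.
under eq_fun do rewrite E.
exact: cvgMl_tmp.
Qed.

Lemma is_derive_pdiv a A x : (forall k, `|a k| <= A) -> `|x| < 1 ->
  is_derive x 1 (fun x => limn (pseries (pdiv a) x))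
    (limn (pseries (fun k => a k.+1) x)).
Proof.
move=> aA x1.
have -> : (fun k => a k.+1) = pseries_diffs (pdiv a).
  by apply/funext => k; rewrite /pseries_diffs /pdiv mulrC divfK// pnatr_eq0.
pose K := (1 + `|x|) / 2.
have K1 : `|K| < 1 by rewrite ger0_norm /K; have := normr_ge0 x; lra.
apply: (@pseries_snd_diffs _ _ K).
- by apply: (@is_cvg_pseries_bnd _ A) => //; exact: pdiv_bound.
- apply: (@is_cvg_pseries_bnd _ A) => // k.
  by rewrite /pseries_diffs /pdiv mulrC divfK ?pnatr_eq0.
- apply: (@is_cvg_pseries_lin _ A) => // k.
  rewrite /pseries_diffs /pdiv [k.+2%:R * _]mulrC divfK ?pnatr_eq0//.
  by rewrite normrM ger0_norm// mulrC ler_wpM2r.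
- by rewrite [X in _ < X]ger0_norm /K; have := normr_ge0 x; lra.
Qed.

(** By [is_derive_pdiv] and [pseries_recl] the derivative of the integrated series at r is F(r)/r,
    which is at least F(r) >= L because 0 < r < 1 and L >= 0; the mean value theorem concludes. *)
Lemma pdiv_increase a A L x y : (forall k, `|a k| <= A) -> a 0%N = 0 ->
  0 <= L -> 0 <= x -> x <= y -> y < 1 ->
  (forall r, x < r -> r < y -> L <= limn (pseries a r)) ->
  L * (y - x) <= limn (pseries (pdiv a) y) - limn (pseries (pdiv a) x).
Proof.
move=> aA a0 L0 x0; rewrite le_eqVlt => /predU1P[<- _ _|xy y1 aL].
  by rewrite !subrr mulr0.
have dr r : x <= r <= y -> `|r| < 1.
  by move=> /andP[? ?]; rewrite ger0_norm; lra.
have [||r] := @MVT _ (fun x => limn (pseries (pdiv a) x))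
   (fun x => limn (pseries (fun k => a k.+1) x)) x y xy.
- move=> r; rewrite in_itv/= => /andP[xr ry].
  by apply: (is_derive_pdiv _ A) => //; apply: dr; rewrite !ltW.
- apply: derivable_within_continuous => r; rewrite in_itv/= => rxy.
  by have [] := is_derive_pdiv _ A r aA (dr _ rxy).
rewrite in_itv/= => /andP[xr ry] ->; rewrite ler_pM2r ?subr_gt0//.
have r0 : 0 < r by lra.
have r1 : `|r| < 1 by rewrite ger0_norm; lra.
have := aL r xr ry; rewrite pseries_recl//; last exact: (is_cvg_pseries_bnd _ A).
set s := limn _ => Ls; apply: le_trans Ls _.
rewrite ler_piMl//; last lra.
by rewrite -(pmulr_rge0 _ r0); apply: le_trans L0 _; have := aL r xr ry;
  rewrite pseries_recl//; exact: (is_cvg_pseries_bnd _ A).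
Qed.

Lemma pseries_at0 a : a 0%N = 0 -> limn (pseries a 0) = 0.
Proof.
move=> a0; apply/cvg_lim => //; apply: cvg_near_cst; apply: nearW => n.
by rewrite /pseries/series/= big1// => -[|i] _; rewrite ?a0 ?mul0r// exprS mul0r mulr0.
Qed.

Lemma pdiv_ge0 a A : (forall k, `|a k| <= A) -> a 0%N = 0 ->
  (forall r, 0 < r -> r < 1 -> 0 <= limn (pseries a r)) ->
  forall r, 0 < r -> r < 1 -> 0 <= limn (pseries (pdiv a) r).
Proof.
move=> aA a0 ap r r0 r1.
have /= := @pdiv_increase a A 0 0 r aA a0 (lexx 0) (lexx 0) (ltW r0) r1.
rewrite mul0r pseries_at0 /pdiv ?a0 ?mul0r// subr0; apply => s s0 sr.
by apply: ap => //; lra.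
Qed.

(** The lower bound on [x, y] is collected once by integration; nonnegativity of F elsewhere
    preserves the gain on all of [y, 1). *)
Lemma pdiv_ge a A L x y : (forall k, `|a k| <= A) -> a 0%N = 0 -> 0 <= L ->
  0 < x -> x <= y -> y < 1 ->
  (forall r, 0 < r -> r < 1 -> 0 <= limn (pseries a r)) ->
  (forall r, x <= r -> r <= y -> L <= limn (pseries a r)) ->
  forall r, y <= r -> r < 1 -> L * (y - x) <= limn (pseries (pdiv a) r).
Proof.
move=> aA a0 L0 x0 xy y1 ap aL r yr r1.
have H1 := @pdiv_increase a A L x y aA a0 L0 (ltW x0) xy y1.
have H2 := @pdiv_increase a A 0 y r aA a0 (lexx _) (le_trans (ltW x0) xy) yr r1.
have H3 := pdiv_ge0 a A aA a0 ap x x0 (le_lt_trans xy y1).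
have {}H1 : L * (y - x) <= limn (pseries (pdiv a) y) - limn (pseries (pdiv a) x).
  by apply: H1 => s ? ?; apply: aL; exact: ltW.
have {}H2 : 0 * (r - y) <= limn (pseries (pdiv a) r) - limn (pseries (pdiv a) y).
  by apply: H2 => s ? ?; apply: ap; lra.
rewrite mul0r in H2; lra.
Qed.

Lemma one_sub_expr_le (r : R) k : 0 <= r <= 1 -> 1 - r ^+ k <= k%:R * (1 - r).
Proof.
move=> /andP[r0 r1]; elim: k => [|k IH]; first by rewrite expr0 subrr mul0r.
rewrite exprS -natr1 mulrDl mul1r.
have -> : 1 - r * r ^+ k = (1 - r ^+ k) + (1 - r) * r ^+ k by ring.
rewrite lerD// ler_piMr ?subr_ge0// exprn_ile1//.
Qed.

(** A quantitative Abel theorem: the values of the series at 1 and at r differ by at most 2 A (1 -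
    r), since 1 - r^k <= k (1 - r) uses up one of the three powers of k and leaves a summable
    k^-2. *)
Lemma abel_cube a A M x : (forall k, `|a k| <= A) -> a 0%N = 0 -> x < 1 ->
  (forall r, x <= r -> r < 1 ->
     M <= limn (pseries (fun k => a k / k%:R ^+ 3) r)) ->
  M <= limn (series (fun k => a k / k%:R ^+ 3)).
Proof.
move=> aA a0 x1 aM; have A0 : 0 <= A by exact: le_trans (aA 0%N).
set b := fun k => a k / k%:R ^+ 3.
have b2 k : `|b k| <= A * (k%:R ^+ 2)^-1.
  rewrite /b; case: k => [|k]; first by rewrite a0 mul0r normr0 expr0n/= invr0 mulr0.
  rewrite normrM normfV [`|_ ^+ 3|]ger0_norm ?exprn_ge0//.
  rewrite ler_pM ?invr_ge0 ?exprn_ge0// lef_pV2 ?posrE ?exprn_gt0//.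
  by rewrite [leRHS]exprSr ler_peMr ?exprn_ge0// ler1n.
have cb := is_cvg_dom2 _ _ b2.
apply/ler_addgt0Pr => e e0.
pose d := e / (A * 2 + 1); have d0 : 0 < d by rewrite divr_gt0//; lra.
pose r := Num.max (Num.max x 0) (1 - d).
have r1 : r < 1 by rewrite /r !gt_max x1 ltr01/= gtrBl.
have rx : x <= r by rewrite /r !le_max lexx.
have r0 : 0 <= r by rewrite /r !le_max lexx orbT.
have rd : 1 - r <= d by rewrite lerBlDr addrC -lerBlDr /r le_max lexx orbT.
apply: le_trans (aM r rx r1) _; rewrite -/b.
have cbr : cvgn (pseries b r).
  apply: (@is_cvg_dom2 _ A) => k; apply: le_trans (b2 k); rewrite normrM ler_piMr//.
  by rewrite normrX exprn_ile1// ger0_norm// ltW.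
suff : `|limn (series b) - limn (pseries b r)| <= e.
  by rewrite ler_norml => /andP[H _]; lra.
rewrite -lim_seriesB//; apply: (@le_trans _ _ (A * (1 - r) * 2)).
  apply: lim_dom2_le => [|k]; first by rewrite mulr_ge0// subr_ge0 ltW.
  rewrite !fctE.
  have -> : b k - b k * r ^+ k = b k * (1 - r ^+ k) by ring.
  have rk : 0 <= 1 - r ^+ k by rewrite subr_ge0 exprn_ile1// ltW.
  rewrite normrM (ger0_norm rk) /b.
  case: k rk => [|k] rk; first by rewrite expr0 subrr mulr0 expr0n/= invr0 mulr0.
  rewrite normrM normfV [`|_ ^+ 3|]ger0_norm ?exprn_ge0//.
  have := one_sub_expr_le r k.+1; rewrite r0 ltW// => /(_ erefl) H.
  apply: (@le_trans _ _ (A / k.+1%:R ^+ 3 * (k.+1%:R * (1 - r)))).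
    by rewrite ler_pM// ?divr_ge0 ?exprn_ge0// ler_wpM2r ?invr_ge0 ?exprn_ge0.
  rewrite le_eqVlt; apply/orP; left; apply/eqP; field.
  by rewrite addrC natr1 pnatr_eq0.
have Ar : A * (1 - r) <= A * d by rewrite ler_wpM2l.
have : A * 2 * d <= e.
  rewrite /d mulrCA ler_piMr ?(ltW e0)// ler_pdivrMr ?mul1r; lra.
lra.
Qed.

(* Dividing the coefficients by k three times amounts to integrating the
   generating function three times against dr/r, each time over an interval of
   length eta. *)
Lemma series_cube_ge a A L x eta : (forall k, `|a k| <= A) -> a 0%N = 0 ->
  0 <= L -> 0 < x -> 0 <= eta -> x + 3 * eta < 1 ->
  (forall r, 0 < r -> r < 1 -> 0 <= limn (pseries a r)) ->
  (forall r, x <= r -> r <= x + eta -> L <= limn (pseries a r)) ->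
  L * eta ^+ 3 <= limn (series (fun k => a k / k%:R ^+ 3)).
Proof.
move=> aA a0 L0 x0 e0 x1 ap aL.
have E : pdiv (pdiv (pdiv a)) = (fun k => a k / k%:R ^+ 3).
  apply/funext => k; rewrite /pdiv -!mulrA; congr (_ * _).
  by rewrite -!invfM !exprS expr0 mulr1.
have p1 := pdiv_ge0 a A aA a0 ap.
have b1 := pdiv_bound a A aA.
have z1 : pdiv a 0%N = 0 by rewrite /pdiv a0 mul0r.
have p2 := pdiv_ge0 _ A b1 z1 p1.
have b2 := pdiv_bound _ A b1.
have z2 : pdiv (pdiv a) 0%N = 0 by rewrite /pdiv a0 !mul0r.
have g1 : forall r, x + eta <= r -> r < 1 -> L * eta <= limn (pseries (pdiv a) r).
  move=> r ? ?; have -> : eta = x + eta - x by ring.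
  by apply: (pdiv_ge _ A) => //; lra.
have g2 : forall r, x + eta *+ 2 <= r -> r < 1 ->
    L * eta * eta <= limn (pseries (pdiv (pdiv a)) r).
  move=> r ? ?; have {2}-> : eta = x + eta *+ 2 - (x + eta) by ring.
  apply: (pdiv_ge _ A) => //; rewrite ?mulr2n; try lra; first exact: mulr_ge0.
  by move=> s ? ?; apply: g1; lra.
rewrite !exprS expr0 mulr1 !mulrA.
apply: (@abel_cube a A _ (x + eta *+ 3)) => //; first by rewrite mulrS mulr2n; lra.
move=> r ? ?; rewrite -E; have {3}-> : eta = x + eta *+ 3 - (x + eta *+ 2) by ring.
apply: (pdiv_ge _ A) => //; rewrite ?mulrS ?mulr0n; try lra.
  by rewrite !mulr_ge0.
by move=> s ? ?; apply: g2; rewrite ?mulrS ?mulr0n; lra.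
Qed.

Lemma sum_fromE m a : sum_from m a = limn (series (fun k => (m <= k)%:R * a k)).
Proof.
rewrite /sum_from; congr (lim (_ @ \oo)); apply/funext => n.
rewrite /series/= big_geq_mkord big_mkord big_mkcond/=.
by apply: eq_bigr => i _; case: ifP; rewrite ?mul1r ?mul0r.
Qed.

(** The partial sum of [a] up to n N is the n-th partial sum over the multiples, so this is
    convergence along a subsequence. *)
Lemma cvg_series_multiples N a : (0 < N)%N ->
  (forall k, ~~ (N %| k)%N -> a k = 0) -> cvgn (series a) ->
  series (fun j => a (j * N)%N) @ \oo --> limn (series a).
Proof.
move=> N0 aN ca.
have -> : series (fun j => a (j * N)%N) = series a \o (fun n => (n * N)%N).
  apply/funext => n /=; elim: n => [|n IH]; first by rewrite mul0n /series/= !big_geq.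
  rewrite seriesSr IH mulSn addnC seriesEnat/=.
  rewrite [RHS](@big_cat_nat _ _ _ (n * N)%N)//= ?leq_addr//; congr (_ + _).
  rewrite big_ltn; last by lia.
  rewrite big_nat_cond big1 ?addr0 => // k; rewrite andbT => /andP[k1 k2].
  apply: aN; apply/negP => /dvdnP[q qE]; move: k1 k2; rewrite qE.
  rewrite -mulSnr !ltn_mul2r N0/=; lia.
apply: cvg_comp ca => A [M _ MA]; exists M => // n /= Mn.
by apply: MA => /=; apply: leq_trans Mn _; rewrite leq_pmulr.
Qed.

(** Multiplies the generating function by r; summed against weights b, it replaces b k by b (k + 1).
    It thus links the weights (k + i)^-3 with the factors r^i. *)
Definition delay a n : R := if n is m.+1 then a m else 0.

Lemma delay_bound (a : nat -> R) A : (forall k, `|a k| <= A) ->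
  forall k, `|delay a k| <= A.
Proof.
move=> aA [|k]; last exact: aA.
by rewrite normr0; apply: le_trans (aA 0%N).
Qed.

Lemma cvg_pseries_delay a x (l : R) : pseries a x @ \oo --> l ->
  pseries (delay a) x @ \oo --> x * l.
Proof.
move=> al; rewrite -cvg_shiftS.
have -> : (fun n => pseries (delay a) x n.+1) = (fun n => x * pseries a x n).
  apply/funext => n; rewrite /pseries/series/= big_nat_recl// mul0r add0r mulr_sumr.
  by apply: eq_bigr => i _; rewrite exprS mulrCA.
exact: cvgMl_tmp.
Qed.

Lemma cvg_series_delay a b (l : R) : series (fun k => a k * b k.+1) @ \oo --> l ->
  series (fun k => delay a k * b k) @ \oo --> l.
Proof.
move=> al; rewrite -cvg_shiftS.
have -> // : (fun n => series (fun k : nat => delay a k * b k) n.+1) =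
    series (fun k => a k * b k.+1).
by apply/funext => n; rewrite /series/= big_nat_recl// mul0r add0r.
Qed.

End Series.

(** * Fejer and Poisson kernels *)

Section Kernels.
Context {R : realType}.
Implicit Types (r x : R) (k m n N : nat).

Lemma cos_rec k x : cos (k.+2%:R * x) + cos (k%:R * x) =
  2 * cos x * cos (k.+1%:R * x) :> R.
Proof.
have -> : k.+2%:R * x = k.+1%:R * x + x by rewrite -[k.+2%:R]natr1; ring.
have -> : k%:R * x = k.+1%:R * x - x by rewrite -[k.+1%:R]natr1; ring.
by rewrite cosD cosB; ring.
Qed.

Definition dirichlet n x : R := 1 + 2 * \sum_(1 <= k < n.+1) cos (k%:R * x).

Lemma dirichletE n x :
  dirichlet n x * (1 - cos x) = cos (n%:R * x) - cos (n.+1%:R * x).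
Proof.
elim: n => [|n IH]; first by rewrite /dirichlet big_geq// mul0r cos0 !mul1r; ring.
have -> : dirichlet n.+1 x = dirichlet n x + 2 * cos (n.+1%:R * x).
  by rewrite /dirichlet big_nat_recr//=; ring.
rewrite mulrDl IH; have /eqP := cos_rec n x; rewrite -subr_eq0 => /eqP E.
by apply/eqP; rewrite -subr_eq0 -E; apply/eqP; ring.
Qed.

(** Equals (sin(N x / 2) / sin(x / 2))^2 off 2 pi Z: this normalization has mean N and value N^2 at
    0. *)
Definition fejer N x : R :=
  N%:R + 2 * \sum_(1 <= k < N) (N%:R - k%:R) * cos (k%:R * x).

Lemma fejerS N x : fejer N.+1 x = fejer N x + dirichlet N x.
Proof.
rewrite /fejer /dirichlet; case: N => [|N].
  by rewrite !big_geq//; ring.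
rewrite [in LHS]big_nat_recr//= [\sum_(1 <= k < N.+2) cos _]big_nat_recr//=.
have -> : \sum_(1 <= k < N.+1) (N.+2%:R - k%:R) * cos (k%:R * x) =
   \sum_(1 <= k < N.+1) (N.+1%:R - k%:R) * cos (k%:R * x) +
   \sum_(1 <= k < N.+1) cos (k%:R * x).
  rewrite -big_split/=; apply: eq_bigr => i _; rewrite -[N.+2%:R]natr1; ring.
by rewrite -[N.+2%:R]natr1; ring.
Qed.

Lemma fejerE N x : fejer N x * (1 - cos x) = 1 - cos (N%:R * x).
Proof.
elim: N => [|N IH]; first by rewrite /fejer big_geq// !mul0r cos0; ring.
by rewrite fejerS mulrDl IH dirichletE; ring.
Qed.

Lemma fejer_double N x :
  fejer N x = \sum_(i < N) \sum_(j < N) cos ((i%:R - j%:R) * x).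
Proof.
elim: N => [|N IH]; first by rewrite /fejer big_geq// big_ord0; ring.
rewrite fejerS IH big_ord_recr/= big_ord_recr/= subrr mul0r cos0.
under [X in _ = X + _]eq_bigr do rewrite big_ord_recr/=.
rewrite big_split/= -addrA; congr (_ + _).
have E : \sum_(i < N) cos ((N%:R - i%:R) * x) = \sum_(1 <= k < N.+1) cos (k%:R * x).
  rewrite big_add1/= big_mkord (reindex_inj rev_ord_inj)/=.
  apply: eq_bigr => i _; congr (cos (_ * x)).
  by rewrite -natrB ?leq_subr// subKn.
have -> : \sum_(i < N) cos ((i%:R - N%:R) * x) = \sum_(i < N) cos ((N%:R - i%:R) * x).
  by apply: eq_bigr => i _; rewrite -cosN -mulNr opprB.
by rewrite E /dirichlet; ring.
Qed.

Lemma fejer_sqr N x : fejer N x =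
  (\sum_(i < N) cos (i%:R * x)) ^+ 2 + (\sum_(i < N) sin (i%:R * x)) ^+ 2.
Proof.
rewrite fejer_double !expr2 !mulr_suml -big_split/=; apply: eq_bigr => i _.
rewrite !mulr_sumr -big_split/=; apply: eq_bigr => j _.
by rewrite mulrBl cosB; ring.
Qed.

Lemma fejer_ge0 N x : 0 <= fejer N x.
Proof. by rewrite fejer_sqr addr_ge0// sqr_ge0. Qed.

Definition poisson r x : R := (1 - r ^+ 2) / (1 - 2 * r * cos x + r ^+ 2).

Definition fejer_max N r : R :=
  N%:R + \sum_(1 <= k < N) (N%:R - k%:R) * (r^-1 ^+ k + r ^+ k).

Definition minor_coef N r m : R :=
  \sum_(m.+1 <= k < N) (N%:R - k%:R) * (r^-1 ^+ (k - m) - r ^+ (k - m)).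

Lemma poisson_den_gt0 r x : 0 < r < 1 -> 0 < 1 - 2 * r * cos x + r ^+ 2.
Proof.
move=> /andP[r0 r1].
have -> : 1 - 2 * r * cos x + r ^+ 2 = (1 - r) ^+ 2 + 2 * r * (1 - cos x) by ring.
rewrite ltr_pwDl//; first by rewrite exprn_gt0// subr_gt0.
by rewrite !mulr_ge0// ?subr_ge0 ?cos_le1// ltW.
Qed.

Lemma poisson_gt0 r x : 0 < r < 1 -> 0 < poisson r x.
Proof.
move=> r01; rewrite divr_gt0 ?poisson_den_gt0//.
by case/andP: r01 => r0 r1; rewrite subr_gt0 expr_lt1// ltW.
Qed.

(** As a polynomial in cos x, r^-k + r^k - 2 cos kx vanishes at cos x = (r^-1 + r) / 2; [Uk] is its
    quotient by r^-1 + r - 2 cos x, times r^-1 - r, written as a cosine sum. *)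
Let Uk r k x : R := \sum_(m < k)
  (if m == 0%N :> nat then 1 else 2) * (r^-1 ^+ (k - m) - r ^+ (k - m)) *
    cos (m%:R * x).

Let UkS r k x : r != 0 -> Uk r k.+2 x + Uk r k x =
  (r^-1 + r) * Uk r k.+1 x + 2 * (r^-1 - r) * cos (k.+1%:R * x).
Proof.
move=> r0; have rV : r^-1 * r = 1 by rewrite mulVf.
rewrite /Uk (big_ord_recr k.+1)/= (big_ord_recr k)/= (big_ord_recr k)/=.
rewrite subSnn subSnn (_ : (k.+2 - k = 2)%N); last by lia.
have E : \sum_(m < k) (if m == 0%N :> nat then 1 else 2) *
    (r^-1 ^+ (k.+2 - m) - r ^+ (k.+2 - m)) * cos (m%:R * x) =
   (r^-1 + r) * (\sum_(m < k) (if m == 0%N :> nat then 1 else 2) *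
    (r^-1 ^+ (k.+1 - m) - r ^+ (k.+1 - m)) * cos (m%:R * x)) -
   \sum_(m < k) (if m == 0%N :> nat then 1 else 2) *
    (r^-1 ^+ (k - m) - r ^+ (k - m)) * cos (m%:R * x).
  rewrite mulr_sumr -sumrB; apply: eq_bigr => m _.
  rewrite (_ : (k.+2 - m = (k - m).+2)%N); last by have := ltn_ord m; lia.
  rewrite (_ : (k.+1 - m = (k - m).+1)%N); last by have := ltn_ord m; lia.
  rewrite !exprS; move: (r^-1) rV => s rV; ring: rV.
rewrite E.
rewrite !expr1 expr2 expr2; move: (r^-1) rV => s rV; ring: rV.
Qed.

(** Two-step induction: [UkS] and [cos_rec] give both sides the same three-term recurrence. *)
Let UkE r k x : r != 0 -> (r^-1 - r) * (r^-1 ^+ k + r ^+ k - 2 * cos (k%:R * x)) =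
  (r^-1 + r - 2 * cos x) * Uk r k x.
Proof.
move=> r0.
pose P k := (r^-1 - r) * (r^-1 ^+ k + r ^+ k - 2 * cos (k%:R * x)) =
  (r^-1 + r - 2 * cos x) * Uk r k x.
suff : P k /\ P k.+1 by case.
elim: k => [|k [IH1 IH2]]; rewrite /P.
  split; first by rewrite /Uk big_ord0 mul0r cos0 !expr0; ring.
  by rewrite /Uk big_ord_recl big_ord0/= mul0r cos0 !expr1 !mul1r; ring.
split => //.
have rV : r^-1 * r = 1 by rewrite mulVf.
have -> : Uk r k.+2 x = (r^-1 + r) * Uk r k.+1 x
    + 2 * (r^-1 - r) * cos (k.+1%:R * x) - Uk r k x.
  by rewrite -UkS// addrK.
have -> : cos (k.+2%:R * x) = 2 * cos x * cos (k.+1%:R * x) - cos (k%:R * x) :> R.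
  by rewrite -cos_rec addrK.
rewrite /P in IH1 IH2.
have -> : (r^-1 + r - 2 * cos x) * ((r^-1 + r) * Uk r k.+1 x +
    2 * (r^-1 - r) * cos (k.+1%:R * x) - Uk r k x) =
  (r^-1 + r) * ((r^-1 + r - 2 * cos x) * Uk r k.+1 x) +
  (r^-1 + r - 2 * cos x) * (2 * (r^-1 - r) * cos (k.+1%:R * x)) -
  (r^-1 + r - 2 * cos x) * Uk r k x by ring.
rewrite -IH2 -IH1 !exprS.
by move: (r^-1) rV => s rV; ring: rV.
Qed.

(* [fejer_max N r] is the value of the Fejer kernel at the complex zeros of the
   denominator of the Poisson kernel, so the product on the left is again a
   cosine polynomial. *)
Lemma poisson_minorant N r x : 0 < r < 1 ->
  (fejer_max N r - fejer N x) * poisson r x =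
  minor_coef N r 0 + 2 * \sum_(1 <= m < N) minor_coef N r m * cos (m%:R * x).
Proof.
move=> r01; have /andP[r0 r1] := r01; have rN0 : r != 0 by rewrite gt_eqF.
have d0 := poisson_den_gt0 r x r01.
have pE : poisson r x = (r^-1 - r) / (r^-1 + r - 2 * cos x).
  rewrite /poisson.
  have -> : r^-1 - r = (1 - r ^+ 2) / r by field.
  have -> : r^-1 + r - 2 * cos x = (1 - 2 * r * cos x + r ^+ 2) / r by field.
  by field; rewrite rN0 gt_eqF.
have dd0 : r^-1 + r - 2 * cos x != 0.
  have -> : r^-1 + r - 2 * cos x = (1 - 2 * r * cos x + r ^+ 2) / r by field.
  by rewrite gt_eqF// divr_gt0.
have -> : fejer_max N r - fejer N x =
   \sum_(1 <= k < N) (N%:R - k%:R) * (r^-1 ^+ k + r ^+ k - 2 * cos (k%:R * x)).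
  rewrite /fejer_max /fejer opprD addrACA subrr add0r mulr_sumr -sumrB.
  by apply: eq_bigr => k _; ring.
rewrite mulr_suml.
transitivity (\sum_(1 <= k < N) (N%:R - k%:R) * Uk r k x).
  apply: eq_bigr => k _; rewrite -mulrA; congr (_ * _).
  by rewrite pE mulrA [_ * (r^-1 - r)]mulrC UkE// mulrAC mulfV// mul1r.
case: N => [|N]; first by rewrite /minor_coef !big_geq//; ring.
have [->|N0] := posnP N; first by rewrite /minor_coef !big_geq//; ring.
rewrite /Uk.
transitivity (\sum_(0 <= m < N.+1) (if m == 0%N then 1 else 2) *
   minor_coef N.+1 r m * cos (m%:R * x)); last first.
  rewrite big_ltn//= mul0r cos0 mulr1 mul1r; congr (_ + _).
  by rewrite mulr_sumr; apply: eq_big_nat => -[|m] //= _; rewrite mulrA.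
under eq_bigr do rewrite -(big_mkord xpredT (fun m => (if m == 0%N then 1 else 2) *
  (r^-1 ^+ (_ - m) - r ^+ (_ - m)) * cos (m%:R * x))).
transitivity (\sum_(0 <= k < N.+1) \sum_(0 <= m < N.+1 | (m < k)%N)
   (N.+1%:R - k%:R) * ((if m == 0%N then 1 else 2) *
  (r^-1 ^+ (k - m) - r ^+ (k - m)) * cos (m%:R * x))).
  rewrite [RHS]big_ltn// [X in _ = X + _]big_pred0// add0r.
  apply: eq_big_nat => k /andP[k0 kN]; rewrite mulr_sumr.
  rewrite (big_nat_widen 0 k N.+1)//; lia.
rewrite (exchange_big_dep predT)//=; apply: eq_big_nat => m /andP[_ mN].
rewrite /minor_coef mulr_sumr mulr_suml.
rewrite [RHS](big_nat_widenl _ 0)//=.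
by apply: eq_bigr => k _; rewrite !mulrA [_ * (if _ then _ else _)]mulrC.
Qed.

Lemma poisson_cvg r x : 0 < r < 1 ->
  pseries (fun k => (k != 0%N)%:R * cos (k%:R * x)) r @ \oo -->
  (poisson r x - 1) / 2.
Proof.
move=> r01; have /andP[r0 r1] := r01.
have d0 := poisson_den_gt0 r x r01.
pose D := 1 - 2 * r * cos x + r ^+ 2.
(* r^n (r cos((n-1)x) - cos(nx)) is the remainder of the geometric sum. *)
have E n : pseries (fun k => (k != 0%N)%:R * cos (k%:R * x)) r n.+1 =
   (poisson r x - 1) / 2 +
   r ^+ n * ((r ^+ 2 * cos (n%:R * x) - r * cos (n.+1%:R * x)) / D).
  apply: (@mulIf _ D); first by rewrite gt_eqF.
  rewrite mulrDl -!mulrA mulVf ?gt_eqF// mulr1.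
  have -> : (poisson r x - 1) * (2^-1 * D) = r * cos x - r ^+ 2.
    by rewrite /poisson -/D; rewrite /D; field; rewrite gt_eqF.
  elim: n => [|n IH].
    by rewrite /pseries/series/= big_nat1 !mul0r expr0 cos0 !mul1r; ring.
  rewrite /pseries seriesSr mulrDl IH /= mul1r.
  have -> : cos (n.+2%:R * x) = 2 * cos x * cos (n.+1%:R * x) - cos (n%:R * x) :> R.
    by rewrite -cos_rec addrK.
  by rewrite /D !exprS; ring.
rewrite -cvg_shiftS; under eq_fun do rewrite E.
suff H : (fun n => (poisson r x - 1) / 2 +
    r ^+ n * ((r ^+ 2 * cos (n%:R * x) - r * cos (n.+1%:R * x)) / D)) @ \oo -->
    (poisson r x - 1) / 2 + 0 by rewrite addr0 in H.
apply: cvgD; first exact: cvg_cst.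
apply/norm_cvg0P; pose A := 2 / D.
apply: (@squeeze_cvgr _ _ _ _ (cst 0) (fun n => A * r ^+ n)); last 2 first.
- exact: cvg_cst.
- rewrite -(mulr0 A); apply: cvgMl_tmp; apply: cvg_expr; rewrite ger0_norm ?ltW//.
near=> n; rewrite normr_ge0/= normrM mulrC normrX (ger0_norm (ltW r0)).
rewrite ler_wpM2r ?exprn_ge0 ?(ltW r0)// /A normrM normfV (ger0_norm (ltW d0)).
rewrite ler_wpM2r ?invr_ge0 ?(ltW d0)//.
apply: le_trans (ler_normB _ _) _.
rewrite normrM (ger0_norm (sqr_ge0 r)) [X in _ + X]normrM (ger0_norm (ltW r0)).
have c1 := cos_max (n%:R * x); have c2 := cos_max (n.+1%:R * x).
have : r ^+ 2 * `|cos (n%:R * x)| <= 1.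
  by rewrite mulr_ile1 ?exprn_ge0 ?(ltW r0)// expr_le1// ltW.
have : r * `|cos (n.+1%:R * x)| <= 1.
  by rewrite mulr_ile1 ?(ltW r0)// ltW.
lra.
Unshelve. all: by end_near. Qed.

End Kernels.

(** * The energy identity *)

Section Energy.
Context {R : realType}.
Implicit Types (mu : atomic R) (r x : R) (k m n N : nat).

Lemma fourierE mu k : fourier mu k =
  Complex (\sum_l weight l * cos (k%:R * node (a := mu) l))
          (- \sum_l weight l * sin (k%:R * node (a := mu) l)).
Proof.
rewrite /fourier -sumrN.
apply: (big_ind3 (fun (z : R[i]) a b => z = Complex a b)) => //.
  by move=> z a b z' a' b' -> ->.
by move=> i _; apply/eqP; rewrite eq_complex/=; apply/andP; split; apply/eqP; ring.
Qed.

Lemma sqmod_sqr mu k : sqmod mu k =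
  (\sum_l weight l * cos (k%:R * node (a := mu) l)) ^+ 2 +
  (\sum_l weight l * sin (k%:R * node (a := mu) l)) ^+ 2.
Proof.
rewrite /sqmod fourierE /Normc.normc sqrrN sqr_sqrtr//.
by rewrite addr_ge0// sqr_ge0.
Qed.

Lemma sqmodE mu k : sqmod mu k = \sum_i \sum_j
  weight (a := mu) i * weight (a := mu) j * cos (k%:R * (node i - node j)).
Proof.
rewrite sqmod_sqr !expr2 !mulr_suml -big_split/=; apply: eq_bigr => i _.
rewrite !mulr_sumr -big_split/=; apply: eq_bigr => j _.
by rewrite mulrBr cosB; ring.
Qed.

Lemma sqmod_ge0 mu k : 0 <= sqmod mu k.
Proof. by rewrite sqmod_sqr addr_ge0// sqr_ge0. Qed.

Lemma sqmod_le1 mu k : (forall l, 0 <= weight (a := mu) l) ->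
  \sum_l weight (a := mu) l = 1 -> sqmod mu k <= 1.
Proof.
move=> w0 w1; rewrite sqmodE.
have -> : 1 = \sum_i \sum_j weight (a := mu) i * weight (a := mu) j.
  by under eq_bigr do rewrite -mulr_sumr; rewrite w1; under eq_bigr do rewrite mulr1.
apply: ler_sum => i _; apply: ler_sum => j _.
by rewrite ler_piMr ?cos_le1// mulr_ge0.
Qed.

Lemma cos_neq1 x : 0 < x < 2 * pi -> cos x < 1.
Proof.
move=> /andP[x0 x1].
have s0 : 0 < sin (x / 2) by apply: sin_gt0_pi; apply/andP; split; lra.
have -> : x = (x / 2) *+ 2 by rewrite mulr2n -splitr.
rewrite cos_mulr2n cos2sin2 mulr2n.
have : 0 < sin (x / 2) ^+ 2 by rewrite exprn_gt0.
lra.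
Qed.

Lemma cosD2pin x n : cos (x + n%:R * (2 * pi)) = cos x.
Proof.
have := @periodicn _ _ _ _ (@cosD2pi R) n x.
by rewrite (_ : pi *+ 2 *+ n = n%:R * (2 * pi))// -mulr_natl mulr2n; ring.
Qed.

Lemma sinD2pin x n : sin (x + n%:R * (2 * pi)) = sin x.
Proof.
have := @periodicn _ _ _ _ (@sinD2pi R) n x.
by rewrite (_ : pi *+ 2 *+ n = n%:R * (2 * pi))// -mulr_natl mulr2n; ring.
Qed.

Lemma fejer0 N : fejer N 0 = N%:R ^+ 2 :> R.
Proof.
rewrite fejer_double; under eq_bigr do under eq_bigr do rewrite mulr0 cos0.
by under eq_bigr do rewrite sumr_const; rewrite sumr_const !card_ord -mulrnA mulnn natrX.
Qed.

Lemma fejerN N x : fejer N (- x) = fejer N x.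
Proof.
rewrite /fejer; congr (_ + 2 * _); apply: eq_bigr => k _.
by rewrite mulrN cosN.
Qed.

Lemma fejerD2pi N x n : fejer N (x + n%:R * (2 * pi)) = fejer N x.
Proof.
rewrite /fejer; congr (_ + 2 * _); apply: eq_bigr => k _; congr (_ * _).
by rewrite mulrDr mulrA -natrM cosD2pin.
Qed.

Lemma fejer_root N k : (0 < N)%N ->
  fejer N (2 * pi * k%:R / N%:R) = (N %| k)%:R * N%:R ^+ 2 :> R.
Proof.
move=> N0; have Nr : 0 < N%:R :> R by rewrite ltr0n.
have -> : 2 * pi * k%:R / N%:R =
    2 * pi * (k %% N)%:R / N%:R + (k %/ N)%:R * (2 * pi) :> R.
  rewrite {1}(divn_eq k N) natrD natrM; field.
  by rewrite gt_eqF.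
rewrite fejerD2pi /dvdn; case: eqP => [->|/eqP kN].
  by rewrite mulr0 mul0r fejer0 mul1r.
(* For a nonzero residue the argument lies strictly between 0 and 2 pi, so the factor 1 - cos in
   [fejerE] can be cancelled. *)
rewrite mul0r; apply/eqP; rewrite -(mulIr_eq0 _ (mulIf (x := 1 - cos (2 * pi * (k %% N)%:R / N%:R)) _)).
  rewrite fejerE (_ : N%:R * _ = 0 + (k %% N)%:R * (2 * pi)).
    by rewrite cosD2pin cos0 subrr.
  by field; rewrite gt_eqF.
rewrite subr_eq0 eq_sym lt_eqF// cos_neq1//.
have k0 : 0 < (k %% N)%:R :> R by rewrite ltr0n lt0n.
have kl : (k %% N)%:R < N%:R :> R by rewrite ltr_nat ltn_mod.
have p0 := pi_gt0 R; apply/andP; split.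
  by rewrite divr_gt0// !mulr_gt0.
by rewrite ltr_pdivrMr// ltr_pM2l// mulr_gt0.
Qed.

Lemma sqmod_sigma N (gamma : R) k : (0 < N)%N ->
  sqmod (sigma N gamma) k = (N %| k)%:R.
Proof.
move=> N0; have Nr : N%:R != 0 :> R by rewrite pnatr_eq0 -lt0n.
have : N%:R ^+ 2 * sqmod (sigma N gamma) k = fejer N (2 * pi * k%:R / N%:R).
  rewrite fejer_double sqmodE/= mulr_sumr; apply: eq_bigr => i _.
  rewrite mulr_sumr; apply: eq_bigr => j _.
  rewrite (_ : _ * (_ - _) = (i%:R - j%:R) * (2 * pi * k%:R / N%:R)); last by ring.
  by field.
rewrite fejer_root// [RHS]mulrC => /mulfI; apply.
by rewrite expf_neq0.
Qed.

Lemma cvgn_sum (I : Type) (s : seq I) (P : pred I) (f : I -> nat -> R)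
    (l : I -> R) : (forall i, f i @ \oo --> l i) ->
  (fun n => \sum_(i <- s | P i) f i n) @ \oo --> \sum_(i <- s | P i) l i.
Proof.
move=> fl; elim: s => [|i s IH].
  by rewrite big_nil; under eq_fun do rewrite big_nil; exact: cvg_cst.
rewrite big_cons; under eq_fun do rewrite big_cons.
by case: (P i) => //; exact: cvgD.
Qed.

Lemma sqmod_pseries mu r : 0 < r < 1 -> \sum_l weight (a := mu) l = 1 ->
  pseries (fun k => (k != 0%N)%:R * sqmod mu k) r @ \oo -->
  ((\sum_i \sum_j weight (a := mu) i * weight (a := mu) j *
     poisson r (node i - node j)) - 1) / 2.
Proof.
move=> r01 w1.
have -> : (\sum_i \sum_j weight (a := mu) i * weight (a := mu) j *
     poisson r (node i - node j) - 1) / 2 =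
   \sum_i \sum_j weight (a := mu) i * weight (a := mu) j *
     ((poisson r (node i - node j) - 1) / 2).
  have W : \sum_i \sum_j weight (a := mu) i * weight (a := mu) j = 1.
    by under eq_bigr do rewrite -mulr_sumr w1 mulr1.
  rewrite -[X in (_ - X) / _]W -sumrB mulr_suml; apply: eq_bigr => i _.
  rewrite -sumrB mulr_suml; apply: eq_bigr => j _; ring.
have -> : pseries (fun k => (k != 0%N)%:R * sqmod mu k) r =
   (fun n => \sum_i \sum_j weight (a := mu) i * weight (a := mu) j *
     pseries (fun k => (k != 0%N)%:R * cos (k%:R * (node i - node j))) r n).
  apply/funext => n; rewrite /pseries/series/=.
  under eq_bigr => k _.
    rewrite sqmodE mulr_sumr mulr_suml.
    under eq_bigr do rewrite mulr_sumr mulr_suml.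
    over.
  rewrite exchange_big/=; apply: eq_bigr => i _.
  rewrite exchange_big/=; apply: eq_bigr => j _.
  rewrite mulr_sumr; apply: eq_bigr => k _; ring.
apply: cvgn_sum => i; apply: cvgn_sum => j; apply: cvgMl_tmp.
exact: poisson_cvg.
Qed.

Lemma energy_split mu N r : 0 < r < 1 -> \sum_l weight (a := mu) l = 1 ->
  fejer_max N r * (\sum_i \sum_j weight (a := mu) i * weight (a := mu) j *
     poisson r (node i - node j)) =
  minor_coef N r 0 + 2 * (\sum_(1 <= m < N) minor_coef N r m * sqmod mu m) +
  \sum_i \sum_j weight (a := mu) i * weight (a := mu) j *
     (fejer N (node i - node j) * poisson r (node i - node j)).
Proof.
move=> r01 w1; apply/eqP; rewrite -subr_eq; apply/eqP.
rewrite [X in X - _]mulr_sumr -sumrB.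
transitivity (\sum_i \sum_j weight (a := mu) i * weight (a := mu) j *
   (minor_coef N r 0 + 2 * \sum_(1 <= m < N) minor_coef N r m *
     cos (m%:R * (node i - node j)))).
  apply: eq_bigr => i _; rewrite mulr_sumr -sumrB; apply: eq_bigr => j _.
  by rewrite -poisson_minorant//; ring.
under eq_bigr => i _ do (under eq_bigr => j _ do rewrite mulrDr; rewrite big_split/=).
rewrite big_split/=; congr (_ + _).
  under eq_bigr do rewrite -mulr_suml -mulr_sumr.
  by rewrite -mulr_suml -mulr_suml w1 !mul1r.
rewrite [RHS]mulr_sumr.
transitivity (\sum_i \sum_(1 <= m < N) \sum_j 2 * (minor_coef N r m *
   (weight (a := mu) i * weight (a := mu) j * cos (m%:R * (node i - node j))))).
  apply: eq_bigr => i _; rewrite exchange_big/=; apply: eq_bigr => j _.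
  by rewrite !mulr_sumr; apply: eq_bigr => k _; ring.
rewrite exchange_big/=; apply: eq_bigr => m _; rewrite sqmodE mulr_sumr mulr_sumr.
by apply: eq_bigr => i _; rewrite mulr_sumr mulr_sumr.
Qed.

Definition dcoef N mu k : R := (k != 0%N)%:R * (sqmod mu k - (N %| k)%:R).

Lemma dcoef0 N mu : dcoef N mu 0 = 0.
Proof. by rewrite /dcoef eqxx mul0r. Qed.

Lemma admissible_ge0 N mu : admissible N mu -> forall l, 0 <= weight (a := mu) l.
Proof. by move=> [_ w _ _] l; exact: ltW. Qed.

Lemma dcoef_bound N mu k : admissible N mu -> `|dcoef N mu k| <= 1.
Proof.
move=> adm; have w0 := admissible_ge0 _ _ adm; case: adm => _ _ w1 _.
have v1 := sqmod_le1 mu k w0 w1; have v0 := sqmod_ge0 mu k.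
by rewrite /dcoef; case: eqP; case: (N %| k)%N; rewrite /= ?mul0r ?mul1r ?normr0//
  ler_norml; lra.
Qed.

(** The difference of [energy_split] for [mu] and for [sigma N 0]. For the latter V(m) = 0 when 0 <
    m < N, and K_N vanishes at differences of distinct nodes, so only the diagonal N P_r(0)
    survives; set against the diagonal N^2 P_r(0) sum w_l^2 of [mu], it produces the excess. *)
Lemma dcoef_pseries N mu r : (2 <= N)%N -> 0 < r < 1 -> admissible N mu ->
  2 * fejer_max N r * limn (pseries (dcoef N mu) r) =
  2 * (\sum_(1 <= m < N) minor_coef N r m * sqmod mu m) +
  N%:R ^+ 2 * poisson r 0 * (\sum_l weight (a := mu) l ^+ 2 - N%:R^-1) +
  \sum_i \sum_(j | j != i) weight (a := mu) i * weight (a := mu) j *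
     (fejer N (node i - node j) * poisson r (node i - node j)).
Proof.
move=> N2 r01 adm; have [_ _ w1 _] := adm.
have N0 : (0 < N)%N by lia.
have NR : N%:R != 0 :> R by rewrite pnatr_eq0 -lt0n.
have s1 : \sum_l weight (a := sigma N (0 : R)) l = 1.
  rewrite (_ : \sum_l _ = \sum_(l < N) N%:R^-1)//.
  by rewrite sumr_const card_ord -[_ *+ N]mulr_natl mulfV.
have E : pseries (dcoef N mu) r =
  (fun n => pseries (fun k => (k != 0%N)%:R * sqmod mu k) r n -
    pseries (fun k => (k != 0%N)%:R * sqmod (sigma N 0) k) r n).
  apply/funext => n; rewrite /pseries/series/= -sumrB; apply: eq_bigr => k _.
  by rewrite /dcoef sqmod_sigma//; ring.
have C1 := sqmod_pseries mu r r01 w1.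
have C2 := sqmod_pseries (sigma N 0) r r01 s1.
set S1 := (X in (X - 1) / 2) in C1; set S2 := (X in (X - 1) / 2) in C2.
have -> : limn (pseries (dcoef N mu) r) = (S1 - 1) / 2 - (S2 - 1) / 2.
  by rewrite E; apply/cvg_lim => //; exact: cvgB.
have -> : 2 * fejer_max N r * ((S1 - 1) / 2 - (S2 - 1) / 2) =
  fejer_max N r * S1 - fejer_max N r * S2 by field.
rewrite /S1 /S2 !energy_split//.
have -> : \sum_(1 <= m < N) minor_coef N r m * sqmod (sigma N (0:R)) m = 0.
  rewrite big_nat_cond big1// => m; rewrite andbT => /andP[m1 mN].
  by rewrite sqmod_sigma// gtnNdvd// mulr0.
have -> : \sum_i \sum_j weight (a := sigma N (0 : R)) i * weight (a := sigma N 0) j *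
     (fejer N (node i - node j) * poisson r (node i - node j)) = N%:R * poisson r 0.
  transitivity (\sum_(i < N) (N%:R ^- 2 * (N%:R ^+ 2 * poisson r 0))).
    apply: eq_bigr => i _; rewrite (bigD1 i)//= subrr fejer0 -[RHS]addr0 -invfM.
    congr (_ + _); rewrite big1// => j ji.
    suff -> : fejer N (0 + 2 * pi * i%:R / N%:R - (0 + 2 * pi * j%:R / N%:R)) = 0 :> R.
      by rewrite mul0r mulr0.
    wlog ij : i j ji / (j < i)%N => [H|].
      have [ij|ij|ij] := ltngtP i j; last by rewrite (val_inj ij) eqxx in ji.
      - have := H j i; rewrite eq_sym ji ij => /(_ erefl erefl).
        by rewrite -fejerN opprB.
      - by apply: H.
    have -> : 0 + 2 * pi * i%:R / N%:R - (0 + 2 * pi * j%:R / N%:R) =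
      2 * pi * (i - j)%:R / N%:R :> R by rewrite natrB ?(ltnW ij)//; ring.
    rewrite fejer_root// gtnNdvd ?mul0r ?subn_gt0//.
    exact: leq_ltn_trans (leq_subr _ _) (ltn_ord i).
  by rewrite sumr_const card_ord -[_ *+ N]mulr_natl mulKf ?expf_neq0.
have -> : \sum_i \sum_j weight (a := mu) i * weight (a := mu) j *
     (fejer N (node i - node j) * poisson r (node i - node j)) =
  N%:R ^+ 2 * poisson r 0 * (\sum_l weight (a := mu) l ^+ 2) +
  \sum_i \sum_(j | j != i) weight (a := mu) i * weight (a := mu) j *
     (fejer N (node i - node j) * poisson r (node i - node j)).
  rewrite mulr_sumr -big_split/=; apply: eq_bigr => i _.
  by rewrite (bigD1 i)//= subrr fejer0; congr (_ + _); ring.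
by field.
Qed.

End Energy.

(** * Positivity and coercivity of the cubic deficit *)

Section LowerBounds.
Context {R : realType}.
Implicit Types (mu : atomic R) (r x : R) (k m n N : nat).

(** Expand sum (w_l - 1/N)^2 >= 0 and use M <= N. This is where the bound on the number of atoms
    enters the positivity of F. *)
Lemma sum_sqr_ge N mu : admissible N mu ->
  N%:R^-1 <= \sum_l weight (a := mu) l ^+ 2.
Proof.
move=> [/andP[M1 MN] w0 w1 _]; have N0 : 0 < N%:R :> R by rewrite ltr0n; lia.
have MR : (natoms mu)%:R <= N%:R :> R by rewrite ler_nat.
have : 0 <= \sum_l (weight (a := mu) l - N%:R^-1) ^+ 2.
  by apply: sumr_ge0 => i _; exact: sqr_ge0.
have -> : \sum_l (weight (a := mu) l - N%:R^-1) ^+ 2 =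
  \sum_l weight (a := mu) l ^+ 2 - 2 * N%:R^-1 + (natoms mu)%:R * N%:R ^- 2.
  under eq_bigr do rewrite sqrrB.
  rewrite big_split/= sumrB sumrMnl -mulr_suml w1 mul1r sumr_const card_ord.
  rewrite -[(_ ^+ 2) *+ natoms mu]mulr_natl exprVn; ring.
have : (natoms mu)%:R * N%:R ^- 2 <= N%:R^-1 :> R.
  rewrite -[leRHS](mulVKf (x := N%:R)) ?gt_eqF// -invfM -expr2.
  by rewrite ler_wpM2r// invr_ge0 exprn_ge0// ltW.
lra.
Qed.

Lemma fejer_max_ge1 N r : (1 <= N)%N -> 0 < r < 1 -> 1 <= fejer_max N r.
Proof.
move=> N1 /andP[r0 r1]; rewrite /fejer_max ler_wpDr ?ler1n//.
rewrite big_nat_cond sumr_ge0// => k /andP[/andP[_ kN] _].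
rewrite mulr_ge0// ?subr_ge0 ?ler_nat; first lia.
by rewrite addr_ge0// exprn_ge0// ?invr_ge0 ltW.
Qed.

Lemma minor_coef_ge0 N r m : 0 < r < 1 -> 0 <= minor_coef N r m.
Proof.
move=> /andP[r0 r1]; rewrite /minor_coef big_nat_cond sumr_ge0// => k /andP[/andP[_ kN] _].
rewrite mulr_ge0// ?subr_ge0 ?ler_nat; first lia.
apply: (@le_trans _ _ 1); first by rewrite exprn_ile1// ltW.
by rewrite exprn_ege1// invf_ge1// ltW.
Qed.

Lemma dcoef_pseries_ge0 N mu r : (2 <= N)%N -> 0 < r < 1 -> admissible N mu ->
  0 <= limn (pseries (dcoef N mu) r).
Proof.
move=> N2 r01 adm; have w0 := admissible_ge0 _ _ adm.
have k1 := fejer_max_ge1 N r (ltnW N2) r01.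
have k0 : 0 < 2 * fejer_max N r by lra.
rewrite -(pmulr_rge0 _ k0) dcoef_pseries//; rewrite !addr_ge0//.
- rewrite mulr_ge0// sumr_ge0// => m _.
  by rewrite mulr_ge0 ?minor_coef_ge0 ?sqmod_ge0.
- apply: mulr_ge0; last by rewrite subr_ge0 sum_sqr_ge.
  by apply: mulr_ge0; [exact: exprn_ge0 | exact/ltW/poisson_gt0].
- apply: sumr_ge0 => i _; apply: sumr_ge0 => j _.
  apply: mulr_ge0; first exact: mulr_ge0.
  by apply: mulr_ge0; [exact: fejer_ge0 | exact/ltW/poisson_gt0].
Qed.

(** By Bernoulli, N (1 - r) <= 1/2 keeps r^k >= 1/2 for k < N, so each bracket in kappa is at most
    3. *)
Lemma fejer_max_le N r : (1 <= N)%N -> 0 < r < 1 -> N%:R * (1 - r) <= 1 / 2 ->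
  fejer_max N r <= 4 * N%:R ^+ 2.
Proof.
move=> N1 /andP[r0 r1] Nr.
have H k : (k < N)%N -> r^-1 ^+ k + r ^+ k <= 3.
  move=> kN; have rk : 1 - r ^+ k <= 1 / 2.
    apply: le_trans (one_sub_expr_le r k _) _; first by rewrite !ltW.
    by apply: le_trans Nr; rewrite ler_wpM2r ?subr_ge0 ?(ltW r1)// ler_nat ltnW.
  have rk1 : r ^+ k <= 1 by rewrite exprn_ile1// ltW.
  have : r^-1 ^+ k <= 2 by rewrite exprVn invf_ple ?posrE ?exprn_gt0//; lra.
  lra.
rewrite /fejer_max.
have N1R : 1 <= N%:R :> R by rewrite ler1n.
apply: (@le_trans _ _ (N%:R + \sum_(1 <= k < N) N%:R * 3)).
  rewrite lerD2l; apply: ler_sum_nat => k /andP[k0 kN].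
  rewrite ler_pM ?H// ?subr_ge0 ?ler_nat ?(ltnW kN)//.
    by rewrite addr_ge0// exprn_ge0// ?invr_ge0 ltW.
  by rewrite gerBl.
rewrite sumr_const_nat -[_ *+ (N - 1)]mulr_natr natrB//; nra.
Qed.

Lemma sum_parabola n :
  \sum_(0 <= l < n) (n%:R - l%:R) * l%:R = (n%:R ^+ 3 - n%:R) / 6 :> R.
Proof.
elim: n => [|n IH]; first by rewrite big_geq//; field.
rewrite big_nat_recr//=.
have -> : \sum_(0 <= l < n) (n.+1%:R - l%:R) * l%:R =
  \sum_(0 <= l < n) (n%:R - l%:R) * l%:R + \sum_(0 <= l < n) l%:R :> R.
  by rewrite -big_split/=; apply: eq_bigr => i _; rewrite -natr1; ring.
rewrite IH.
have -> : \sum_(0 <= l < n) l%:R = n%:R * (n%:R - 1) / 2 :> R.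
  elim: n {IH} => [|n IH]; first by rewrite big_geq//; field.
  by rewrite big_nat_recr//= IH -natr1; field.
by rewrite -natr1; field.
Qed.

(** With l = k - m and n = N - m, r^-l - r^l >= 1 - r^l >= l (1 - r) / 2, so the coefficient is at
    least (1 - r) / 2 times sum (n - l) l, of order n^3 / N. The restriction on m gives n >= N/5,
    hence order N^2. *)
Lemma minor_coef_ge N r m : (10 <= N)%N -> 0 < r < 1 ->
  3 / 8 <= N%:R * (1 - r) <= 1 / 2 -> (5 * m <= 4 * N)%N ->
  N%:R ^+ 2 / (60 * 100) <= minor_coef N r m.
Proof.
move=> N10 /andP[r0 r1] /andP[Nr1 Nr2] mN.
have N10R : 10 <= N%:R :> R by rewrite (ler_nat _ 10).
pose n := (N - m)%N; have nE : N%:R - m%:R = n%:R :> R by rewrite natrB//; lia.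
have n5 : N%:R <= 5 * n%:R :> R by rewrite -natrM ler_nat; lia.
apply: (@le_trans _ _ (\sum_(0 <= l < n) (n%:R - l%:R) * (l%:R * (1 - r) / 2))).
  have -> : \sum_(0 <= l < n) (n%:R - l%:R) * (l%:R * (1 - r) / 2) =
    (1 - r) / 2 * \sum_(0 <= l < n) (n%:R - l%:R) * l%:R :> R.
    by rewrite mulr_sumr; apply: eq_bigr => l _; ring.
  rewrite sum_parabola.
  have h1 : N%:R ^+ 3 / 125 <= n%:R ^+ 3 :> R.
    have : (N%:R / 5) ^+ 3 <= n%:R ^+ 3 :> R by rewrite lerXn2r ?nnegrE//; lra.
    by rewrite (_ : (N%:R / 5) ^+ 3 = N%:R ^+ 3 / 125)//; field.
  have h2 : n%:R <= n%:R ^+ 3 / 4 :> R.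
    have : 2 <= n%:R :> R by lra.
    nra.
  have h3 : N%:R ^+ 3 * 3 / 500 <= n%:R ^+ 3 - n%:R :> R by lra.
  apply: (@le_trans _ _ ((1 - r) / 2 * (N%:R ^+ 3 * 3 / 500 / 6))); last first.
    by rewrite ler_wpM2l ?ler_wpM2r//; lra.
  have -> : (1 - r) / 2 * (N%:R ^+ 3 * 3 / 500 / 6) =
     N%:R ^+ 2 * (N%:R * (1 - r)) / (20 * 100) :> R by field.
  have : N%:R ^+ 2 * (3 / 8) <= N%:R ^+ 2 * (N%:R * (1 - r)) :> R.
    by rewrite ler_wpM2l// exprn_ge0.
  have : 0 <= N%:R ^+ 2 :> R by rewrite exprn_ge0.
  lra.
have n0 : (0 < n)%N by rewrite /n; lia.
rewrite big_ltn// !mul0r mulr0 add0r.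
rewrite /minor_coef -[m.+1]add1n big_addn -/n.
apply: ler_sum_nat => l /andP[l0 ln].
have -> : N%:R - (l + m)%:R = n%:R - l%:R :> R by rewrite natrD -nE; ring.
rewrite addnK; apply: ler_wpM2l; first by rewrite subr_ge0 ler_nat ltnW.
have lN : (l <= N)%N by apply: leq_trans (ltnW ln) _; exact: leq_subr.
have rl : 1 / 2 <= r ^+ l.
  have : 1 - r ^+ l <= 1 / 2; last by lra.
  apply: le_trans (one_sub_expr_le r l _) _; first by rewrite !ltW.
  by apply: le_trans Nr2; rewrite ler_wpM2r ?subr_ge0 ?(ltW r1)// ler_nat.
have r1l : r ^+ l <= 1 by rewrite exprn_ile1// ltW.
apply: (@le_trans _ _ (1 - r ^+ l)); last first.
  by rewrite lerD2r exprVn invf_ge1// exprn_gt0.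
rewrite -mulrA -[1 - r ^+ l]opprB subrX1 -mulNr opprB [leRHS]mulrC.
have -> : l%:R * ((1 - r) / 2) = l%:R * (1 / 2) * (1 - r) :> R by field.
rewrite ler_wpM2r ?subr_ge0 ?(ltW r1)//.
have -> : l%:R * (1 / 2) = \sum_(i < l) (1 / 2) :> R.
  by rewrite -mulr_suml sumr_const card_ord mulrA mulr1.
apply: ler_sum => i _; apply: le_trans rl _.
by rewrite ler_wiXn2l ?(ltW r0) ?(ltW r1)// ltnW.
Qed.

Lemma poisson0_ge r : 0 < r < 1 -> (1 - r)^-1 <= poisson r 0.
Proof.
move=> /andP[r0 r1]; rewrite /poisson cos0.
have r2 : 1 - r != 0 by rewrite gt_eqF// subr_gt0.
have -> : (1 - r ^+ 2) / (1 - 2 * r * 1 + r ^+ 2) = (1 + r) / (1 - r).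
  field; rewrite r2/= (_ : 1 - _ + _ = (1 - r) ^+ 2) ?expf_neq0//; ring.
by rewrite -[leLHS]mul1r ler_wpM2r ?invr_ge0 ?subr_ge0 ?(ltW r1)// lerDl ltW.
Qed.

Lemma poisson_near_ge N r x : (1 <= N)%N -> 0 < r < 1 ->
  3 / 8 <= N%:R * (1 - r) <= 1 / 2 -> N%:R ^+ 2 * (1 - cos x) <= 60 ->
  N%:R / 330 <= poisson r x.
Proof.
move=> N1 r01 /andP[Nr1 Nr2] Nx; have /andP[r0 r1] := r01.
have N0 : 0 < N%:R :> R by rewrite ltr0n.
have D0 := poisson_den_gt0 r x r01.
rewrite /poisson ler_pdivlMr//.
have D1 : N%:R ^+ 2 * (1 - 2 * r * cos x + r ^+ 2) <= 121.
  have -> : N%:R ^+ 2 * (1 - 2 * r * cos x + r ^+ 2) =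
    (N%:R * (1 - r)) ^+ 2 + 2 * r * (N%:R ^+ 2 * (1 - cos x)) by ring.
  have c0 : 0 <= N%:R ^+ 2 * (1 - cos x).
    by rewrite mulr_ge0 ?exprn_ge0 ?subr_ge0 ?cos_le1// ltW.
  have : r * (N%:R ^+ 2 * (1 - cos x)) <= 60 by rewrite (le_trans _ Nx)// ler_piMl// ltW.
  nra.
rewrite -(ler_pM2l N0).
apply: (@le_trans _ _ (121 / 330)).
  by rewrite (_ : _ * _ = N%:R ^+ 2 * (1 - 2 * r * cos x + r ^+ 2) / 330); [lra | field].
have : N%:R * (1 - r ^+ 2) = N%:R * (1 - r) * (1 + r) by ring.
nra.
Qed.

(** The cosine makes the condition insensitive to the choice of representatives. The constant 60
    exceeds (16 pi / 5)^2 / 2, so that nodes separated by a gap of at most 16 pi / (5 N) qualify. *)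
Definition close_pair N mu (i j : 'I_(natoms mu)) : bool :=
  N%:R ^+ 2 * (1 - cos (node i - node j)) <= 60 :> R.

(** The cutoff keeps N - m >= N/5, as [minor_coef_ge] requires, and still covers all m < 2n for the
    test degree n = floor(2N/5) of [exists_near_node]. *)
Definition lowfreq N mu : R :=
  \sum_(1 <= m < N | (5 * m <= 4 * N)%N) sqmod mu m.

Definition excess N mu : R := \sum_l weight (a := mu) l ^+ 2 - N%:R^-1.

Definition nearsum N mu : R := \sum_i \sum_(j | (j != i) && close_pair N mu i j)
  weight (a := mu) i * weight (a := mu) j * fejer N (node i - node j).

Lemma lowfreq_ge0 N mu : 0 <= lowfreq N mu.
Proof. by apply: sumr_ge0 => m _; exact: sqmod_ge0. Qed.

Lemma excess_ge0 N mu : admissible N mu -> 0 <= excess N mu.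
Proof. by move=> adm; rewrite subr_ge0 sum_sqr_ge. Qed.

Lemma nearsum_ge0 N mu : admissible N mu -> 0 <= nearsum N mu.
Proof.
move=> adm; have w0 := admissible_ge0 _ _ adm.
apply: sumr_ge0 => i _; apply: sumr_ge0 => j _.
by apply: mulr_ge0; [exact: mulr_ge0 | exact: fejer_ge0].
Qed.

(* The numerical constants from here on are not optimized. *)
Definition wc : R := (10 ^+ 5)^-1.

Lemma wc_gt0 : 0 < wc.
Proof. by rewrite invr_gt0 exprn_gt0. Qed.

Lemma wc_small : wc * (300 * 100) <= 1.
Proof. by rewrite /wc mulrC ler_pdivrMr ?exprn_gt0// mul1r; lra. Qed.

(** All estimates are taken at N (1 - r) of order 1: kappa <= 4 N^2 on the left, against
    [minor_coef] of order N^2, N^2 P_r(0) of order N^3, and P_r of order N on close pairs. Division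
    by 8 N^2 leaves the weights 1, N and 1/N. *)
Lemma dcoef_window N mu r : (10 <= N)%N -> admissible N mu -> 0 < r < 1 ->
  3 / 8 <= N%:R * (1 - r) <= 1 / 2 ->
  wc * (lowfreq N mu + N%:R * excess N mu + nearsum N mu / N%:R) <=
    limn (pseries (dcoef N mu) r).
Proof.
move=> N10 adm r01 Nr; have w0 := admissible_ge0 _ _ adm.
have N2 : (2 <= N)%N by lia.
have N1 : (1 <= N)%N by lia.
have /andP[r0 r1] := r01; have /andP[Nr1 Nr2] := Nr.
have N0 : 0 < N%:R :> R by rewrite ltr0n.
have N20 : 0 < 8 * N%:R ^+ 2 :> R by apply: mulr_gt0 => //; exact: exprn_gt0.
have c0 := wc_gt0; have c1 := wc_small.
rewrite -(ler_pM2l N20).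
have F0 := dcoef_pseries_ge0 N mu r N2 r01 adm.
apply: (@le_trans _ _ (2 * fejer_max N r * limn (pseries (dcoef N mu) r))); last first.
  rewrite ler_wpM2r//; have := fejer_max_le N r N1 r01 Nr2; lra.
rewrite dcoef_pseries//.
have -> : 8 * N%:R ^+ 2 *
    (wc * (lowfreq N mu + N%:R * excess N mu + nearsum N mu / N%:R)) =
  8 * wc * N%:R ^+ 2 * lowfreq N mu +
  8 * wc * N%:R ^+ 3 * excess N mu + 8 * wc * N%:R * nearsum N mu.
  by field; rewrite gt_eqF.
apply: lerD; first apply: lerD.
- have -> : 8 * wc * N%:R ^+ 2 * lowfreq N mu = 2 * (4 * wc * N%:R ^+ 2 * lowfreq N mu).
    by ring.
  apply: ler_wpM2l => //; rewrite /lowfreq mulr_sumr big_mkcond/=.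
  apply: ler_sum => m _; case: ifP => mN; last first.
    by apply: mulr_ge0; [exact: minor_coef_ge0 | exact: sqmod_ge0].
  apply: ler_wpM2r; first exact: sqmod_ge0.
  apply: le_trans (minor_coef_ge N r m N10 r01 Nr mN).
  rewrite mulrC; apply: ler_wpM2l; first by apply: exprn_ge0.
  by rewrite -[_^-1]mul1r ler_pdivlMr; lra.
- apply: ler_wpM2r; first exact: excess_ge0.
  have -> : 8 * wc * N%:R ^+ 3 = N%:R ^+ 2 * (8 * wc * N%:R) by ring.
  apply: ler_wpM2l; first by apply: exprn_ge0.
  apply: le_trans (poisson0_ge r r01).
  rewrite -[(1 - r)^-1]mul1r ler_pdivlMr ?subr_gt0//; nra.
- rewrite /nearsum mulr_sumr; apply: ler_sum => i _; rewrite mulr_sumr big_mkcondr/=.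
  apply: ler_sum => j _; case: ifP => ij; last first.
    apply: mulr_ge0; first exact: mulr_ge0.
    by apply: mulr_ge0; [exact: fejer_ge0 | exact/ltW/poisson_gt0].
  rewrite mulrC -[leLHS]mulrA; apply: ler_wpM2l; first exact: mulr_ge0.
  apply: ler_wpM2l; first exact: fejer_ge0.
  apply: le_trans (poisson_near_ge N r _ N1 r01 Nr ij).
  rewrite mulrC; apply: ler_wpM2l; first by apply: ltW.
  by rewrite -[_^-1]mul1r ler_pdivlMr; lra.
Qed.

(** The vanishing of the first coefficient lets the sum start at k = 1, and zeta(3) / N^3 is the sum
    of k^-3 over the positive multiples of N. *)
Lemma d3E N mu : (2 <= N)%N -> admissible N mu -> fourier mu 1 = 0 ->
  d3 N mu = limn (series (fun k => dcoef N mu k / k%:R ^+ 3)).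
Proof.
move=> N2 adm f1; have w0 := admissible_ge0 _ _ adm; have [_ _ w1 _] := adm.
have N0 : (0 < N)%N by lia.
have s1 : sqmod mu 1 = 0.
  by rewrite /sqmod f1 /Normc.normc /= expr0n/= addr0 sqrtr0 expr0n.
pose f k : R := (k != 0%N)%:R * sqmod mu k / k%:R ^+ 3.
pose g k : R := (k != 0%N)%:R * (N %| k)%:R / k%:R ^+ 3.
have bnd (u : nat -> R) : (forall k, 0 <= u k <= 1) ->
    cvgn (series (fun k => (k != 0%N)%:R * u k / k%:R ^+ 3)).
  move=> u01; apply: (@is_cvg_dom2 _ _ 1) => -[|k].
    by rewrite !mul0r normr0 expr0n/= invr0 mulr0.
  have /andP[u0 u1] := u01 k.+1.
  rewrite !mul1r ger0_norm ?divr_ge0 ?exprn_ge0//.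
  rewrite ler_pdivrMr ?exprn_gt0// exprS mulrCA mulVf ?mulr1.
    by apply: le_trans u1 _; rewrite ler1n.
  by rewrite expr1 mulf_neq0// pnatr_eq0.
have cf : cvgn (series f) by apply: bnd => k; rewrite sqmod_ge0 sqmod_le1.
have cg : cvgn (series g) by apply: bnd => k; case: (N %| k)%N; rewrite /= ?ler01 ?lexx.
have -> : (fun k => dcoef N mu k / k%:R ^+ 3) = f - g.
  by apply/funext => k; rewrite !fctE /f /g /dcoef; ring.
rewrite lim_seriesB// /d3; congr (_ - _).
  rewrite sum_fromE; congr (limn (series _)); apply/funext => -[|[|k]]//=.
  - by rewrite /f !mul0r.
  - by rewrite /f s1 mulr0 !mul0r.
  - by rewrite /f !mul1r.
rewrite /zeta sum_fromE.
set h := (fun k => _).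
have ch : cvgn (series h).
  have -> : h = (fun k => (k != 0%N)%:R * 1 / k%:R ^+ 3).
    by apply/funext => -[|k]; rewrite /h /= ?mul0r// !mul1r.
  by apply: bnd => k; rewrite ler01 lexx.
rewrite -[LHS]mulrC -lim_seriesM//.
have gE : (fun j => g (j * N)%N) = (fun j => (N%:R ^+ 3)^-1 * h j).
  apply/funext => -[|j]; first by rewrite /g /h mul0n !mul0r mulr0.
  rewrite /g /h dvdn_mull// mulr1 (_ : (j.+1 * N)%N != 0%N); last by lia.
  by rewrite /= !mul1r natrM exprMn invfM mulrC.
have gN k : ~~ (N %| k)%N -> g k = 0.
  by move=> kN; rewrite /g (negbTE kN) mulr0 mul0r.
have := cvg_series_multiples N g N0 gN cg; rewrite gE => H.
by apply/cvg_lim => //; exact: H.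
Qed.

Lemma d3_lower N mu : (10 <= N)%N -> admissible N mu -> fourier mu 1 = 0 ->
  wc * (lowfreq N mu + N%:R * excess N mu + nearsum N mu / N%:R) <=
    (8 * N%:R) ^+ 3 * d3 N mu.
Proof.
move=> N10 adm f1; have N2 : (2 <= N)%N by lia.
have N0 : 0 < N%:R :> R by rewrite ltr0n; lia.
have N10R : 10 <= N%:R :> R by rewrite (ler_nat _ 10).
have c0 := wc_gt0.
rewrite d3E//.
set L := wc * _.
(* The window 3/8 <= N (1 - r) <= 1/2 is exactly [1 - 4 eta, 1 - 3 eta]; the two remaining
   integrations of length eta end at 1 - eta, still below 1. *)
pose eta : R := (8 * N%:R)^-1.
have e0 : 0 < eta by rewrite invr_gt0; apply: mulr_gt0.
have eN : N%:R * eta = 1 / 8 by rewrite /eta; field; rewrite gt_eqF.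
have e1 : eta <= 1 / 80 by nra.
rewrite -ler_pdivrMl ?exprn_gt0//; last by apply: mulr_gt0.
rewrite mulrC -exprVn -/eta.
apply: (@series_cube_ge _ (dcoef N mu) 1 L (1 - 4 * eta) eta) => //.
- by move=> k; exact: dcoef_bound.
- exact: dcoef0.
- apply: mulr_ge0; first exact: ltW.
  apply: addr_ge0; first apply: addr_ge0.
  + exact: lowfreq_ge0.
  + by apply: mulr_ge0 => //; exact: excess_ge0.
  + by apply: divr_ge0 => //; exact: nearsum_ge0.
- lra.
- exact: ltW.
- lra.
- by move=> r r0 r1; apply: dcoef_pseries_ge0 => //; rewrite r0.
- move=> r rx ry; apply: dcoef_window => //; first by apply/andP; split; lra.
  by apply/andP; split; nra.
Qed.

Lemma d3_ge0 N mu : (10 <= N)%N -> admissible N mu -> fourier mu 1 = 0 ->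
  0 <= d3 N mu.
Proof.
move=> N10 adm f1; have N0 : 0 < N%:R :> R by rewrite ltr0n; lia.
have p0 : 0 < (8 * N%:R) ^+ 3 :> R by apply: exprn_gt0; apply: mulr_gt0.
rewrite -(pmulr_rge0 _ p0); apply: le_trans (d3_lower N mu N10 adm f1).
apply: mulr_ge0; first exact/ltW/wc_gt0.
apply: addr_ge0; first apply: addr_ge0.
- exact: lowfreq_ge0.
- by apply: mulr_ge0 => //; exact: excess_ge0.
- by apply: divr_ge0 => //; exact: nearsum_ge0.
Qed.

End LowerBounds.

(** * Gaps between nodes *)

Section Trig.
Context {R : realType}.
Implicit Types (x y : R).

Lemma ge0_of_derive (f df : R -> R) x : 0 <= x -> f 0 = 0 ->
  (forall y, is_derive y 1 f (df y)) -> (forall y, 0 < y -> 0 <= df y) -> 0 <= f x.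
Proof.
rewrite le_eqVlt => /predU1P[<- ->//|x0] f0 fd df0.
have [|c] := MVT x0 (fun y _ => fd y).
  by apply: derivable_within_continuous => y _; have [] := fd y.
rewrite in_itv/= => /andP[c0 _]; rewrite f0 !subr0 => ->.
by rewrite mulr_ge0 ?df0// ltW.
Qed.

Lemma sin_le_id x : 0 <= x -> sin x <= x.
Proof.
move=> x0; rewrite -subr_ge0.
apply: (@ge0_of_derive (fun x => x - sin x) (fun x => 1 - cos x)) => //.
by rewrite sin0 subrr.
Qed.

Lemma sin_sqr_le x : sin x ^+ 2 <= x ^+ 2.
Proof.
wlog x0 : x / 0 <= x => [H|].
  have [x0|x0] := leP 0 x; first exact: H.
  by rewrite -[x ^+ 2]sqrrN -[sin x ^+ 2]sqrrN -sinN H// oppr_ge0 ltW.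
have [xp|xp] := leP x pi.
  by rewrite lerXn2r ?nnegrE ?sin_le_id// sin_ge0_pi// x0.
apply: (@le_trans _ _ 1).
  by have := sin2cos2 x; have := sqr_ge0 (cos x); lra.
by have := pi_ge2 R; nra.
Qed.

Lemma one_sub_cosE x : 1 - cos x = 2 * sin (x / 2) ^+ 2.
Proof.
have {1}-> : x = (x / 2) *+ 2 by rewrite mulr2n -splitr.
by rewrite cos_mulr2n cos2sin2 mulr2n; ring.
Qed.

Lemma one_sub_cos_le x : 1 - cos x <= x ^+ 2 / 2.
Proof.
by rewrite one_sub_cosE; have := sin_sqr_le (x / 2); rewrite exprMn; lra.
Qed.

Lemma sin_ge_cubic x : 0 <= x -> x - x ^+ 3 / 6 <= sin x.
Proof.
move=> x0; rewrite -subr_ge0.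
apply: (@ge0_of_derive (fun x => sin x - (x - x ^+ 3 / 6))
  (fun x => cos x - (1 - x ^+ 2 / 2))) => //.
- by rewrite sin0 expr0n/=; lra.
- move=> y; have -> : (fun x : R => sin x - (x - x ^+ 3 / 6)) =
     (fun x : R => sin x - (x - 6^-1 *: x ^+ 3)).
    by apply/funext => z; rewrite mulrC.
  apply: is_derive_eq; by rewrite /GRing.scale/= ?mulr1; field.
- by move=> y y0; have := one_sub_cos_le y; lra.
Qed.

Lemma one_sub_cos_ge x : 0 <= x -> x <= 2 -> x ^+ 2 / 2 - x ^+ 4 / 24 <= 1 - cos x.
Proof.
move=> x0 x2; rewrite one_sub_cosE.
have h0 : 0 <= x / 2 by lra.
have := sin_ge_cubic _ h0; set s := sin _; rewrite exprMn => hs.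
have h1 : 0 <= x / 2 - x ^+ 3 * 2^-1 ^+ 3 / 6.
  have -> : x / 2 - x ^+ 3 * 2^-1 ^+ 3 / 6 = x / 2 * (1 - x ^+ 2 / 24) by field.
  by apply: mulr_ge0 => //; nra.
have : (x / 2 - x ^+ 3 * 2^-1 ^+ 3 / 6) ^+ 2 <= s ^+ 2.
  by rewrite lerXn2r ?nnegrE//; apply: le_trans hs.
have -> : (x / 2 - x ^+ 3 * 2^-1 ^+ 3 / 6) ^+ 2 =
   x ^+ 2 / 4 - x ^+ 4 / 48 + x ^+ 6 / (48 * 48) by field.
have : 0 <= x ^+ 6 / (48 * 48) by rewrite divr_ge0// exprn_ge0.
lra.
Qed.

(** For a = pi/6, the identity sin 3a = 1 reads (sin a + 1) (2 sin a - 1)^2 = 0, so sin a = 1/2, and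
    sin a <= a. *)
Lemma pi_ge3 : 3 <= pi :> R.
Proof.
have p2 := pi_ge2 R; have p4 := pihalf_lt2 R.
pose a : R := pi / 6.
have s0 : 0 < sin a by apply: sin_gt0_pi; apply/andP; split; rewrite /a; lra.
have E : sin (a *+ 2 + a) = 1.
  by rewrite (_ : a *+ 2 + a = pi / 2) ?sin_pihalf// /a mulr2n; field.
rewrite sinD sin_mulr2n cos_mulr2n !mulr2n cos2sin2 in E.
have E2 : cos a * cos a = 1 - sin a ^+ 2 by rewrite -cos2sin2 expr2.
have {}E : (sin a + 1) * (2 * sin a - 1) ^+ 2 = 0.
  have : (cos a * sin a + cos a * sin a) * cos a = 2 * sin a * (1 - sin a ^+ 2).
    by rewrite -E2; ring.
  move=> H; rewrite H in E.
  have -> : (sin a + 1) * (2 * sin a - 1) ^+ 2 = 1 - (2 * sin a * (1 - sin a ^+ 2) +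
     (1 - sin a ^+ 2 + (1 - sin a ^+ 2) - 1) * sin a) by ring.
  by rewrite E subrr.
move/eqP: E; rewrite mulf_eq0 sqrf_eq0 => /orP[/eqP|/eqP] h; first lra.
have a0 : 0 <= a by rewrite /a; lra.
by have := sin_le_id _ a0; rewrite /a in h *; lra.
Qed.

(** If pi/2 were at least 8/5, cos(8/5) would be nonnegative, while [one_sub_cos_ge] gives 1 -
    cos(8/5) > 1. *)
Lemma pi_lt : pi < 16 / 5 :> R.
Proof.
have [h|//] := leP (16 / 5) (pi : R).
have : 0 <= cos (8 / 5 : R) by apply: cos_ge0_pihalf; apply/andP; split; lra.
have h0 : 0 <= 8 / 5 :> R by lra.
have h1 : 8 / 5 <= 2 :> R by lra.
by have := one_sub_cos_ge _ h0 h1; lra.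
Qed.

End Trig.

(** * Long gaps excluded by a trigonometric test function *)

Section Gap.
Context {R : realType}.
Variables (mu : atomic R) (tau : R).

Definition cmoment (k : nat) : R :=
  \sum_i weight (a := mu) i * cos (k%:R * (node i - tau)).

Definition test (f : R -> R) : R := \sum_i weight (a := mu) i * f (node i - tau).

(** [cmoment k] is the real part of the k-th coefficient of [mu] rotated by [tau], and rotation
    preserves the modulus. *)
Lemma cmoment_sqr k : cmoment k ^+ 2 <= sqmod mu k.
Proof.
rewrite /cmoment sqmod_sqr.
set C := (X in X ^+ 2 + _); set S := (X in _ + X ^+ 2).
have -> : \sum_i weight (a := mu) i * cos (k%:R * (node i - tau)) =
   cos (k%:R * tau) * C + sin (k%:R * tau) * S.
  rewrite !mulr_sumr -big_split/=; apply: eq_bigr => i _.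
  by rewrite mulrBr cosB; ring.
have := cos2Dsin2 (k%:R * tau); set c := cos _; set s := sin _ => cs.
have -> : C ^+ 2 + S ^+ 2 = (c * C + s * S) ^+ 2 + (c * S - s * C) ^+ 2.
  by rewrite -[LHS]mulr1 -cs; ring.
by rewrite lerDl sqr_ge0.
Qed.

Lemma testD f g : test (fun x => f x + g x) = test f + test g.
Proof. by rewrite -big_split/=; apply: eq_bigr => i _; rewrite mulrDr. Qed.

Lemma testZ c f : test (fun x => c * f x) = c * test f.
Proof. by rewrite mulr_sumr; apply: eq_bigr => i _; rewrite mulrCA. Qed.

Lemma test_sum m n (f : nat -> R -> R) :
  test (fun x => \sum_(m <= k < n) f k x) = \sum_(m <= k < n) test (f k).
Proof.
rewrite exchange_big/=; apply: eq_bigr => i _; rewrite mulr_sumr.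
by apply: eq_bigr => k _.
Qed.

Hypothesis w1 : \sum_i weight (a := mu) i = 1.

Lemma cmoment0 : cmoment 0 = 1.
Proof. by rewrite -[RHS]w1; apply: eq_bigr => i _; rewrite mul0r cos0 mulr1. Qed.

Lemma test_fejer n : test (fejer n) =
  n%:R + 2 * \sum_(1 <= k < n) (n%:R - k%:R) * cmoment k.
Proof.
rewrite {1}/fejer testD testZ test_sum; congr (_ + 2 * _).
  by rewrite /test -mulr_suml w1 mul1r.
by apply: eq_bigr => k _; rewrite testZ.
Qed.

(** The product formula for cosines; [maxn k l - minn k l] is |k - l| in [nat]. *)
Lemma cosM_fejer n l (x : R) : cos (l%:R * x) * fejer n x = n%:R * cos (l%:R * x) +
  \sum_(1 <= k < n) (n%:R - k%:R) *
    (cos ((k + l)%:R * x) + cos ((maxn k l - minn k l)%:R * x)).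
Proof.
rewrite /fejer mulrDr mulrC mulrA mulrC; congr (_ + _).
rewrite mulr_sumr; apply: eq_bigr => k _.
have -> : cos ((maxn k l - minn k l)%:R * x) = cos (k%:R * x - l%:R * x).
  have [kl|lk] := leqP k l.
    by rewrite natrB// mulrBl -cosN opprB.
  by rewrite natrB ?(ltnW lk)// mulrBl.
by rewrite natrD [(k%:R + l%:R) * x]mulrDl cosB cosD; ring.
Qed.

Lemma test_cosM_fejer n l : test (fun x => cos (l%:R * x) * fejer n x) =
  n%:R * cmoment l + \sum_(1 <= k < n) (n%:R - k%:R) *
    (cmoment (k + l) + cmoment (maxn k l - minn k l)).
Proof.
transitivity (test (fun x => n%:R * cos (l%:R * x) +
  \sum_(1 <= k < n) (n%:R - k%:R) *
    (cos ((k + l)%:R * x) + cos ((maxn k l - minn k l)%:R * x)))).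
  by apply: eq_bigr => i _; rewrite cosM_fejer.
rewrite testD testZ test_sum; congr (_ + _); apply: eq_bigr => k _.
by rewrite testZ testD.
Qed.

Variables (n : nat) (E : R).
Hypothesis n0 : (0 < n)%N.
Hypothesis HE : \sum_(1 <= m < n.*2) `|cmoment m| <= E.

Let E0 : 0 <= E. Proof. by apply: le_trans HE; apply: sumr_ge0. Qed.

Let sum_range a b : (1 <= a)%N -> (b <= n.*2)%N ->
  \sum_(a <= m < b) `|cmoment m| <= E.
Proof.
move=> a1 bn; have [ba|ab] := leqP b a; first by rewrite big_geq.
apply: le_trans HE; rewrite [leRHS](@big_cat_nat _ _ _ a)//=; last lia.
rewrite [X in _ <= _ + X](@big_cat_nat _ _ _ b)//=; last exact: ltnW.
by rewrite addrCA lerDl addr_ge0// sumr_ge0.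
Qed.

Let weighted_le (e : nat -> R) a b : (1 <= a)%N -> (b <= n)%N ->
  \sum_(a <= k < b) `|e k| <= E ->
  `|\sum_(a <= k < b) (n%:R - k%:R) * e k| <= n%:R * E.
Proof.
move=> a1 bn eE; apply: le_trans (ler_norm_sum _ _ _) _.
apply: (@le_trans _ _ (n%:R * \sum_(a <= k < b) `|e k|)); last by rewrite ler_wpM2l.
rewrite mulr_sumr; apply: ler_sum_nat => k /andP[ak kb].
have kn : k%:R <= n%:R :> R by rewrite ler_nat; lia.
by rewrite normrM ler_wpM2r// ger0_norm ?subr_ge0// gerBl.
Qed.

Let shift_le l : (l <= n)%N -> \sum_(1 <= k < n) `|cmoment (k + l)| <= E.
Proof.
move=> ln; have -> : \sum_(1 <= k < n) `|cmoment (k + l)| =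
    \sum_(1 + l <= m < n + l) `|cmoment m|.
  by rewrite big_addn addnK.
by apply: sum_range; lia.
Qed.

Let below_le l : (l <= n)%N ->
  \sum_(1 <= k < l) `|cmoment (maxn k l - minn k l)| <= E.
Proof.
move=> ln; have -> : \sum_(1 <= k < l) `|cmoment (maxn k l - minn k l)| =
    \sum_(1 <= m < l) `|cmoment m|.
  rewrite [RHS]big_nat_rev/=; apply: eq_big_nat => k /andP[k1 kl].
  by congr `|cmoment _|; lia.
by apply: sum_range; lia.
Qed.

Let above_le l : (l <= n)%N ->
  \sum_(l.+1 <= k < n) `|cmoment (maxn k l - minn k l)| <= E.
Proof.
move=> ln; have -> : \sum_(l.+1 <= k < n) `|cmoment (maxn k l - minn k l)| =
    \sum_(1 <= m < n - l) `|cmoment m|.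
  rewrite -[l.+1]add1n big_addn; apply: eq_big_nat => k /andP[k1 kl].
  by congr `|cmoment _|; lia.
by apply: sum_range; lia.
Qed.

(** Here and in the next bounds, [HE] makes the nonzero frequencies below 2n negligible, so each
    test differs from the mean of the trigonometric polynomial over the circle by an error
    controlled by E. *)
Lemma test_fejer_le : test (fejer n) <= n%:R + 2 * (n%:R * E).
Proof.
rewrite test_fejer lerD2l ler_pM2l//; apply: le_trans (ler_norm _) _.
by apply: weighted_le => //; apply: sum_range => //; lia.
Qed.

Lemma test_fejer_ge : n%:R - 2 * (n%:R * E) <= test (fejer n).
Proof.
rewrite test_fejer lerD2l -mulrN ler_pM2l// lerNl; apply: le_trans (ler_norm _) _.
by rewrite normrN; apply: weighted_le => //; apply: sum_range => //; lia.
Qed.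

Lemma norm_cmoment_le l : (1 <= l <= n)%N -> `|cmoment l| <= E.
Proof.
move=> ln; have := sum_range l l.+1; rewrite big_nat1; apply; lia.
Qed.

Lemma test_cosn_fejer_ge :
  - (3 * (n%:R * E)) <= test (fun x => cos (n%:R * x) * fejer n x).
Proof.
rewrite test_cosM_fejer.
under eq_bigr do rewrite mulrDr.
rewrite big_split/=.
have := weighted_le (fun k => cmoment (k + n)) 1 n isT (leqnn n) (shift_le n (leqnn n)).
have := weighted_le (fun k => cmoment (maxn k n - minn k n)) 1 n isT (leqnn n)
  (below_le n (leqnn n)).
have : `|n%:R * cmoment n| <= n%:R * E.
  by rewrite normrM ger0_norm// ler_wpM2l// norm_cmoment_le// n0 leqnn.
rewrite !ler_norml => /andP[? _] /andP[? _] /andP[? _]; lra.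
Qed.

Lemma test_cosM_fejer_ge l : (1 <= l < n)%N ->
  (n%:R - l%:R) - 4 * (n%:R * E) <= test (fun x => cos (l%:R * x) * fejer n x).
Proof.
move=> /andP[l1 ln]; rewrite test_cosM_fejer.
under eq_bigr do rewrite mulrDr.
rewrite big_split/= [X in _ <= _ + (_ + X)](@big_cat_nat _ _ _ l)//=; last exact: ltnW.
(* The term k = l contains the zeroth moment 1 and contributes the mean n - l; the others are split
   at l because |k - l| changes form there. *)
rewrite [X in _ <= _ + (_ + (_ + X))]big_ltn// maxnn minnn subnn cmoment0 mulr1.
have := weighted_le (fun k => cmoment (k + l)) 1 n isT (leqnn n) (shift_le l (ltnW ln)).
have := weighted_le (fun k => cmoment (maxn k l - minn k l)) 1 l isT (ltnW ln)
  (below_le l (ltnW ln)).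
have := weighted_le (fun k => cmoment (maxn k l - minn k l)) l.+1 n isT (leqnn n)
  (above_le l (ltnW ln)).
have : `|n%:R * cmoment l| <= n%:R * E.
  by rewrite normrM ger0_norm// ler_wpM2l// norm_cmoment_le// l1 ltnW.
rewrite !ler_norml => /andP[? _] /andP[? _] /andP[? _] /andP[? _]; lra.
Qed.

Let sum_squares : n%:R ^+ 2 + 2 * \sum_(1 <= l < n) (n%:R - l%:R) ^+ 2 =
  (2 * n%:R ^+ 3 + n%:R) / 3 :> R.
Proof.
have -> : \sum_(1 <= l < n) (n%:R - l%:R) ^+ 2 = \sum_(1 <= l < n) l%:R ^+ 2 :> R.
  rewrite [RHS]big_nat_rev/=; apply: eq_big_nat => k /andP[k1 kn].
  by rewrite add1n subSS natrB// ltnW.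
case: n n0 => // m _; elim: m => [|m IH]; first by rewrite big_geq//; field.
rewrite big_nat_recr//= mulrDr; move: IH; rewrite -[m.+2%:R]natr1.
set a := 2 * \sum_(_ <= _ < _) _; set b := m.+1%:R => IH.
have -> : a = (2 * b ^+ 3 + b) / 3 - b ^+ 2 by rewrite -IH; ring.
by field.
Qed.

(** The mean of K_n^2 is n^2 + 2 sum (n - l)^2 = (2 n^3 + n) / 3; the errors of the individual
    moments add up to at most 10 n^3 E. *)
Lemma test_fejer_sqr_ge : n%:R ^+ 3 * (2 / 3 - 10 * E) <=
  test (fun x => fejer n x ^+ 2).
Proof.
have -> : test (fun x => fejer n x ^+ 2) = n%:R * test (fejer n) +
    2 * \sum_(1 <= l < n) (n%:R - l%:R) * test (fun x => cos (l%:R * x) * fejer n x).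
  transitivity (test (fun x => n%:R * fejer n x + 2 * \sum_(1 <= l < n)
      (n%:R - l%:R) * (cos (l%:R * x) * fejer n x))).
    apply: eq_bigr => i _; congr (_ * _); rewrite expr2 {1}/fejer mulrDl -mulrA mulr_suml.
    by congr (_ + 2 * _); apply: eq_bigr => l _; rewrite mulrA.
  rewrite testD !testZ test_sum; congr (_ + 2 * _).
  by apply: eq_bigr => l _; rewrite testZ.
have n1 : 1 <= n%:R :> R by rewrite ler1n.
have h1 := test_fejer_ge.
have h2 : \sum_(1 <= l < n) ((n%:R - l%:R) ^+ 2 - 4 * (n%:R ^+ 2 * E)) <=
  \sum_(1 <= l < n) (n%:R - l%:R) * test (fun x => cos (l%:R * x) * fejer n x).
  apply: ler_sum_nat => l /andP[l1 ln].
  have nl : 0 <= n%:R - l%:R :> R by rewrite subr_ge0 ler_nat ltnW.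
  have l0 : 0 <= l%:R :> R by [].
  apply: le_trans (ler_wpM2l nl (test_cosM_fejer_ge l _)); last by rewrite l1.
  have : 0 <= l%:R * (n%:R * E) by rewrite !mulr_ge0.
  nra.
rewrite sumrB sumr_const_nat -[_ *+ (n - 1)]mulr_natr natrB// in h2.
have nE : 0 <= n%:R ^+ 2 * E by rewrite mulr_ge0// exprn_ge0.
have h3 : n%:R * (n%:R - 2 * (n%:R * E)) <= n%:R * test (fejer n) by rewrite ler_wpM2l.
have h4 : 4 * (n%:R ^+ 2 * E) * (n%:R - 1) <= 4 * (n%:R ^+ 3 * E).
  have -> : 4 * (n%:R ^+ 3 * E) = 4 * (n%:R ^+ 2 * E) * n%:R by ring.
  by rewrite ler_wpM2l; lra.
have h5 : n%:R ^+ 2 * E <= n%:R ^+ 3 * E.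
  by rewrite [n%:R ^+ 3]exprSr ler_wpM2r// ler_peMr// exprn_ge0.
have := sum_squares; lra.
Qed.

(* The function (cos x - (1 - b)) * fejer n x ^+ 2 is nonpositive at every node,
   whereas its mean is positive when b is large compared with n^-2. *)
Lemma gap_estimate b : 0 <= b -> (forall l, 0 <= weight (a := mu) l) ->
  (forall l, cos (node (a := mu) l - tau) <= 1 - b) ->
  b * n%:R ^+ 2 * (2 / 3 - 10 * E) <= 1 + 5 * E.
Proof.
move=> b0 w0 gap.
have nR : 0 < n%:R :> R by rewrite ltr0n.
have H : b * test (fun x => fejer n x ^+ 2) <=
    test (fun x => fejer n x) - test (fun x => cos (n%:R * x) * fejer n x).
  rewrite -testZ /test -sumrB; apply: ler_sum => i _; rewrite -mulrBr.
  apply: ler_wpM2l => //; set x := node i - tau.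
  (* By [fejerE], (1 - cos x) K_n^2 = (1 - cos nx) K_n, whose mean is only n, whereas K_n^2 has mean
     of order n^3. *)
  have -> : fejer n x - cos (n%:R * x) * fejer n x = (1 - cos x) * fejer n x ^+ 2.
    by rewrite expr2 mulrA [(1 - _) * _]mulrC fejerE; ring.
  by rewrite ler_wpM2r ?sqr_ge0//; have := gap i; rewrite -/x; lra.
have h1 := ler_wpM2l b0 test_fejer_sqr_ge.
have h2 := test_fejer_le; have h3 := test_cosn_fejer_ge.
rewrite -(ler_pM2l nR).
have -> : n%:R * (b * n%:R ^+ 2 * (2 / 3 - 10 * E)) =
  b * (n%:R ^+ 3 * (2 / 3 - 10 * E)) by ring.
lra.
Qed.

End Gap.

Section Nodes.
Context {R : realType}.

Definition gap_eps : R := (10 ^+ 3)^-1.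

Lemma gap_epsE : gap_eps * 10 ^+ 3 = 1.
Proof. by rewrite mulVf// expf_neq0. Qed.

(** Otherwise [gap_estimate] applies with n = floor(2N/5) and b = 1 - cos(8 pi / (5 N)). Then b n^2
    is about (16 pi / 25)^2 / 2, close to 2.02, while that estimate allows at most 3/2 as E tends to
    0; N >= 200 and [gap_eps] absorb the rounding and E. *)
Lemma exists_near_node N (mu : atomic R) tau : (200 <= N)%N -> admissible N mu ->
  N%:R * lowfreq N mu <= gap_eps ^+ 2 ->
  exists i, cos (8 / 5 * pi / N%:R) < cos (node (a := mu) i - tau).
Proof.
move=> N200 adm lowN; have w0 := admissible_ge0 _ _ adm; have [_ _ w1 _] := adm.
apply: contrapT => /forallNP gap.
have N0 : 0 < N%:R :> R by rewrite ltr0n; lia.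
have N200R : 200 <= N%:R :> R by rewrite (ler_nat _ 200).
have eE := gap_epsE; set e := gap_eps in lowN eE.
have e0 : 0 < e by rewrite /e invr_gt0 exprn_gt0.
pose n := (2 * N %/ 5)%N.
have nN : (5 * n <= 2 * N < 5 * n + 5)%N.
  have := divn_eq (2 * N) 5; have := ltn_mod (2 * N) 5; rewrite -/n; lia.
have n0 : (0 < n)%N by lia.
have nN1 : 5 * n%:R <= 2 * N%:R :> R by rewrite -!natrM ler_nat; lia.
have nN2 : 2 * N%:R <= 5 * n%:R + 4 :> R by rewrite -!natrM -natrD ler_nat; lia.
have HE : \sum_(1 <= m < n.*2) `|cmoment mu tau m| <= e.
  (* The inequality |c| <= e / (2N) + N c^2 / (2e) turns the bound e^2 on N times the sum of squares
     into a bound e on the sum of absolute values, as there are fewer than 4N/5 frequencies. *)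
  apply: (@le_trans _ _ (\sum_(1 <= m < n.*2)
      (e / (2 * N%:R) + N%:R / (2 * e) * sqmod mu m))).
    apply: ler_sum_nat => m _.
    apply: (@le_trans _ _ (e / (2 * N%:R) + N%:R / (2 * e) * `|cmoment mu tau m| ^+ 2)).
      rewrite -subr_ge0; set c := `|_|.
      have -> : e / (2 * N%:R) + N%:R / (2 * e) * c ^+ 2 - c =
        (N%:R / (2 * e)) * (c - e / N%:R) ^+ 2 by field; rewrite !gt_eqF.
      by rewrite mulr_ge0 ?sqr_ge0// divr_ge0 ?mulr_ge0// ltW.
    rewrite lerD2l ler_wpM2l//; last by rewrite real_normK ?num_real// cmoment_sqr.
    by rewrite divr_ge0 ?mulr_ge0// ltW.
  have -> : \sum_(1 <= m < n.*2) (e / (2 * N%:R) + N%:R / (2 * e) * sqmod mu m) =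
      (n.*2 - 1)%:R * (e / (2 * N%:R)) +
      N%:R / (2 * e) * \sum_(1 <= m < n.*2) sqmod mu m.
    by rewrite big_split/= mulr_sumr sumr_const_nat -[_ *+ (n.*2 - 1)]mulr_natl.
  have low : \sum_(1 <= m < n.*2) sqmod mu m <= lowfreq N mu.
    rewrite (big_nat_widen _ _ N); last by lia.
    rewrite /lowfreq big_mkcond [leRHS]big_mkcond/=; apply: ler_sum_nat => m _.
    case: ifP => [mn|_]; last by case: ifP => // _; exact: sqmod_ge0.
    by rewrite ifT//; lia.
  have h1 : (n.*2 - 1)%:R * (e / (2 * N%:R)) <= e * (2 / 5).
    apply: (@le_trans _ _ ((2 * n%:R) * (e / (2 * N%:R)))).
      rewrite ler_wpM2r//; first by rewrite divr_ge0 ?mulr_ge0// ltW.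
      by rewrite -natrM ler_nat; lia.
    have -> : 2 * n%:R * (e / (2 * N%:R)) = e * (n%:R / N%:R) by field; rewrite gt_eqF.
    by rewrite ler_pM2l// ler_pdivrMr//; lra.
  have h2 : N%:R / (2 * e) * lowfreq N mu <= e / 2.
    have -> : N%:R / (2 * e) * lowfreq N mu = (N%:R * lowfreq N mu) / (2 * e).
      by field; rewrite gt_eqF.
    rewrite ler_pdivrMr ?mulr_gt0//; apply: le_trans lowN _.
    by rewrite (_ : e / 2 * (2 * e) = e ^+ 2)//; field.
  have h3 : N%:R / (2 * e) * \sum_(1 <= m < n.*2) sqmod mu m <=
      N%:R / (2 * e) * lowfreq N mu.
    by rewrite ler_wpM2l// divr_ge0 ?mulr_ge0// ltW.
  lra.
pose z : R := 8 / 5 * pi / N%:R.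
have p3 : 3 <= pi :> R := pi_ge3; have p4 : pi < 16 / 5 :> R := pi_lt.
have zN : z * N%:R = 8 / 5 * pi by rewrite /z; field; rewrite gt_eqF.
have z0 : 0 < z by rewrite /z divr_gt0// mulr_gt0// pi_gt0.
have z1 : z <= 13 / 500 by nra.
have b1 : z ^+ 2 / 2 - z ^+ 4 / 24 <= 1 - cos z by apply: one_sub_cos_ge; lra.
pose b := 1 - cos z.
have b0 : 0 <= b by rewrite /b subr_ge0 cos_le1.
have := @gap_estimate _ mu tau w1 n e n0 HE b b0 w0.
have -> : 1 - b = cos z by rewrite /b; ring.
have H l : cos (node (a := mu) l - tau) <= cos z by rewrite leNgt; apply/negP/gap.
move=> /(_ H).
have zn : 24 / 5 <= z * N%:R by rewrite zN; lra.
have z2 : z ^+ 2 * (499 / 1000) <= b.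
  apply: le_trans b1.
  have -> : z ^+ 2 / 2 - z ^+ 4 / 24 = z ^+ 2 * (1 / 2 - z ^+ 2 / 24) by field.
  by rewrite ler_wpM2l ?exprn_ge0 ?ltW//; nra.
have zn2 : 47 / 25 <= z * n%:R.
  have : z * (2 * N%:R) <= z * (5 * n%:R + 4) by rewrite ler_pM2l.
  lra.
have bn : 88 / 50 <= b * n%:R ^+ 2.
  apply: (@le_trans _ _ (z ^+ 2 * (499 / 1000) * n%:R ^+ 2)); last first.
    by rewrite ler_wpM2r// exprn_ge0.
  have -> : z ^+ 2 * (499 / 1000) * n%:R ^+ 2 = (499 / 1000) * (z * n%:R) ^+ 2 by ring.
  have : (47 / 25) ^+ 2 <= (z * n%:R) ^+ 2 by rewrite lerXn2r ?nnegrE; lra.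
  lra.
have e3 : e <= 1 / 1000 by lra.
nra.
Qed.

End Nodes.

(** * Arcs of the circle and the Fejer kernel on one gap *)

Section Circle.
Context {R : realType}.
Implicit Types (x y z : R).

Lemma to_circleP x y :
  reflect (exists m : int, x - y = m%:~R * (2 * pi)) (to_circle x == to_circle y).
Proof.
apply: (iffP eqP) => [/eqmodP/asboolP//|xy].
by apply/eqmodP/asboolP.
Qed.

Lemma cosD2pi_int x (m : int) : cos (x + m%:~R * (2 * pi)) = cos x.
Proof.
case: m => n; first exact: cosD2pin.
by rewrite NegzE mulrNz mulNr -(cosD2pin (x - n.+1%:R * (2 * pi)) n.+1) subrK.
Qed.

Lemma sinD2pi_int x (m : int) : sin (x + m%:~R * (2 * pi)) = sin x.
Proof.
case: m => n; first exact: sinD2pin.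
by rewrite NegzE mulrNz mulNr -(sinD2pin (x - n.+1%:R * (2 * pi)) n.+1) subrK.
Qed.

Lemma cos_circle x y : to_circle x = to_circle y -> cos x = cos y.
Proof.
move=> /eqP/to_circleP[m xy].
by rewrite -(cosD2pi_int y m) -xy addrC subrK.
Qed.

Lemma to_circleD x y z : to_circle x = to_circle y ->
  to_circle (x + z) = to_circle (y + z).
Proof.
move=> /eqP/to_circleP[m xy]; apply/eqP/to_circleP; exists m.
by rewrite -xy; ring.
Qed.

Lemma circle_rep x : exists y, [/\ 0 <= y, y < 2 * pi & to_circle x = to_circle y].
Proof.
have p0 : 0 < 2 * pi :> R by rewrite mulr_gt0// pi_gt0.
pose m := Num.floor (x / (2 * pi)).
have /andP[m1 m2] := floor_itv (x / (2 * pi)).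
exists (x - m%:~R * (2 * pi)); split.
- by rewrite subr_ge0 -ler_pdivlMr.
- by rewrite ltrBlDl -[X in _ + X]mul1r -mulrDl -ltr_pdivrMr// -[1]/(1%:~R) -intrD.
- by apply/eqP/to_circleP; exists m; ring.
Qed.

Lemma cos_le_arc z x : 0 <= z -> z <= pi -> z <= x -> x <= 2 * pi - z ->
  cos x <= cos z.
Proof.
move=> z0 zp zx x2.
wlog xp : x zx x2 / x <= pi => [H|].
  have [xp|xp] := leP x pi; first exact: H.
  have -> : cos x = cos (2 * pi - x).
    by rewrite -(cosN x) -[in LHS](cosD2pin (- x) 1) mul1r addrC.
  by apply: H; lra.
rewrite le_eqVlt in zx; case/predU1P: zx => [->//|zx].
by apply: ltW; rewrite ltr_cos// in_itv/=; apply/andP; split; lra.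
Qed.

Lemma sort_ordinal N (nu : 'I_N -> R) : injective nu ->
  exists2 s : 'I_N -> 'I_N, bijective s &
    forall i j : 'I_N, (i < j)%N -> nu (s i) < nu (s j).
Proof.
move=> nui; pose le := [rel i j | nu i <= nu j].
pose sq := sort le (enum 'I_N).
have le_total : total le by move=> i j; exact: le_total.
have le_tr : transitive le by move=> i j k; exact: le_trans.
have sz : size sq = N by rewrite size_sort size_enum_ord.
have us : uniq sq by rewrite sort_uniq enum_uniq.
have ss : sorted le sq by exact: sort_sorted.
pose s (i : 'I_N) := nth i sq i.
have sE (i j : 'I_N) : s i = nth j sq i by apply: set_nth_default; rewrite sz.
have si : injective s.
  move=> i j; rewrite (sE i j) => /eqP; rewrite nth_uniq ?sz//.
  by move=> /eqP/val_inj.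
exists s; first exact: injF_bij.
move=> i j ij; rewrite lt_neqAle; apply/andP; split.
  by apply/eqP => /nui/si E; rewrite E ltnn in ij.
by rewrite (sE i j); apply: (sorted_ltn_nth le_tr j ss); rewrite ?inE ?sz.
Qed.

(** The range goes beyond pi because t - 2 pi reaches 6 pi / 5 when t runs up to 16 pi / 5 in
    [fejer_gap_ge]. Since 15 exceeds (6 pi / 5)^2, beyond |x| = 2 it is enough that cos x <= 0. *)
Lemma one_sub_cos_quad x : - (6 / 5 * pi) <= x -> x <= 6 / 5 * pi ->
  x ^+ 2 / 15 <= 1 - cos x.
Proof.
have p3 : 3 <= pi :> R := pi_ge3; have p4 : pi < 16 / 5 :> R := pi_lt.
have ph := pihalf_lt2 R.
wlog x0 : x / 0 <= x => [H x1 x2|_ x2].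
  have [x0|x0] := leP 0 x; first exact: H.
  by rewrite -cosN -sqrrN; apply: H; lra.
have [xs|xs] := leP x 2.
  apply: le_trans (one_sub_cos_ge _ x0 xs).
  have -> : x ^+ 2 / 2 - x ^+ 4 / 24 = x ^+ 2 * (1 / 2 - x ^+ 2 / 24) by field.
  by rewrite ler_wpM2l ?exprn_ge0//; nra.
have : cos x <= cos (pi / 2) by apply: cos_le_arc; lra.
rewrite cos_pihalf; nra.
Qed.

(** With t = N x, [fejerE] gives K_N(x) >= 2 N^2 (1 - cos t) / t^2. On (0, 16 pi / 5] this vanishes
    only at t = 2 pi, to second order, the next zero being 4 pi. For t <= pi it is of order N^2
    outright; beyond, the quadratic bound is used around 2 pi. *)
Lemma fejer_gap_ge N x : (1 <= N)%N -> 0 < x -> x <= 16 / 5 * pi / N%:R ->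
  N%:R ^+ 4 * (x - 2 * pi / N%:R) ^+ 2 / (8 * 100) <= fejer N x.
Proof.
move=> N1 x0 xN; have N0 : 0 < N%:R :> R by rewrite ltr0n.
have p3 : 3 <= pi :> R := pi_ge3; have p4 : pi < 16 / 5 :> R := pi_lt.
pose t := N%:R * x; pose v := t - 2 * pi.
have t0 : 0 < t by apply: mulr_gt0.
have t1 : t <= 16 / 5 * pi.
  apply: (@le_trans _ _ (N%:R * (16 / 5 * pi / N%:R))); first by rewrite ler_pM2l.
  by rewrite mulrC divfK// gt_eqF.
have -> : N%:R ^+ 4 * (x - 2 * pi / N%:R) ^+ 2 / (8 * 100) = N%:R ^+ 2 * v ^+ 2 / (8 * 100).
  by rewrite /v /t; field; rewrite gt_eqF.
have F := fejerE N x; rewrite -/t in F.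
have F0 := fejer_ge0 N x.
have c1 := one_sub_cos_le x.
have cv : cos t = cos v.
  by rewrite -[LHS](cosD2pi_int _ (-1)) /v mulN1r.
have FF : 1 - cos t <= fejer N x * (x ^+ 2 / 2) by rewrite -F ler_wpM2l.
have N20 : 0 < N%:R ^+ 2 :> R by apply: exprn_gt0.
have FN : N%:R ^+ 2 * (1 - cos t) <= fejer N x * (t ^+ 2 / 2).
  have -> : fejer N x * (t ^+ 2 / 2) = N%:R ^+ 2 * (fejer N x * (x ^+ 2 / 2)).
    by rewrite /t; field.
  by rewrite ler_pM2l.
have [tp|tp] := leP t pi.
  have q1 : t ^+ 2 / 15 <= 1 - cos t by apply: one_sub_cos_quad; lra.
  have h1 : N%:R ^+ 2 * (t ^+ 2 / 15) <= fejer N x * (t ^+ 2 / 2).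
    by apply: le_trans FN; rewrite ler_pM2l.
  have t20 : 0 < t ^+ 2 by apply: exprn_gt0.
  have h2 : N%:R ^+ 2 * (2 / 15) <= fejer N x.
    rewrite -(ler_pM2r t20); lra.
  apply: le_trans h2; rewrite -mulrA ler_pM2l//.
  have : v ^+ 2 <= (2 * pi) ^+ 2.
    by rewrite -sqrrN lerXn2r ?nnegrE /v; lra.
  nra.
have q1 : v ^+ 2 / 15 <= 1 - cos t by rewrite cv; apply: one_sub_cos_quad; rewrite /v; lra.
have h1 : N%:R ^+ 2 * (v ^+ 2 / 15) <= fejer N x * (t ^+ 2 / 2).
  by apply: le_trans FN; rewrite ler_pM2l.
have h2 : t ^+ 2 / 2 <= 53.
  have : t ^+ 2 <= (16 / 5 * (16 / 5)) ^+ 2 by rewrite lerXn2r ?nnegrE; lra.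
  lra.
have h3 : fejer N x * (t ^+ 2 / 2) <= fejer N x * 53 by rewrite ler_wpM2l.
lra.
Qed.

End Circle.

(** * Stability *)

Section Structure.
Context {R : realType}.

Lemma sorted_lift N (th : 'I_N -> R) : injective (fun l => to_circle (th l)) ->
  exists (s : 'I_N -> 'I_N) (t : 'I_N -> R),
    [/\ bijective s, forall j, to_circle (th (s j)) = to_circle (t j),
        forall i j : 'I_N, (i < j)%N -> t i < t j &
        forall i j : 'I_N, t i < t j + 2 * pi].
Proof.
move=> thi; have [nu nuP] := choice (fun l : 'I_N => circle_rep (th l)).
have nui : injective nu.
  by move=> i j ij; apply: thi; have [_ _ ->] := nuP i; have [_ _ ->] := nuP j; rewrite ij.
have [s sb st] := sort_ordinal N nu nui.
exists s, (nu \o s); split => // [j|i j] /=; first by have [] := nuP (s j).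
by have [_ h _] := nuP (s i); have [h' _ _] := nuP (s j); lra.
Qed.

Variables (N : nat) (w th : 'I_N -> R).
Let mu := @Atomic R N w th.
Hypothesis N200 : (200 <= N)%N.
Hypothesis adm : admissible N mu.
Variables (s : 'I_N -> 'I_N) (t : 'I_N -> R).
Hypothesis sb : bijective s.
Hypothesis st : forall j, to_circle (th (s j)) = to_circle (t j).
Hypothesis tlt : forall i j : 'I_N, (i < j)%N -> t i < t j.
Hypothesis t2pi : forall i j : 'I_N, t i < t j + 2 * pi.

Let N0 : (0 < N)%N. Proof. by lia. Qed.
Let NR : 0 < N%:R :> R. Proof. by rewrite ltr0n. Qed.

Definition arc_gap (j : 'I_N) : R :=
  t (ordS j) - t j + (if (j.+1 < N)%N then 0 else 2 * pi).

Let tle (i j : 'I_N) : (i <= j)%N -> t i <= t j.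
Proof.
rewrite leq_eqVlt => /predU1P[/val_inj -> //|ij]; exact/ltW/tlt.
Qed.

Let ordS_lt (j : 'I_N) : (j.+1 < N)%N -> ordS j = j.+1 :> nat.
Proof. by move=> jN; rewrite /= modn_small. Qed.

Let ordS_last (j : 'I_N) : ~~ (j.+1 < N)%N -> ordS j = 0%N :> nat.
Proof.
move=> jN; have -> : nat_of_ord (ordS j) = (j.+1 %% N)%N by [].
by have -> : j.+1 = N; [have := ltn_ord j; lia | rewrite modnn].
Qed.

Lemma arc_gap_gt0 j : 0 < arc_gap j.
Proof.
rewrite /arc_gap; case: ifPn => jN.
  by rewrite addr0 subr_gt0 tlt// ordS_lt.
by have := t2pi j (ordS j); lra.
Qed.

(** No node lies strictly inside the arc after t_j, so every node is at least half the gap away from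
    its midpoint; nodes of index at most j are first moved forward by 2 pi. *)
Lemma cos_node_midpoint j l : let tau := t j + arc_gap j / 2 in
  2 * (8 / 5 * pi / N%:R) < arc_gap j ->
  cos (th (s l) - tau) <= cos (8 / 5 * pi / N%:R).
Proof.
move=> tau; set z := 8 / 5 * pi / N%:R => gz.
have p0 : 0 < pi :> R := pi_gt0 R.
have N2 : 2 <= N%:R :> R by rewrite (ler_nat _ 2); lia.
have z0 : 0 <= z by rewrite /z divr_ge0// mulr_ge0// ltW.
have zp : z <= pi by rewrite /z ler_pdivrMr//; nra.
rewrite (cos_circle _ (t l - tau)); last exact: to_circleD.
have [lj|jl] := leqP l j.
  rewrite -[cos (t l - tau)](cosD2pi_int _ 1) mul1r.
  have := tle l j lj; have g0 := arc_gap_gt0 j.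
  have : t j + arc_gap j <= t l + 2 * pi.
    rewrite /arc_gap; case: ifPn => jN; first by have := t2pi (ordS j) l; lra.
    have : t (ordS j) <= t l by apply: tle; rewrite ordS_last.
    lra.
  by move=> ? ?; apply: cos_le_arc => //; rewrite /tau; lra.
have jN : (j.+1 < N)%N by apply: leq_ltn_trans jl (ltn_ord l).
have gE : arc_gap j = t (ordS j) - t j by rewrite /arc_gap jN addr0.
have : t (ordS j) <= t l by apply: tle; rewrite ordS_lt.
have := t2pi l j.
by move=> ? ?; apply: cos_le_arc => //; rewrite /tau; lra.
Qed.

Lemma arc_gap_le j : N%:R * lowfreq N mu <= gap_eps ^+ 2 ->
  arc_gap j <= 16 / 5 * pi / N%:R.
Proof.
move=> low; rewrite leNgt; apply/negP => gz.
have gz' : 2 * (8 / 5 * pi / N%:R) < arc_gap j by apply: le_lt_trans gz; lra.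
have [i ci] := exists_near_node N mu (t j + arc_gap j / 2) N200 adm low.
have [s' ss' s's] := sb.
by have := cos_node_midpoint j (s' i) gz'; rewrite s's leNgt ci.
Qed.

(** Only the N ordered pairs of consecutive nodes are kept in [nearsum]; each has weight product at
    least 1 / (4 N^2), and [fejer_gap_ge] bounds its kernel value. *)
Lemma gap_deviation : N%:R * lowfreq N mu <= gap_eps ^+ 2 ->
  (forall i, 1 / 2 / N%:R <= w i) ->
  N%:R ^+ 2 * \sum_j (arc_gap j - 2 * pi / N%:R) ^+ 2 <= 32 * 100 * nearsum N mu.
Proof.
move=> low wl; have w0 : forall i, 0 <= w i := admissible_ge0 _ _ adm.
have p3 : 3 <= pi :> R := pi_ge3; have p4 : pi < 16 / 5 :> R := pi_lt.
pose c (j : 'I_N) : R := if (j.+1 < N)%N then 0 else 1.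
have Fg j : fejer N (th (s j) - th (s (ordS j))) = fejer N (arc_gap j) /\
    cos (th (s j) - th (s (ordS j))) = cos (arc_gap j).
  have : to_circle (- (th (s j) - th (s (ordS j)))) = to_circle (arc_gap j).
    apply/eqP/to_circleP; rewrite opprB.
    have /eqP/to_circleP[m mE] := st j; have /eqP/to_circleP[m' mE'] := st (ordS j).
    exists (m' - m - (if (j.+1 < N)%N then 0 else 1)).
    rewrite /arc_gap !intrB !mulrBl -mE -mE'; case: ifP => _.
      by rewrite mul0r; ring.
    by rewrite mul1r; ring.
  move=> E; split; last by rewrite -(cos_circle _ _ E) cosN.
  have /eqP/to_circleP[m mE] := E.
  rewrite -fejerN /fejer; congr (_ + 2 * _); apply: eq_bigr => k _; congr (_ * _).
  have -> : k%:R * - (th (s j) - th (s (ordS j))) =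
     k%:R * arc_gap j + (k%:Z * m)%:~R * (2 * pi).
    by rewrite intrM -[k%:~R]/(k%:R) -mulrA -mE; ring.
  exact: cosD2pi_int.
have term j : N%:R ^+ 2 * (arc_gap j - 2 * pi / N%:R) ^+ 2 <=
    32 * 100 * (w (s j) * w (s (ordS j)) *
      fejer N (th (s j) - th (s (ordS j)))).
  have [-> _] := Fg j.
  have F := fejer_gap_ge N (arc_gap j) N0 (arc_gap_gt0 j) (arc_gap_le j low).
  have ww : 1 / 4 / N%:R ^+ 2 <= w (s j) * w (s (ordS j)).
    have -> : 1 / 4 / N%:R ^+ 2 = (1 / 2 / N%:R) * (1 / 2 / N%:R) :> R by field; rewrite gt_eqF.
    by apply: ler_pM => //; apply: divr_ge0 => //; lra.
  set D := _ ^+ 2 in F *.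
  have D0 : 0 <= D by apply: sqr_ge0.
  have -> : N%:R ^+ 2 * D = 32 * 100 * ((1 / 4 / N%:R ^+ 2) * (N%:R ^+ 4 * D / (8 * 100))).
    by field; rewrite gt_eqF.
  apply: ler_wpM2l; first by apply: mulr_ge0.
  apply: ler_pM; [| |exact: ww|exact: F].
    by apply: divr_ge0; [apply: divr_ge0 | apply: exprn_ge0].
  by apply: divr_ge0; [apply: mulr_ge0; [apply: exprn_ge0|] | apply: mulr_ge0].
rewrite mulr_sumr; apply: (le_trans (ler_sum _ (fun j _ => term j))).
rewrite -mulr_sumr; apply: ler_wpM2l; first by apply: mulr_ge0.
rewrite /nearsum [leRHS](reindex s)/=; last exact: onW_bij.
apply: ler_sum => j _.
rewrite (bigD1 (s (ordS j)))/=.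
  rewrite lerDl; apply: sumr_ge0 => i _.
  by apply: mulr_ge0; [exact: mulr_ge0 | exact: fejer_ge0].
apply/andP; split.
  apply/eqP => /(bij_inj sb) E.
  have := congr1 (@nat_of_ord N) E.
  have [jN|jN] := boolP (j.+1 < N)%N; first by rewrite ordS_lt//; lia.
  by rewrite ordS_last// => j0; move: jN; rewrite -j0; lia.
rewrite /close_pair /=; have [_ ->] := Fg j.
have g0 := arc_gap_gt0 j; have gl := arc_gap_le j low.
have N20 : 0 <= N%:R ^+ 2 :> R by apply: exprn_ge0.
apply: le_trans (ler_wpM2l N20 (one_sub_cos_le _)) _.
have -> : N%:R ^+ 2 * (arc_gap j ^+ 2 / 2) = (N%:R * arc_gap j) ^+ 2 / 2 by field.
have h1 : N%:R * arc_gap j <= 16 / 5 * (16 / 5).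
  apply: (@le_trans _ _ (N%:R * (16 / 5 * pi / N%:R))); first by rewrite ler_pM2l.
  rewrite mulrC divfK ?gt_eqF//; lra.
have h0 : 0 <= N%:R * arc_gap j by rewrite mulr_ge0// ltW.
have : (N%:R * arc_gap j) ^+ 2 <= (16 / 5 * (16 / 5)) ^+ 2 by rewrite lerXn2r ?nnegrE; lra.
lra.
Qed.

Definition lattice_shift : R := N%:R^-1 * \sum_j (t j - j%:R * (2 * pi / N%:R)).

Definition displacement (j : 'I_N) : R := t j - j%:R * (2 * pi / N%:R) - lattice_shift.

Lemma sum_displacement : \sum_j displacement j = 0.
Proof.
rewrite /displacement sumrB sumr_const card_ord -[lattice_shift *+ N]mulr_natl /lattice_shift.
by rewrite mulVKf ?gt_eqF// subrr.
Qed.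

Lemma displacement_dist i j :
  `|displacement j - displacement i| <= \sum_k `|arc_gap k - 2 * pi / N%:R|.
Proof.
wlog ij : i j / (i <= j)%N => [H|].
  have [ij|/ltnW ji] := leqP i j; first exact: H.
  by rewrite distrC; exact: H.
(* Extended by 0 to [nat], so that the difference telescopes along the indices from i to j, without
   crossing the last gap. *)
pose d k := if insub k is Some l then displacement l else 0 : R.
have dE (l : 'I_N) : displacement l = d l by rewrite /d valK.
rewrite !dE -telescope_sumr//; apply: le_trans (ler_norm_sum _ _ _) _.
pose g k := if insub k is Some l then `|arc_gap l - 2 * pi / N%:R| else 0 : R.
have -> : \sum_k `|arc_gap k - 2 * pi / N%:R| = \sum_(0 <= k < N) g k.
  by rewrite big_mkord; apply: eq_bigr => k _; rewrite /g valK.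
have g0 k : 0 <= g k by rewrite /g; case: insubP.
rewrite [leRHS](@big_cat_nat _ _ _ i)//=; last exact: ltnW (ltn_ord i).
rewrite [X in _ <= _ + X](@big_cat_nat _ _ _ j)//=; last exact: ltnW (ltn_ord j).
rewrite addrCA; apply: ler_wpDr; first by apply: addr_ge0; apply: sumr_ge0.
apply: ler_sum_nat => k /andP[ik kj].
have kN : (k < N)%N by apply: ltn_trans kj (ltn_ord j).
have kN1 : (k.+1 < N)%N by apply: leq_ltn_trans kj (ltn_ord j).
have -> : d k = displacement (Ordinal kN) by rewrite dE.
have -> : d k.+1 = displacement (ordS (Ordinal kN)) by rewrite dE ordS_lt.
have -> : g k = `|arc_gap (Ordinal kN) - 2 * pi / N%:R|.
  by rewrite -[k]/(nat_of_ord (Ordinal kN)) /g valK.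
rewrite /displacement /arc_gap /= kN1 modn_small// -natr1.
by rewrite le_eqVlt; apply/orP; left; apply/eqP; congr `|_|; ring.
Qed.

Lemma sqr_sum_le (f : 'I_N -> R) : (\sum_i f i) ^+ 2 <= N%:R * \sum_i f i ^+ 2.
Proof.
have : 0 <= \sum_i (f i - N%:R^-1 * \sum_j f j) ^+ 2.
  by apply: sumr_ge0 => i _; apply: sqr_ge0.
set S := \sum_j f j.
have -> : \sum_i (f i - N%:R^-1 * S) ^+ 2 = \sum_i f i ^+ 2 - S ^+ 2 / N%:R.
  under eq_bigr do rewrite sqrrB.
  rewrite big_split/= sumrB sumrMnl -mulr_suml -/S sumr_const card_ord.
  rewrite -[(_ ^+ 2) *+ N]mulr_natl; field; by rewrite gt_eqF.
by rewrite subr_ge0 ler_pdivrMr// mulrC.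
Qed.

(** As the displacements have mean zero, |y_j| is at most the average of |y_j - y_i|, hence at most
    the sum of the gap deviations; Cauchy-Schwarz costs the factor N. Combined with [gap_deviation]
    this is the uniform bound of order B / N, and the bound on sum y_j^2 follows by summation. *)
Lemma displacement_sqr_le j : displacement j ^+ 2 <=
  N%:R * \sum_k (arc_gap k - 2 * pi / N%:R) ^+ 2.
Proof.
set D := \sum_k `|arc_gap k - 2 * pi / N%:R|.
have h : `|displacement j| <= D.
  rewrite -(ler_pM2l NR).
  have -> : N%:R * `|displacement j| = `|\sum_i (displacement j - displacement i)|.
    rewrite sumrB sum_displacement subr0 sumr_const card_ord.
    by rewrite -[displacement j *+ N]mulr_natl normrM ger0_norm.
  apply: le_trans (ler_norm_sum _ _ _) _.
  apply: (le_trans (ler_sum _ (fun i _ => displacement_dist i j))).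
  by rewrite sumr_const card_ord -[_ *+ N]mulr_natl.
rewrite -[displacement j ^+ 2]real_normK ?num_real//.
apply: (@le_trans _ _ (D ^+ 2)).
  by rewrite lerXn2r ?nnegrE// sumr_ge0.
apply: le_trans (sqr_sum_le _) _; rewrite ler_pM2l//.
by apply: ler_sum => k _; rewrite real_normK ?num_real.
Qed.

End Structure.

Section Stability.
Context {R : realType}.
Implicit Types (mu : atomic R) (N : nat).

Definition stab_const : R := 8 ^+ 3 / wc.

Lemma stab_const_ge1 : 1 <= stab_const.
Proof.
have c0 := @wc_gt0 R; have c1 := @wc_small R.
rewrite /stab_const ler_pdivlMr ?wc_gt0//; lra.
Qed.

(** [d3_lower] multiplied by N; the factor 8^3 of [stab_const] comes from the length 1 / (8 N) of
    the three integrations. *)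
Lemma stab_bounds N mu : (10 <= N)%N -> admissible N mu -> fourier mu 1 = 0 ->
  let B := N%:R ^+ 4 * d3 N mu in
  [/\ N%:R * lowfreq N mu <= stab_const * B,
      N%:R ^+ 2 * excess N mu <= stab_const * B &
      nearsum N mu <= stab_const * B].
Proof.
move=> N10 adm f1 B; have N0 : 0 < N%:R :> R by rewrite ltr0n; lia.
have c0 := @wc_gt0 R; have := d3_lower N mu N10 adm f1.
have A0 := lowfreq_ge0 N mu; have X0 := excess_ge0 N mu adm.
have S0 := nearsum_ge0 N mu adm.
set A := lowfreq N mu in A0 *; set X := excess N mu in X0 *.
set S := nearsum N mu in S0 * => H.
have {}H : N%:R * A + N%:R ^+ 2 * X + S <= stab_const * B.
  rewrite -(ler_pM2l c0).
  have -> : wc * (stab_const * B) = N%:R * ((8 * N%:R) ^+ 3 * d3 N mu).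
    by rewrite /stab_const /B; field; rewrite gt_eqF.
  have -> : wc * (N%:R * A + N%:R ^+ 2 * X + S) =
      N%:R * (wc * (A + N%:R * X + S / N%:R)) by field; rewrite gt_eqF.
  by rewrite ler_pM2l.
have h1 : 0 <= N%:R * A by apply: mulr_ge0 => //; exact: ltW.
have h2 : 0 <= N%:R ^+ 2 * X by apply: mulr_ge0 => //; apply: exprn_ge0; exact: ltW.
by split; lra.
Qed.

Definition stab_threshold : R := gap_eps ^+ 2 / stab_const.

Definition stab_factor : R := 32 * 100 * stab_const.

Lemma stab_threshold_gt0 : 0 < stab_threshold.
Proof.
have k1 := stab_const_ge1; apply: divr_gt0; last lra.
by apply: exprn_gt0; rewrite invr_gt0; apply: exprn_gt0.
Qed.

Lemma stab_factor_ge : stab_const <= stab_factor.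
Proof. by have := stab_const_ge1; rewrite /stab_factor; lra. Qed.

Lemma gap_eps_sqr_lt : gap_eps ^+ 2 <= 1 / 4 :> R.
Proof.
have E := @gap_epsE R; set e := gap_eps in E *.
have h : e <= 1 / 2 by lra.
have h0 : 0 <= e by lra.
by nra.
Qed.

(** With M < N atoms, sum w_l^2 >= 1/M would give N^2 excess >= 1, beyond the allowed 1/4. With N
    atoms the excess equals sum (w_l - 1/N)^2, so (N w_l - 1)^2 <= 1/4 and w_l >= 1 / (2 N), the
    lower bound on the weights that [gap_deviation] needs. *)
Lemma stability N mu : (200 <= N)%N -> admissible N mu -> fourier mu 1 = 0 ->
  let B := N%:R ^+ 4 * d3 N mu in
  B <= stab_threshold ->
  natoms mu = N /\
  exists (s : 'I_N -> 'I_(natoms mu)) (gamma : R) (y : 'I_N -> R),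
    let h := 2 * pi / N%:R in
    let u := fun j => weight (s j) - N%:R^-1 in
    [/\ cyclic_lift s (fun j => gamma + j%:R * h + y j),
        \sum_j y j = 0,
        forall j, y j ^+ 2 <= stab_factor * (B / N%:R) &
        \sum_j u j ^+ 2 <= stab_factor * B / N%:R ^+ 2].
Proof.
move=> N200 adm f1 B Bc.
have N0 : 0 < N%:R :> R by rewrite ltr0n; lia.
have k1 := stab_const_ge1; have k0 : 0 < stab_const by lra.
have N10 : (10 <= N)%N by lia.
have [hA hX hS] := stab_bounds N mu N10 adm f1.
have d0 := d3_ge0 N mu N10 adm f1.
have B0 : 0 <= B by apply: mulr_ge0 => //; apply: exprn_ge0; exact: ltW.
rewrite -/B in hA hX hS.
have kB : stab_const * B <= gap_eps ^+ 2.
  by move: Bc; rewrite /stab_threshold ler_pdivlMr// mulrC.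
have low : N%:R * lowfreq N mu <= gap_eps ^+ 2 by apply: le_trans kB.
have e4 := gap_eps_sqr_lt.
have NN : natoms mu = N.
  have [/andP[M1 MN] w0 w1 inj] := adm.
  apply/eqP; rewrite eqn_leq MN/= leqNgt; apply/negP => MltN.
  have adm' : admissible (natoms mu) mu by split => //; rewrite M1 leqnn.
  have sM := sum_sqr_ge _ mu adm'.
  have M0 : 0 < (natoms mu)%:R :> R by rewrite ltr0n.
  have MN1 : (natoms mu)%:R + 1 <= N%:R :> R by rewrite natr1 ler_nat.
  have : 1 <= N%:R ^+ 2 * excess N mu.
    apply: (@le_trans _ _ (N%:R ^+ 2 * ((natoms mu)%:R^-1 - N%:R^-1))).
      have -> : N%:R ^+ 2 * ((natoms mu)%:R^-1 - N%:R^-1) =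
        N%:R * (N%:R - (natoms mu)%:R) / (natoms mu)%:R :> R.
        by field; rewrite !gt_eqF.
      rewrite ler_pdivlMr//; nra.
    by rewrite ler_pM2l ?exprn_gt0// /excess lerB.
  lra.
split => //.
have sE i : (weight (a := mu) i - N%:R^-1) ^+ 2 <= excess N mu /\
    \sum_i (weight (a := mu) i - N%:R^-1) ^+ 2 = excess N mu.
  have E : \sum_i (weight (a := mu) i - N%:R^-1) ^+ 2 = excess N mu.
    have [_ _ w1 _] := adm.
    under eq_bigr do rewrite sqrrB.
    rewrite big_split/= sumrB sumrMnl -mulr_suml w1 sumr_const card_ord.
    rewrite -[(_ ^+ 2) *+ natoms mu]mulr_natl (_ : (natoms mu)%:R = N%:R); last by rewrite NN.
    by rewrite /excess; field; rewrite gt_eqF.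
  split => //; rewrite -E (bigD1 i)//= lerDl.
  by apply: sumr_ge0 => j _; exact: sqr_ge0.
(* The equality of the number of atoms with N is eliminated by substitution, so that nodes and gaps
   are indexed by the same ordinal type. *)
move: N NN N200 adm f1 @B Bc N0 N10 hA hX hS d0 B0 kB low sE.
case: mu => M w th N NN; rewrite /= in NN; subst N.
move=> N200 adm f1 B Bc N0 N10 hA hX hS d0 B0 kB low sE.
have [_ wp w1 inj] := adm.
have wl i : 1 / 2 / M%:R <= w i.
  have [h _] := sE i.
  have h2 : (M%:R * (w i - M%:R^-1)) ^+ 2 <= 1 / 4.
    rewrite exprMn; apply: le_trans e4; apply: le_trans kB; apply: le_trans hX.
    by rewrite ler_pM2l// exprn_gt0.
  have h3 : M%:R * (w i - M%:R^-1) = M%:R * w i - 1 by rewrite mulrBr divff ?gt_eqF.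
  rewrite h3 in h2; rewrite ler_pdivrMr// mulrC.
  by have [//|] := leP (1 / 2) (M%:R * w i) => ?; nra.
have [s [t [sb st tlt t2]]] := sorted_lift M th inj.
have dev := gap_deviation M w th N200 adm s t sb st tlt t2 low wl.
set D := \sum_j _ ^+ 2 in dev.
have D0 : 0 <= D by apply: sumr_ge0 => j _; exact: sqr_ge0.
have MD : M%:R ^+ 2 * D <= stab_factor * B.
  by apply: le_trans dev _; rewrite /stab_factor -(mulrA (32 * 100)); apply: ler_wpM2l => //;
    apply: mulr_ge0.
exists s, (lattice_shift M t), (displacement M t).
have tE : (fun j : 'I_M => lattice_shift M t + j%:R * (2 * pi / M%:R) + displacement M t j) = t.
  by apply/funext => j; rewrite /displacement; ring.
split.
- by rewrite tE.
- exact: (sum_displacement _ N200).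
- move=> j; apply: (le_trans (displacement_sqr_le _ N200 t j)).
  rewrite -/D mulrA ler_pdivlMr// [leLHS](_ : _ = M%:R ^+ 2 * D)//.
  by ring.
- have M0 : (0 < M)%N by exact: leq_trans N10.
  have [_ E] := sE (Ordinal M0).
  have -> : \sum_j (w (s j) - M%:R^-1) ^+ 2 = excess M (Atomic w th).
    by rewrite -E [RHS](reindex s)//=; exact: onW_bij.
  rewrite ler_pdivlMr ?exprn_gt0// mulrC; apply: le_trans hX _.
  by apply: ler_wpM2r => //; exact: stab_factor_ge.
Qed.

Definition defect_const : R := 2 * stab_factor + stab_threshold^-1.

(** For B above the threshold the right side already exceeds 1. Below it, the lattice part of the
    nodes disappears from cos(N (theta_i - theta_j)), leaving 1 - cos(N (y_a - y_b)) <= N^2 (y_a -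
    y_b)^2 / 2, of order N B. *)
Lemma sqmod_defect N mu : (200 <= N)%N -> admissible N mu -> fourier mu 1 = 0 ->
  1 - sqmod mu N <= defect_const * (N%:R ^+ 5 * d3 N mu).
Proof.
rewrite /defect_const.
move=> N200 adm f1.
have N0 : 0 < N%:R :> R by rewrite ltr0n; lia.
have N1 : 1 <= N%:R :> R by rewrite ler1n; lia.
have N10 : (10 <= N)%N by lia.
have d0 := d3_ge0 N mu N10 adm f1.
have t0 := stab_threshold_gt0.
have F0 : 0 <= stab_factor by have := stab_factor_ge; have := stab_const_ge1; lra.
have E : N%:R ^+ 5 * d3 N mu = N%:R * (N%:R ^+ 4 * d3 N mu) by ring.
set B := N%:R ^+ 4 * d3 N mu in E.
have B0 : 0 <= B by apply: mulr_ge0 => //; apply: exprn_ge0; exact: ltW.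
have NB : 0 <= N%:R * B by apply: mulr_ge0 => //; exact: ltW.
rewrite E mulrDl.
have [Bt|Bt] := leP B stab_threshold; last first.
  apply: (@le_trans _ _ 1); first by rewrite gerBl sqmod_ge0.
  have h : 1 <= stab_threshold^-1 * B by rewrite ler_pdivlMl// mulr1 ltW.
  have h2 : 0 <= 2 * stab_factor * (N%:R * B) by apply: mulr_ge0 => //; apply: mulr_ge0.
  have h3 : stab_threshold^-1 * B <= stab_threshold^-1 * (N%:R * B).
    by rewrite ler_wpM2l ?invr_ge0 ?(ltW t0)// ler_peMl.
  lra.
have [NN [s [gamma [y [[sb st _ _] _ yB _]]]]] := stability N mu N200 adm f1 Bt.
apply: ler_wpDr; first by apply: mulr_ge0 => //; rewrite invr_ge0 ltW.
have w0 := admissible_ge0 _ _ adm; have [_ _ w1 _] := adm.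
have ww : \sum_i \sum_j weight (a := mu) i * weight (a := mu) j = 1.
  by under eq_bigr do rewrite -mulr_sumr w1 mulr1.
rewrite sqmodE -{1}ww -sumrB.
have -> : 2 * stab_factor * (N%:R * B) = \sum_i \sum_j
    weight (a := mu) i * weight (a := mu) j * (2 * stab_factor * (N%:R * B)).
  under eq_bigr do rewrite -mulr_suml.
  by rewrite -mulr_suml ww mul1r.
apply: ler_sum => i _; rewrite -sumrB; apply: ler_sum => j _.
rewrite -[X in X - _]mulr1 -mulrBr; apply: ler_wpM2l; first exact: mulr_ge0.
have [s' ss' s's] := sb; rewrite -(s's i) -(s's j).
set a := s' i; set b := s' j.
have -> : cos (N%:R * (node (s a) - node (s b))) = cos (N%:R * (y a - y b)).
  have /eqP/to_circleP[m mE] := st a; have /eqP/to_circleP[m' mE'] := st b.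
  have -> : N%:R * (node (s a) - node (s b)) = N%:R * (y a - y b) +
     (N%:Z * (m - m') + (a%:Z - b%:Z))%:~R * (2 * pi).
    rewrite intrD intrM !intrB.
    have -> : node (s a) = (gamma + a%:R * (2 * pi / N%:R) + y a) + m%:~R * (2 * pi).
      by rewrite -mE; ring.
    have -> : node (s b) = (gamma + b%:R * (2 * pi / N%:R) + y b) + m'%:~R * (2 * pi).
      by rewrite -mE'; ring.
    rewrite -[N%:~R]/(N%:R) -[(a : nat)%:~R]/((a : nat)%:R) -[(b : nat)%:~R]/((b : nat)%:R).
    by field; rewrite gt_eqF.
  exact: cosD2pi_int.
apply: le_trans (one_sub_cos_le _) _.
have -> : (N%:R * (y a - y b)) ^+ 2 / 2 = N%:R ^+ 2 * ((y a - y b) ^+ 2 / 2) by field.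
have -> : 2 * stab_factor * (N%:R * B) = N%:R ^+ 2 * (2 * (stab_factor * (B / N%:R))).
  by field; rewrite gt_eqF.
apply: ler_wpM2l; first by apply: exprn_ge0; exact: ltW.
have := yB a; have := yB b; have := sqr_ge0 (y a + y b).
rewrite -/B; have -> : (y a - y b) ^+ 2 / 2 = y a ^+ 2 + y b ^+ 2 - (y a + y b) ^+ 2 / 2.
  by field.
lra.
Qed.

End Stability.

(** * Bessel coefficients *)

Section Bessel.
Context {R : realType}.
Implicit Types (k m n : nat) (x q : R).

Lemma fact_neq0 n : n`!%:R != 0 :> R.
Proof. by rewrite pnatr_eq0 -lt0n fact_gt0. Qed.

Definition ecoef k m : R := (-1) ^+ m / (m`! * (m + k)`!)%N%:R.

(** J_k(x) = (x/2)^k [efun k] (x^2/4). In the variable q the derivative is minus the function of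
    next index, and the zeros of J_0 become the positive zeros of [efun 0]. *)
Definition efun k q : R := limn (pseries (ecoef k) q).

Lemma is_cvg_efun k q : cvgn (pseries (ecoef k) q).
Proof.
apply: is_cvg_series_dominated (is_cvg_series_exp_coeff `|q|) => m.
rewrite /exp_coeff /= normrM normrX /ecoef normrM normrX normrN1 expr1n mul1r.
rewrite normfV [`|_%:R|]ger0_norm// mulrC ler_wpM2l ?exprn_ge0//.
by rewrite lef_pV2 ?posrE ?ltr0n ?muln_gt0 ?fact_gt0// ler_nat leq_pmulr// fact_gt0.
Qed.

Lemma pseries_diffs_ecoef k : pseries_diffs (ecoef k) = (fun m => - ecoef k.+1 m).
Proof.
apply/funext => m; rewrite /pseries_diffs /ecoef exprS factS addSn addnS.
rewrite factS !natrM.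
have := fact_neq0 m; have := fact_neq0 (m + k).
move: (m`!%:R) ((m + k)`!%:R) => A B B0 A0; rewrite -[m.+1%:R]natr1 -[(m + k).+1%:R]natr1.
rewrite natrD; field.
by rewrite A0 B0/= !gt_eqF// ?ltr_pwDl// addr_ge0.
Qed.

Lemma is_derive_efun k q : is_derive q 1 (efun k) (- efun k.+1 q).
Proof.
have N (j : nat) K : cvgn (pseries (fun m => - ecoef j m) K).
  have -> : pseries (fun m => - ecoef j m) K = (fun n => - pseries (ecoef j) K n).
    apply/funext => n; rewrite /pseries/series/= -sumrN.
    by apply: eq_bigr => i _; rewrite mulNr.
  by apply: is_cvgN; exact: is_cvg_efun.
have -> : - efun k.+1 q = limn (pseries (pseries_diffs (ecoef k)) q).
  rewrite pseries_diffs_ecoef /efun; apply/esym/cvg_lim => //.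
  have -> : pseries (fun m => - ecoef k.+1 m) q = (fun n => - pseries (ecoef k.+1) q n).
    apply/funext => n; rewrite /pseries/series/= -sumrN.
    by apply: eq_bigr => i _; rewrite mulNr.
  by apply: cvgN; exact: is_cvg_efun.
apply: (@pseries_snd_diffs _ _ (`|q| + 1)).
- exact: is_cvg_efun.
- by rewrite pseries_diffs_ecoef.
- rewrite pseries_diffs_ecoef.
  have -> : pseries_diffs (fun m => - ecoef k.+1 m) = ecoef k.+2.
    apply/funext => m; have := congr1 (fun f => f m) (pseries_diffs_ecoef k.+1).
    by rewrite /pseries_diffs mulrN => ->; rewrite opprK.
  exact: is_cvg_efun.
- by rewrite [X in _ < X]ger0_norm ?addr_ge0// ltrDl.
Qed.

Lemma bessel_efun k x : bessel k x = (x / 2) ^+ k * efun k ((x / 2) ^+ 2).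
Proof.
rewrite /efun -lim_seriesM; last exact: is_cvg_efun.
rewrite /bessel /sum_from; congr (lim (_ @ \oo)); apply/funext => n.
rewrite /series/=; apply: eq_bigr => m _.
by rewrite exprD exprM /ecoef; ring.
Qed.

Lemma derive1_bessel k x : x != 0 ->
  x * derive1 (bessel k) x = k%:R * bessel k x - x * bessel k.+1 x.
Proof.
move=> x0; pose half : R -> R := 2^-1 \*: id.
have halfE y : half y = y / 2 by rewrite /half /= /GRing.scale/= mulrC.
have Dh : is_derive x 1 half (2^-1 *: 1) by exact: is_deriveZ.
have DX n := is_deriveX n Dh.
have DE := is_derive1_comp (is_derive_efun k _) (DX 2).
have DM := is_deriveM (DX k) DE.
have E : bessel k = half ^+ k * (efun k \o half ^+ 2).
  by apply/funext => y; rewrite bessel_efun !fctE halfE.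
rewrite derive1E {1}E derive_val !fctE /= !bessel_efun halfE /GRing.scale/=.
case: k {DE DM E} => [|k]; first by rewrite !expr0; field.
by rewrite !exprS /=; field.
Qed.

(* The partial sums of an alternating series with eventually decreasing terms
   are alternately below and above its sum. *)
Lemma alternating_ge (a : nat -> R) p :
  (forall m, 0 <= a m) -> (forall m, (p.*2 <= m)%N -> a m.+1 <= a m) ->
  cvgn (series (fun m => (-1) ^+ m * a m)) ->
  \sum_(0 <= m < p.*2) (-1) ^+ m * a m <= limn (series (fun m => (-1) ^+ m * a m)).
Proof.
move=> a0 ad ca.
have even_ge n : series (fun m => (-1) ^+ m * a m) p.*2 <=
    series (fun m => (-1) ^+ m * a m) (p + n).*2.
  elim: n => [|n IH]; first by rewrite addn0.
  rewrite addnS doubleS !seriesSr/= -addrA; apply: le_trans IH _; rewrite lerDl.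
  rewrite exprS -signr_odd odd_double expr0 mul1r mulr1 mulN1r subr_ge0 ad//.
  by rewrite leq_double leq_addr.
apply: limr_ge => //; near=> n.
have pn : (p.*2 <= n)%N by near: n; exact: nbhs_infty_ge.
have nE := odd_double_half n.
have E : n./2 = (p + (n./2 - p))%N by rewrite subnKC// -(doubleK p) half_leq.
rewrite -nE; case: (odd n); last by rewrite add0n E; exact: even_ge.
rewrite add1n seriesSr/= -signr_odd odd_double expr0 mul1r.
by rewrite -[leLHS]addr0 lerD// E; exact: even_ge.
Unshelve. all: by end_near. Qed.

Lemma alternating_le (a : nat -> R) p :
  (forall m, 0 <= a m) -> (forall m, (p.*2.+1 <= m)%N -> a m.+1 <= a m) ->
  cvgn (series (fun m => (-1) ^+ m * a m)) ->
  limn (series (fun m => (-1) ^+ m * a m)) <= \sum_(0 <= m < p.*2.+1) (-1) ^+ m * a m.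
Proof.
move=> a0 ad ca.
have odd_le n : series (fun m => (-1) ^+ m * a m) (p + n).*2.+1 <=
    series (fun m => (-1) ^+ m * a m) p.*2.+1.
  elim: n => [|n IH]; first by rewrite addn0.
  apply: le_trans IH.
  rewrite addnS doubleS 2!seriesSr/= -addrA gerDl.
  rewrite !exprS -signr_odd odd_double expr0 mulr1 mulN1r mulrN mulr1 opprK mul1r.
  rewrite addrC subr_le0 ad//.
  by rewrite ltnS leq_double leq_addr.
apply: limr_le => //; near=> n.
have pn : (p.*2.+1 <= n)%N by near: n; exact: nbhs_infty_ge.
have nE := odd_double_half n.
have [on|en] := boolP (odd n).
  have pn' : (p <= n./2)%N by rewrite -(doubleK p) half_leq// ltnW.
  by rewrite -nE on add1n -(subnKC pn'); exact: odd_le.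
have [n' nn'] : exists n', n = n'.+1 by exists n.-1; lia.
rewrite nn' in en pn *; rewrite /= negbK in en.
rewrite seriesSr/= -signr_odd en expr1 mulN1r.
apply: (@le_trans _ _ (series (fun m => (-1) ^+ m * a m) n')).
  by rewrite gerBl.
have nE' := odd_double_half n'; rewrite en add1n in nE'.
have pn' : (p <= n'./2)%N by rewrite -(doubleK p) half_leq.
by rewrite -nE' -(subnKC pn'); exact: odd_le.
Unshelve. all: by end_near. Qed.

Definition ecoef_abs k q m : R := q ^+ m / (m`! * (m + k)`!)%N%:R.

Lemma efun_abs k q : efun k q = limn (series (fun m => (-1) ^+ m * ecoef_abs k q m)).
Proof.
rewrite /efun; congr (lim (_ @ \oo)); apply/funext => n; rewrite /pseries/series/=.
by apply: eq_bigr => m _; rewrite /ecoef /ecoef_abs; ring.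
Qed.

Lemma is_cvg_efun_abs k q : cvgn (series (fun m => (-1) ^+ m * ecoef_abs k q m)).
Proof.
have -> : series (fun m => (-1) ^+ m * ecoef_abs k q m) = pseries (ecoef k) q.
  apply/funext => n; rewrite /pseries/series/=.
  by apply: eq_bigr => m _; rewrite /ecoef /ecoef_abs; ring.
exact: is_cvg_efun.
Qed.

Lemma ecoef_abs_ge0 k q m : 0 <= q -> 0 <= ecoef_abs k q m.
Proof. by move=> q0; rewrite divr_ge0// exprn_ge0. Qed.

(** Consecutive terms have ratio q / ((m + 1) (m + k + 1)), whose denominator is at least 2 except
    at k = m = 0. *)
Lemma ecoef_abs_decr k q m : 0 <= q -> q <= 2 -> (0 < k + m)%N ->
  ecoef_abs k q m.+1 <= ecoef_abs k q m.
Proof.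
move=> q0 q2 km.
have -> : ecoef_abs k q m.+1 = ecoef_abs k q m * (q / (m.+1 * (m + k).+1)%N%:R).
  rewrite /ecoef_abs factS addSn factS exprS !natrM; field.
  by rewrite !pnatr_eq0 -!lt0n !fact_gt0/= !(addrC 1) -natrD !natr1 !pnatr_eq0.
rewrite ler_piMr ?ecoef_abs_ge0// ler_pdivrMr ?ltr0n ?muln_gt0// mul1r.
by apply: le_trans q2 _; rewrite (ler_nat _ 2); nia.
Qed.

Lemma efun_ge k q : (1 <= k)%N -> 0 <= q -> q <= 2 ->
  (k`!%:R)^-1 * (1 - q / k.+1%:R) <= efun k q.
Proof.
move=> k1 q0 q2; rewrite efun_abs.
apply: le_trans (alternating_ge _ 1 _ _ (is_cvg_efun_abs k q)).
- rewrite !big_nat_recr//= big_geq// add0r expr0 mul1r expr1 mulN1r.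
  rewrite /ecoef_abs !add0n expr0 !expr1 fact0 factS !mul1n add1n factS natrM.
  rewrite le_eqVlt; apply/orP; left; apply/eqP; field.
  by rewrite !pnatr_eq0 -lt0n fact_gt0/= addrC natr1 pnatr_eq0.
- by move=> m; exact: ecoef_abs_ge0.
- by move=> m _; apply: ecoef_abs_decr => //; lia.
Qed.

Lemma efun_le k q : (1 <= k)%N -> 0 <= q -> q <= 2 ->
  efun k q <= (k`!%:R)^-1 * (1 - q / k.+1%:R + q ^+ 2 / (2 * k.+1%:R * k.+2%:R)).
Proof.
move=> k1 q0 q2; rewrite efun_abs.
apply: le_trans (alternating_le _ 1 _ _ (is_cvg_efun_abs k q)) _.
- by move=> m; exact: ecoef_abs_ge0.
- by move=> m _; apply: ecoef_abs_decr => //; lia.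
- rewrite !big_nat_recr//= big_geq// add0r expr0 mul1r expr1 mulN1r sqrrN expr1n mul1r.
  rewrite /ecoef_abs !add0n expr0 !expr1 fact0 !mul1n add1n add2n !factS fact0 !natrM.
  rewrite le_eqVlt; apply/orP; left; apply/eqP; field.
  by rewrite fact_neq0/= !gt_eqF// ltr_pwDl.
Qed.

Lemma efun0_at0 : efun 0 0 = 1.
Proof.
apply/cvg_lim => //; rewrite -cvg_shiftS; apply: cvg_near_cst; apply: nearW => n.
rewrite /pseries/series/= big_nat_recl// big1 ?addr0 => [|i _]; last by rewrite expr0n mulr0.
by rewrite /ecoef expr0 /= fact0 mul1n invr1 !mulr1.
Qed.

(** 3/2 is a simple rational slightly above j^2/4, about 1.446. The sum of five terms is negative;
    that of three is still positive. *)
Lemma efun0_neg : efun 0 (3 / 2) < 0.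
Proof.
rewrite efun_abs.
apply: le_lt_trans (alternating_le _ 2 _ _ (is_cvg_efun_abs 0 (3 / 2))) _.
- by move=> m; apply: ecoef_abs_ge0; lra.
- by move=> m m5; apply: ecoef_abs_decr; [lra|lra|lia].
- rewrite !big_nat_recr//= big_geq// add0r /ecoef_abs !addn0 !factS fact0 !natrM.
  lra.
Qed.

Lemma efun_gt0 k q : (1 <= k)%N -> 0 <= q -> q <= 3 / 2 -> 0 < efun k q.
Proof.
move=> k1 q0 q2; have q2' : q <= 2 by lra.
apply: lt_le_trans (efun_ge k q k1 q0 q2').
have k2 : 2 <= k.+1%:R :> R by rewrite (ler_nat _ 2).
rewrite mulr_gt0 ?invr_gt0 ?ltr0n ?fact_gt0// subr_gt0 ltr_pdivrMr ?mul1r; lra.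
Qed.

(** The root comes from the intermediate value theorem; before it [efun 0] is positive since its
    derivative - [efun 1] is negative on [0, 3/2]. *)
Lemma efun0_root : exists2 q, 0 < q < 3 / 2 &
  efun 0 q = 0 /\ forall p, 0 <= p -> p < q -> 0 < efun 0 p.
Proof.
have cont a b : {within `[a, b], continuous (efun 0)}.
  by apply: derivable_within_continuous => y _; have [] := is_derive_efun 0 y.
have h : 0 <= 3 / 2 :> R by lra.
have := @IVT _ (efun 0) 0 (3 / 2) 0 h (cont _ _).
have e0 := efun0_at0; have en := efun0_neg.
case => [|q]; first by rewrite ge_min le_max e0 (ltW en) orbT ler01.
rewrite in_itv/= => /andP[q0 q1] qz.
have q0' : 0 < q.
  rewrite lt_neqAle q0 andbT; apply/eqP => E; move: qz.
  by rewrite -E e0 => /eqP; rewrite oner_eq0.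
have q1' : q < 3 / 2.
  rewrite lt_neqAle q1 andbT; apply/eqP => E; move: qz.
  by rewrite E => H; rewrite H ltxx in en.
exists q; first by rewrite q0'.
split => // p p0 pq.
have [|c] := MVT pq (fun y _ => is_derive_efun 0 y) => //.
rewrite in_itv/= => /andP[pc cq]; rewrite qz sub0r => E.
have : 0 < efun 1 c by apply: efun_gt0 => //; lra.
have : 0 < q - p by rewrite subr_gt0.
by move=> ? ?; have : efun 0 p = efun 1 c * (q - p); [lra | move=> ->; apply: mulr_gt0].
Qed.

(** A root q of [efun 0] yields the zero 2 sqrt q of J_0, so the set defining [j01] is nonempty and
    [xget] picks an element of it. *)
Lemma j01_first_zero : is_first_positive_zero (bessel 0) (j01 R).
Proof.
have [q /andP[q0 q1] [qz qp]] := efun0_root.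
suff : exists x : R, is_first_positive_zero (bessel 0) x.
  by move=> ex; rewrite /j01; case: xgetP => // H; case: ex => x /H.
exists (2 * Num.sqrt q).
have s0 : 0 < Num.sqrt q by rewrite sqrtr_gt0.
split; first by rewrite mulr_gt0.
  rewrite bessel_efun expr0 mul1r (_ : 2 * _ / 2 = Num.sqrt q); last by field.
  by rewrite sqr_sqrtr// ltW.
move=> y y0 ys; rewrite bessel_efun expr0 mul1r gt_eqF// qp ?sqr_ge0//.
rewrite -[ltRHS](sqr_sqrtr (ltW q0)) ltrXn2r ?nnegrE//; lra.
Qed.

Definition jq : R := (j01 R / 2) ^+ 2.

Lemma j01_gt0 : 0 < j01 R. Proof. by have [] := j01_first_zero. Qed.

(** Otherwise the zero 2 sqrt q of J_0, with the q < 3/2 of [efun0_root], would precede the first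
    one. *)
Lemma jq_bounds : 0 < jq /\ jq <= 3 / 2.
Proof.
have j0 := j01_gt0; have [_ _ jmin] := j01_first_zero.
split; first by rewrite exprn_gt0// divr_gt0.
have [q /andP[q0 q1] [qz qp]] := efun0_root.
rewrite leNgt; apply/negP => jl.
have s0 : 0 < Num.sqrt q by rewrite sqrtr_gt0.
have := jmin (2 * Num.sqrt q).
rewrite bessel_efun expr0 mul1r (_ : 2 * _ / 2 = Num.sqrt q); last by field.
rewrite sqr_sqrtr ?(ltW q0)// qz eqxx => H.
suff : 2 * Num.sqrt q < j01 R by move=> /(H (ltac:(lra))).
rewrite -(ltr_pM2r (x := 2^-1))// (_ : 2 * _ / 2 = Num.sqrt q); last by field.
rewrite -(@ltr_pXn2r _ 2)// ?nnegrE ?ltW//; last by rewrite divr_gt0.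
rewrite sqr_sqrtr ?(ltW q0)//; apply: lt_trans jl; lra.
Qed.

End Bessel.

(** * Comparison of the Bessel weights with shifted inverse cubes *)

Section BesselCoefficients.
Context {R : realType}.
Implicit Types (k : nat) (x y q : R).

(** This is j J_{k+1}(j) / J_k(j); the recurrence for J_k' turns beta_k into k + 1 minus it. *)
Definition jrho k : R := 2 * jq * efun k.+1 jq / efun k jq.

Lemma betaE k : (1 <= k)%N -> beta R k = k%:R + 1 - jrho k.
Proof.
move=> k1; have [q0 q1] := @jq_bounds R; have j0 := @j01_gt0 R.
have j20 : j01 R / 2 != 0 by rewrite gt_eqF// divr_gt0.
have E0 := @efun_gt0 R k jq k1 (ltW q0) q1.
rewrite /beta derive1_bessel ?gt_eqF// !bessel_efun -/jq exprS /jrho.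
have h0 := expf_neq0 k j20.
move: E0 h0; set e := efun k jq; set e' := efun k.+1 jq; set h := _ ^+ k => E0 h0.
rewrite (_ : jq = (j01 R / 2) ^+ 2 :> R)//.
by field; rewrite h0 gt_eqF.
Qed.

(** The upper bound of three terms for the numerator is set against the lower bound of two terms for
    the denominator. The result is q times a function of k alone, which makes the inequality behind
    [bcoef_ge] affine in q; the shift 1/6 is compatible with k = 2. *)
Lemma jrho_le k : (2 <= k)%N -> jrho k <= jq * (2 / (k%:R + 1 / 6)).
Proof.
move=> k2; have [q0 q1] := @jq_bounds R; have q2 : (jq : R) <= 2 by lra.
have k1 : (1 <= k)%N by exact: ltnW.
have E0 := @efun_gt0 R k jq k1 (ltW q0) q1.
have kR : 2 <= k%:R :> R by rewrite (ler_nat _ 2).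
rewrite /jrho ler_pdivrMr//.
have f0 : 0 < k`!%:R^-1 :> R by rewrite invr_gt0 ltr0n fact_gt0.
have lo := efun_ge k jq k1 (ltW q0) q2.
have up := efun_le k.+1 jq isT (ltW q0) q2.
have fE : k.+1`!%:R^-1 = k`!%:R^-1 / (k%:R + 1) :> R.
  by rewrite factS natrM invfM mulrC natr1.
rewrite fE -[k.+3%:R]natr1 -[k.+2%:R]natr1 -[k.+1%:R]natr1 in up lo.
move: f0 lo up; set f := _^-1; set x := k%:R in kR *; set q := jq in q0 q1 q2 E0 *.
move=> f0 lo up.
have c0 : 0 < q * (2 / (x + 1 / 6)) by rewrite mulr_gt0// divr_gt0//; lra.
apply: le_trans (ler_wpM2l (ltW c0) lo).
have p0 : 0 < 2 * q by rewrite mulr_gt0.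
apply: le_trans (ler_wpM2l (ltW p0) up) _.
rewrite -subr_ge0.
have -> : q * (2 / (x + 1 / 6)) * (f * (1 - q / (x + 1))) -
   2 * q * (f / (x + 1) * (1 - q / (x + 1 + 1) + q ^+ 2 / (2 * (x + 1 + 1) * (x + 1 + 1 + 1)))) =
   2 * q * f / (x + 1) / (x + 1 / 6) *
   (5 / 6 - q * (11 / 6) / (x + 2) - q ^+ 2 * (x + 1 / 6) / (2 * (x + 2) * (x + 3))).
  field; rewrite !gt_eqF//; lra.
apply: mulr_ge0.
  apply: divr_ge0; last lra.
  by apply: divr_ge0; [apply: mulr_ge0; apply: ltW | lra].
have h1 : q * (11 / 6) / (x + 2) <= (11 / 4) / (x + 2).
  by rewrite ler_pM2r ?invr_gt0; lra.
have h2 : q ^+ 2 * (x + 1 / 6) / (2 * (x + 2) * (x + 3)) <=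
    (9 / 4) * (x + 1 / 6) / (2 * (x + 2) * (x + 3)).
  rewrite ler_pM2r ?invr_gt0 ?ler_pM2r; [nra|lra|].
  by apply: mulr_gt0; [apply: mulr_gt0|]; lra.
apply: (@le_trans _ _ (5 / 6 - (11 / 4) / (x + 2) -
    (9 / 4) * (x + 1 / 6) / (2 * (x + 2) * (x + 3)))); last lra.
have -> : 5 / 6 - (11 / 4) / (x + 2) - (9 / 4) * (x + 1 / 6) / (2 * (x + 2) * (x + 3)) =
  (20 * (x + 2) * (x + 3) - 66 * (x + 3) - 27 * (x + 1 / 6)) / (24 * (x + 2) * (x + 3)).
  field; rewrite !gt_eqF//; lra.
apply: divr_ge0; first nra.
by apply: mulr_ge0; [apply: mulr_ge0|]; lra.
Qed.

Lemma jrho_ge k : (1 <= k)%N ->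
  2 * jq / (k%:R + 1) * (1 - jq / (k%:R + 2)) <= jrho k.
Proof.
move=> k1; have [q0 q1] := @jq_bounds R; have q2 : (jq : R) <= 2 by lra.
have E0 := @efun_gt0 R k jq k1 (ltW q0) q1.
have kR : 1 <= k%:R :> R by rewrite ler1n.
rewrite /jrho ler_pdivlMr//.
have f0 : 0 < k`!%:R^-1 :> R by rewrite invr_gt0 ltr0n fact_gt0.
have up := efun_le k jq k1 (ltW q0) q2.
have lo := efun_ge k.+1 jq isT (ltW q0) q2.
have fE : k.+1`!%:R^-1 = k`!%:R^-1 / (k%:R + 1) :> R.
  by rewrite factS natrM invfM mulrC natr1.
rewrite fE -[k.+2%:R]natr1 -[k.+1%:R]natr1 in up lo.
move: f0 lo up; set f := _^-1; set x := k%:R in kR *; set q := jq in q0 q1 q2 E0 *.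
move=> f0 lo up.
have E1 : efun k q <= f.
  apply: le_trans up _; rewrite -[leRHS]mulr1 ler_pM2l//.
  have -> : 1 - q / (x + 1) + q ^+ 2 / (2 * (x + 1) * (x + 1 + 1)) =
    1 - q / (x + 1) * (1 - q / (2 * (x + 1 + 1))) by field; rewrite !gt_eqF//; lra.
  rewrite gerBl; apply: mulr_ge0; first by apply: divr_ge0; lra.
  rewrite subr_ge0 ler_pdivrMr; lra.
have c0 : 0 <= 2 * q / (x + 1) * (1 - q / (x + 2)).
  apply: mulr_ge0; first by apply: divr_ge0; lra.
  rewrite subr_ge0 ler_pdivrMr; lra.
apply: le_trans (ler_wpM2l c0 E1) _.
have p0 : 0 <= 2 * q by lra.
apply: le_trans (ler_wpM2l p0 lo).
rewrite le_eqVlt; apply/orP; left; apply/eqP; field; rewrite !gt_eqF//; lra.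
Qed.

(* The combination of the (k + i)^-3, i <= 3, that agrees with [bcoef] up to
   O(k^-6) and whose generating polynomial in r is, with u = 1 - r,
   1 + u / 3 + (1 - q) / 6 * u^2 - u^3. *)
Definition mcoef (q x : R) : R :=
  (1 / 2 - q / 6) / x ^+ 3 + (7 / 3 + q / 3) / (x + 1) ^+ 3 -
  (17 / 6 + q / 6) / (x + 2) ^+ 3 + (x + 3) ^- 3.

(** [G1] and [G2] are the parts of degree 0 and 1 in q of x + 1 - x^4 [mcoef q x]. [G1] is O(x^-2)
    and [G2] is 2 / (x + 1) up to O(x^-2), matching the leading term 2 q / (k + 1) of [jrho]. *)
Let f (i x : R) : R := (x / (x + i)) ^+ 3.
Let G1 x : R := 1 + x * (1 / 2 - 7 / 3 * f 1 x + 17 / 6 * f 2 x - f 3 x).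
Let G2 x : R := x / 6 * (1 - 2 * f 1 x + f 2 x).

Let mcoefE q x : 2 <= x ->
  x + 1 - x ^+ 4 * mcoef q x = G1 x + q * G2 x.
Proof.
move=> x2; rewrite /mcoef /G1 /G2 /f.
by field; rewrite !gt_eqF//; lra.
Qed.

Let powers y : 0 <= y -> [/\ 0 <= y ^+ 2, 0 <= y ^+ 3, 0 <= y ^+ 4, 0 <= y ^+ 5 & 0 <= y ^+ 6]
   /\ [/\ 0 <= y ^+ 7, 0 <= y ^+ 8, 0 <= y ^+ 9, 0 <= y ^+ 10 & 0 <= y ^+ 11].
Proof. by move=> y0; split; split; apply: exprn_ge0. Qed.

Let den_ge0 y : 0 <= y -> 0 <= (y + 3) ^+ 3 * (y + 4) ^+ 3 * (y + 5) ^+ 3.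
Proof.
by move=> y0; apply: mulr_ge0; first apply: mulr_ge0; apply: exprn_ge0; lra.
Qed.

(** In y = x - 2 the numerator has nonnegative coefficients, so [lra] only needs the nonnegativity
    of the powers of y. The three bounds that follow are proved in the same way. *)
Let G1_ge0 x : 2 <= x -> 0 <= G1 x.
Proof.
move=> x2; pose y := x - 2; have y0 : 0 <= y by rewrite /y; lra.
have -> : x = y + 2 by rewrite /y; ring.
have -> : G1 (y + 2) = ((y + 3) ^+ 3 * (y + 4) ^+ 3 * (y + 5) ^+ 3 +
    1 / 2 * (y + 2) * (y + 3) ^+ 3 * (y + 4) ^+ 3 * (y + 5) ^+ 3 -
    7 / 3 * (y + 2) ^+ 4 * (y + 4) ^+ 3 * (y + 5) ^+ 3 +
    17 / 6 * (y + 2) ^+ 4 * (y + 3) ^+ 3 * (y + 5) ^+ 3 -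
    (y + 2) ^+ 4 * (y + 3) ^+ 3 * (y + 4) ^+ 3) /
    ((y + 3) ^+ 3 * (y + 4) ^+ 3 * (y + 5) ^+ 3).
  rewrite /G1 /f; field; rewrite !gt_eqF//; lra.
apply: divr_ge0; last exact: den_ge0.
by have [[? ? ? ? ?] [? ? ? ? ?]] := powers y y0; lra.
Qed.

(** The endpoint q = 3/2 of the affine inequality in [bcoef_ge], with the upper bound of [jrho_le]
    inserted; [G1_ge0] is the endpoint q = 0. *)
Let G12_ge x : 2 <= x -> 0 <= G1 x + 3 / 2 * G2 x - 3 / (x + 1 / 6).
Proof.
move=> x2; pose y := x - 2; have y0 : 0 <= y by rewrite /y; lra.
have -> : x = y + 2 by rewrite /y; ring.
have -> : G1 (y + 2) + 3 / 2 * G2 (y + 2) - 3 / (y + 2 + 1 / 6) =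
   ((6 * y + 13) * ((y + 3) ^+ 3 * (y + 4) ^+ 3 * (y + 5) ^+ 3 +
    3 / 4 * (y + 2) * (y + 3) ^+ 3 * (y + 4) ^+ 3 * (y + 5) ^+ 3 -
    17 / 6 * (y + 2) ^+ 4 * (y + 4) ^+ 3 * (y + 5) ^+ 3 +
    37 / 12 * (y + 2) ^+ 4 * (y + 3) ^+ 3 * (y + 5) ^+ 3 -
    (y + 2) ^+ 4 * (y + 3) ^+ 3 * (y + 4) ^+ 3) -
    18 * ((y + 3) ^+ 3 * (y + 4) ^+ 3 * (y + 5) ^+ 3)) /
    ((6 * y + 13) * ((y + 3) ^+ 3 * (y + 4) ^+ 3 * (y + 5) ^+ 3)).
  rewrite /G1 /G2 /f; field; rewrite !gt_eqF//; lra.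
apply: divr_ge0; last by apply: mulr_ge0; [lra | exact: den_ge0].
by have [[? ? ? ? ?] [? ? ? ? ?]] := powers y y0; lra.
Qed.

Let G1_le x : 2 <= x -> x ^+ 2 * G1 x <= 100.
Proof.
move=> x2; pose y := x - 2; have y0 : 0 <= y by rewrite /y; lra.
have -> : x = y + 2 by rewrite /y; ring.
rewrite -subr_ge0.
have -> : 100 - (y + 2) ^+ 2 * G1 (y + 2) =
   (100 * ((y + 3) ^+ 3 * (y + 4) ^+ 3 * (y + 5) ^+ 3) -
    (y + 2) ^+ 2 * ((y + 3) ^+ 3 * (y + 4) ^+ 3 * (y + 5) ^+ 3 +
    1 / 2 * (y + 2) * (y + 3) ^+ 3 * (y + 4) ^+ 3 * (y + 5) ^+ 3 -
    7 / 3 * (y + 2) ^+ 4 * (y + 4) ^+ 3 * (y + 5) ^+ 3 +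
    17 / 6 * (y + 2) ^+ 4 * (y + 3) ^+ 3 * (y + 5) ^+ 3 -
    (y + 2) ^+ 4 * (y + 3) ^+ 3 * (y + 4) ^+ 3)) /
    ((y + 3) ^+ 3 * (y + 4) ^+ 3 * (y + 5) ^+ 3).
  rewrite /G1 /f; field; rewrite !gt_eqF//; lra.
apply: divr_ge0; last exact: den_ge0.
by have [[? ? ? ? ?] [? ? ? ? ?]] := powers y y0; lra.
Qed.

Let G2_le x : 2 <= x -> x ^+ 2 * (G2 x - 2 / (x + 1)) <= 100.
Proof.
move=> x2; pose y := x - 2; have y0 : 0 <= y by rewrite /y; lra.
have -> : x = y + 2 by rewrite /y; ring.
rewrite -subr_ge0.
have -> : 100 - (y + 2) ^+ 2 * (G2 (y + 2) - 2 / (y + 2 + 1)) =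
   (100 * ((y + 3) ^+ 3 * (y + 4) ^+ 3) -
    (y + 2) ^+ 3 / 6 * ((y + 3) ^+ 3 * (y + 4) ^+ 3 -
      2 * (y + 2) ^+ 3 * (y + 4) ^+ 3 + (y + 2) ^+ 3 * (y + 3) ^+ 3) +
    2 * (y + 2) ^+ 2 * (y + 3) ^+ 2 * (y + 4) ^+ 3) /
    ((y + 3) ^+ 3 * (y + 4) ^+ 3).
  rewrite /G2 /f; field; rewrite !gt_eqF//; lra.
apply: divr_ge0; last by apply: mulr_ge0; apply: exprn_ge0; lra.
by have [[? ? ? ? ?] [? ? ? ? ?]] := powers y y0; lra.
Qed.

Lemma bcoef_ge k : (2 <= k)%N -> mcoef jq k%:R <= bcoef R k.
Proof.
move=> k2; have [q0 q1] := @jq_bounds R.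
have kR : 2 <= k%:R :> R by rewrite (ler_nat _ 2).
have k4 : 0 < k%:R ^+ 4 :> R by apply: exprn_gt0; lra.
rewrite /bcoef ler_pdivlMr// betaE; last exact: ltnW.
have rho := jrho_le k k2.
have E := mcoefE jq k%:R kR.
have g1 := G1_ge0 _ kR; have g2 := G12_ge _ kR.
move: rho E g1 g2; set x := k%:R; set q := jq in q0 q1 *; set G := G1 x; set H := G2 x.
set s := 1 / 6.
have -> : 3 / (x + s) = 3 / 2 * (2 / (x + s)) by field; rewrite gt_eqF// /s /x; lra.
set r := 2 / (x + s) => rho E g1 g2.
(* G + q (H - r) is affine in q, and nonnegative at q = 0 and q = 3/2. *)
have : 0 <= G + q * (H - r).
  have -> : G + q * (H - r) =
    (1 - q / (3 / 2)) * G + q / (3 / 2) * (G + 3 / 2 * H - 3 / 2 * r) by field.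
  apply: addr_ge0; apply: mulr_ge0 => //; last by apply: divr_ge0; lra.
  by rewrite subr_ge0 ler_pdivrMr; lra.
rewrite mulrC; lra.
Qed.

(** The remainder times k^4 is at most G1 + q (G2 - 2 / (x + 1)) + 2 q^2 / ((x + 1) (x + 2)) at x =
    k, and x^2 times each term is bounded. *)
Lemma bcoef_le k : (2 <= k)%N -> (bcoef R k - mcoef jq k%:R) * k%:R ^+ 6 <= 3 * 100.
Proof.
move=> k2; have [q0 q1] := @jq_bounds R.
have k1 : (1 <= k)%N by exact: ltnW.
have kR : 2 <= k%:R :> R by rewrite (ler_nat _ 2).
rewrite /bcoef betaE//.
have rho := jrho_ge k k1.
have E := mcoefE jq k%:R kR.
have g1 := G1_le _ kR; have g2 := G2_le _ kR.
have -> : ((k%:R + 1 - jrho k) / k%:R ^+ 4 - mcoef jq k%:R) * k%:R ^+ 6 =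
   k%:R ^+ 2 * (k%:R + 1 - k%:R ^+ 4 * mcoef jq k%:R - jrho k).
  by field; rewrite gt_eqF//; lra.
rewrite E; move: rho g1 g2.
set x := k%:R in kR *; set q := jq in q0 q1 *; set G := G1 x; set H := G2 x => rho g1 g2.
have x20 : 0 <= x ^+ 2 by apply: exprn_ge0; lra.
apply: (@le_trans _ _ (x ^+ 2 * (G + q * H - 2 * q / (x + 1) * (1 - q / (x + 2))))).
  by apply: ler_wpM2l => //; lra.
have -> : x ^+ 2 * (G + q * H - 2 * q / (x + 1) * (1 - q / (x + 2))) =
   x ^+ 2 * G + q * (x ^+ 2 * (H - 2 / (x + 1))) +
   q ^+ 2 * (2 * x ^+ 2 / ((x + 1) * (x + 2))) by field; rewrite !gt_eqF//; lra.
have h1 : q * (x ^+ 2 * (H - 2 / (x + 1))) <= q * 100 by apply: ler_wpM2l => //; exact: ltW.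
have h2 : 2 * x ^+ 2 / ((x + 1) * (x + 2)) <= 2.
  rewrite ler_pdivrMr; last by apply: mulr_gt0; lra.
  nra.
have h3 : q ^+ 2 * (2 * x ^+ 2 / ((x + 1) * (x + 2))) <= q ^+ 2 * 2.
  by apply: ler_wpM2l => //; apply: exprn_ge0; exact: ltW.
have h4 : q ^+ 2 <= 9 / 4 by nra.
lra.
Qed.

End BesselCoefficients.

(** * Comparison of the two deficits *)

Section BesselDeficit.
Context {R : realType}.
Implicit Types (mu : atomic R) (j k N : nat) (q r : R).

(** Shifting the weight by i delays the coefficients by i, so [P] has generating function F(r) times
    the polynomial of [mcoef] minus 1/8. For q <= 3/2 that polynomial stays above 1/4, its value at
    u = 1 - r = 1 and q = 3/2, so 1/8 leaves a margin. *)
Lemma mcoef_energy N mu q : (2 <= N)%N -> admissible N mu -> 0 <= q <= 3 / 2 ->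
  let c := dcoef N mu in
  cvgn (series (fun k => c k * mcoef q k%:R)) /\
  1 / 8 * limn (series (fun k => c k / k%:R ^+ 3)) <=
    limn (series (fun k => c k * mcoef q k%:R)).
Proof.
move=> N2 adm /andP[q0 q1] c.
have c1 k : `|c k| <= 1 by exact: dcoef_bound.
pose b (k : nat) : R := (k%:R ^+ 3)^-1.
pose S i := limn (series (fun k => c k * b (k + i)%N)).
have cS i : series (fun k => c k * b (k + i)%N) @ \oo --> S i.
  apply: (@is_cvg_dom2 _ _ 1) => -[|k].
    by rewrite /c dcoef0 mul0r normr0 expr0n/= invr0 mulr0.
  rewrite normrM; apply: ler_pM => //.
  rewrite /b normfV ger0_norm ?exprn_ge0// lef_pV2 ?posrE ?exprn_gt0 ?ltr0n ?addSn//.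
  apply: (@le_trans _ _ (k.+1%:R ^+ 3)).
    by apply: ler_weXn2l => //; rewrite ler1n.
  by apply: lerXn2r; rewrite ?nnegrE// ler_nat ltnS leq_addr.
pose Q0 : R := 1 / 2 - q / 6; pose Q1 : R := 7 / 3 + q / 3.
pose Q2 : R := 17 / 6 + q / 6.
have mE : (fun k => c k * mcoef q k%:R) = (fun k => Q0 * (c k * b (k + 0)%N) +
    Q1 * (c k * b (k + 1)%N) - Q2 * (c k * b (k + 2)%N) + c k * b (k + 3)%N).
  apply/funext => k; rewrite /mcoef /b !natrD addr0 -/Q0 -/Q1 -/Q2; ring.
have comb (w0 w1 w2 : R) : series (fun k => w0 * (c k * b (k + 0)%N) +
    w1 * (c k * b (k + 1)%N) - w2 * (c k * b (k + 2)%N) + c k * b (k + 3)%N) @ \oo -->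
    w0 * S 0%N + w1 * S 1%N - w2 * S 2%N + S 3%N.
  rewrite [X in X @ _](_ : _ = (fun n => w0 * series (fun k => c k * b (k + 0)%N) n +
      w1 * series (fun k => c k * b (k + 1)%N) n -
      w2 * series (fun k => c k * b (k + 2)%N) n + series (fun k => c k * b (k + 3)%N) n)).
    by apply: cvgD => //; apply: cvgB; [apply: cvgD|]; apply: cvgMl_tmp.
  apply/funext => n; rewrite /series/= !mulr_sumr -!big_split/= -sumrB -big_split/=.
  by [].
rewrite mE; split; first exact: cvgP (comb _ _ _).
have -> := cvg_lim _ (comb Q0 Q1 Q2) => //.
have -> : (fun k => c k / k%:R ^+ 3) = (fun k => c k * b (k + 0)%N).
  by apply/funext => k; rewrite addn0.
rewrite -/(S 0%N).
pose s1 := delay c; pose s2 := delay s1; pose s3 := delay s2.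
pose P k := (Q0 - 1 / 8) * c k + Q1 * s1 k - Q2 * s2 k + s3 k.
have b1 := delay_bound c 1 c1; have b2 := delay_bound _ 1 b1; have b3 := delay_bound _ 1 b2.
have Pb k : `|P k| <= 1 + 4 + 4 + 1.
  have := c1 k; have := b1 k; have := b2 k; have := b3 k.
  rewrite -/s1 -/s2 -/s3 !ler_norml => /andP[? ?] /andP[? ?] /andP[? ?] /andP[? ?].
  by rewrite /P /Q0 /Q1 /Q2; apply/andP; split; nra.
have P0 : P 0%N = 0 by rewrite /P /s1 /s2 /s3 /c dcoef0 /=; ring.
have Pser : series (fun k => P k / k%:R ^+ 3) @ \oo -->
    (Q0 - 1 / 8) * S 0%N + Q1 * S 1%N - Q2 * S 2%N + S 3%N.
  rewrite [X in X @ _](_ : _ = (fun n => (Q0 - 1 / 8) * series (fun k => c k * b k) n +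
      Q1 * series (fun k => s1 k * b k) n -
      Q2 * series (fun k => s2 k * b k) n + series (fun k => s3 k * b k) n)); last first.
    apply/funext => n; rewrite /series/= !mulr_sumr -!big_split/= -sumrB -big_split/=.
    by apply: eq_bigr => k _; rewrite /P /b; ring.
  apply: cvgD; first (apply: cvgB; first apply: cvgD); first apply: cvgMl_tmp.
  - by have := cS 0%N; under eq_fun do rewrite addn0.
  - apply: cvgMl_tmp; apply: cvg_series_delay.
    by have := cS 1%N; under eq_fun do rewrite addn1.
  - apply: cvgMl_tmp; apply: cvg_series_delay; apply: (cvg_series_delay c (fun k => b k.+1)).
    by have := cS 2%N; under eq_fun do rewrite addn2.
  - apply: cvg_series_delay; apply: (cvg_series_delay s1 (fun k => b k.+1)).
    apply: (cvg_series_delay c (fun k => b k.+2)).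
    by have := cS 3%N; under eq_fun do rewrite addn3.
suff : 0 <= (Q0 - 1 / 8) * S 0%N + Q1 * S 1%N - Q2 * S 2%N + S 3%N by lra.
have <- := cvg_lim _ Pser => //.
have Pp r : 0 < r -> r < 1 -> 0 <= limn (pseries P r).
  move=> r0 r1; have r01 : 0 < r < 1 by rewrite r0.
  have F0 := dcoef_pseries_ge0 N mu r N2 r01 adm.
  have cF : pseries c r @ \oo --> limn (pseries c r).
    by apply: (is_cvg_pseries_bnd c 1); rewrite // ger0_norm// ltW.
  rewrite -/c in F0; move: F0 cF; set F := limn (pseries c r) => F0 cF.
  have cF1 : pseries s1 r @ \oo --> r * F by exact: cvg_pseries_delay.
  have cF2 : pseries s2 r @ \oo --> r * (r * F) by exact: cvg_pseries_delay.
  have cF3 : pseries s3 r @ \oo --> r * (r * (r * F)) by exact: cvg_pseries_delay.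
  have -> : limn (pseries P r) =
      (Q0 - 1 / 8) * F + Q1 * (r * F) - Q2 * (r * (r * F)) + r * (r * (r * F)).
    apply/cvg_lim => //.
    rewrite [X in X @ _](_ : _ = (fun n => (Q0 - 1 / 8) * pseries c r n +
      Q1 * pseries s1 r n - Q2 * pseries s2 r n + pseries s3 r n)).
      by apply: cvgD => //; apply: cvgB; [apply: cvgD|]; apply: cvgMl_tmp.
    apply/funext => n; rewrite /pseries/series/= !mulr_sumr -!big_split/= -sumrB -big_split/=.
    by apply: eq_bigr => k _; rewrite /P; ring.
  have -> : (Q0 - 1 / 8) * F + Q1 * (r * F) - Q2 * (r * (r * F)) + r * (r * (r * F)) =
    F * (1 / 8 + (3 / 4 - (1 - r) ^+ 3) + (1 - r) / 3 + (1 - q) / 6 * (1 - r) ^+ 2).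
    by rewrite /Q0 /Q1 /Q2; field.
  apply: mulr_ge0 => //.
  have u0 : 0 < 1 - r by lra.
  have u1 : 1 - r < 1 by lra.
  move: u0 u1; set u := 1 - r => u0 u1.
  have u2 : u ^+ 3 <= u ^+ 2 by rewrite exprS ler_piMl ?sqr_ge0// ltW.
  nra.
(* Used with level 0 and length 0: only the sign of the sum is extracted. *)
have := series_cube_ge P _ 0 (1 / 2) 0 Pb P0 (lexx _).
by rewrite mul0r; apply => //; try lra; move=> r ? ?; apply: Pp; lra.
Qed.

(** For each pair of nodes, 1 - cos jx = K_j(x) (1 - cos x) <= j^2 (1 - cos x). It passes from V(N)
    to all V(jN) at the cost of j^2. *)
Lemma sqmod_dilate mu j k : (forall l, 0 <= weight (a := mu) l) ->
  \sum_l weight (a := mu) l = 1 ->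
  1 - sqmod mu (j * k) <= j%:R ^+ 2 * (1 - sqmod mu k).
Proof.
move=> w0 w1.
have ww : \sum_i \sum_j weight (a := mu) i * weight (a := mu) j = 1.
  by under eq_bigr do rewrite -mulr_sumr w1 mulr1.
have E m : 1 - sqmod mu m = \sum_i \sum_j weight (a := mu) i * weight (a := mu) j *
    (1 - cos (m%:R * (node i - node j))).
  rewrite sqmodE -{1}ww -sumrB; apply: eq_bigr => i _.
  by rewrite -sumrB; apply: eq_bigr => l _; ring.
rewrite !E mulr_sumr; apply: ler_sum => i _; rewrite mulr_sumr.
apply: ler_sum => l _; rewrite mulrCA; apply: ler_wpM2l; first exact: mulr_ge0.
rewrite natrM -mulrA -fejerE; apply: ler_wpM2r; first by rewrite subr_ge0 cos_le1.
rewrite fejer_double.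
apply: (@le_trans _ _ (\sum_(i < j) \sum_(j < j) 1)).
  by apply: ler_sum => a _; apply: ler_sum => b _; exact: cos_le1.
by under eq_bigr do rewrite sumr_const; rewrite sumr_const !card_ord -mulrnA mulnn natrX.
Qed.

Lemma bcoef_bound k : (2 <= k)%N -> `|bcoef R k| <= 2 / k%:R ^+ 3.
Proof.
move=> k2; have [q0 q1] := @jq_bounds R.
have k1 : (1 <= k)%N by exact: ltnW.
have kR : 2 <= k%:R :> R by rewrite (ler_nat _ 2).
have lo := jrho_ge (R := R) k k1; have up := jrho_le (R := R) k k2.
rewrite /bcoef betaE// normrM normfV [`|_ ^+ 4|]ger0_norm; last by apply: exprn_ge0; lra.
have k3 : 0 < k%:R ^+ 3 :> R by apply: exprn_gt0; lra.
rewrite exprS invfM mulrA; apply: ler_wpM2r; first by rewrite invr_ge0 ltW.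
rewrite ler_pdivrMr; last lra.
have r0 : 0 <= jrho (R := R) k.
  apply: le_trans lo; apply: mulr_ge0; first by apply: divr_ge0; lra.
  by rewrite subr_ge0 ler_pdivrMr; lra.
have r1 : jrho (R := R) k <= 3 / 2.
  apply: le_trans up _; rewrite mulrA ler_pdivrMr; last lra.
  by lra.
by rewrite ler_norml; lra.
Qed.

Lemma dBE N mu : (2 <= N)%N -> admissible N mu -> fourier mu 1 = 0 ->
  cvgn (series (fun k => dcoef N mu k * bcoef R k)) /\
  dB N mu = limn (series (fun k => dcoef N mu k * bcoef R k)).
Proof.
move=> N2 adm f1; have w0 := admissible_ge0 _ _ adm; have [_ _ w1 _] := adm.
have N0 : (0 < N)%N by exact: ltnW.
have s1 : sqmod mu 1 = 0.
  by rewrite /sqmod f1 /Normc.normc /= expr0n/= addr0 sqrtr0 expr0n.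
have cB (u : nat -> R) : (forall k, 0 <= u k <= 1) ->
    cvgn (series (fun k => (2 <= k)%N%:R * (bcoef R k * u k))).
  move=> u01; apply: (@is_cvg_dom2 _ _ 2) => k.
  have k20 : 0 <= (k%:R ^+ 2 : R)^-1 by rewrite invr_ge0 sqr_ge0.
  case: ltnP => k2; last by rewrite mul0r normr0 mulr_ge0.
  have /andP[u0 u1] := u01 k; rewrite mul1r normrM (ger0_norm u0).
  have kR : 2 <= k%:R :> R by rewrite (ler_nat _ 2).
  apply: (@le_trans _ _ (2 / k%:R ^+ 3 * 1)).
    by apply: ler_pM => //; exact: bcoef_bound.
  rewrite mulr1; apply: ler_wpM2l => //.
  rewrite lef_pV2 ?posrE; [|by apply: exprn_gt0; lra..].
  by apply: ler_weXn2l => //; lra.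
have E : (fun k => dcoef N mu k * bcoef R k) =
    (fun k => (2 <= k)%N%:R * (bcoef R k * sqmod mu k)) -
    (fun k => (2 <= k)%N%:R * (bcoef R k * sqmod (sigma N 0) k)).
  apply/funext => k; rewrite !fctE sqmod_sigma// /dcoef.
  case: k => [|[|k]]; first by rewrite /= !mul0r subrr.
    by rewrite s1 dvdn1 (gtn_eqF N2) /=; ring.
  by rewrite /= !mul1r; ring.
have c1 : cvgn (series (fun k => (2 <= k)%N%:R * (bcoef R k * sqmod mu k))).
  by apply: cB => k; rewrite sqmod_ge0 sqmod_le1.
have c2 : cvgn (series (fun k => (2 <= k)%N%:R * (bcoef R k * sqmod (sigma N 0) k))).
  by apply: cB => k; rewrite sqmod_sigma//; case: (N %| k)%N; rewrite /= ?ler01 ?lexx.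
rewrite E; split; first exact: is_cvg_seriesB.
by rewrite lim_seriesB// /dB !sum_fromE.
Qed.

(** Off the multiples of N, c_k = V(k) >= 0 and [bcoef_ge] suffices. At multiples c_k = V(k) - 1 <=
    0, and [bcoef_le] bounds the loss by [g]; by [sqmod_dilate] its term at jN is at most a constant
    times j^-4 N^-6 (1 - V(N)), which is summable in j. [sqmod_defect] then turns the total into
    O(d_3 / N). *)
Lemma dB_lower N mu : (200 <= N)%N -> admissible N mu -> fourier mu 1 = 0 ->
  1 / 8 * d3 N mu - 6 * 100 * defect_const * (d3 N mu / N%:R) <= dB N mu.
Proof.
move=> N200 adm f1; have w0 := admissible_ge0 _ _ adm; have [_ _ w1 _] := adm.
have N2 : (2 <= N)%N by exact: leq_trans N200.
have N0 : (0 < N)%N by exact: ltnW.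
have NR : 0 < N%:R :> R by rewrite ltr0n.
have [q0 q1] := @jq_bounds R.
have q01 : 0 <= jq (R := R) <= 3 / 2 by rewrite (ltW q0).
have [cm mge] := mcoef_energy N mu jq N2 adm q01.
have [cb ->] := dBE N mu N2 adm f1.
rewrite -d3E// in mge.
have K0 : 0 <= 3 * 100 :> R by exact: mulr_ge0.
set K := 3 * 100 in K0.
pose g k : R := (k != 0%N)%:R * (N %| k)%:R * (1 - sqmod mu k) * (K / k%:R ^+ 6).
have V01 k : 0 <= 1 - sqmod mu k <= 1.
  by rewrite subr_ge0 sqmod_le1//= gerBl sqmod_ge0.
have g0 k : 0 <= g k.
  have /andP[v0 _] := V01 k.
  apply: mulr_ge0; first by do 2! apply: mulr_ge0 => //.
  by apply: divr_ge0 => //; exact: exprn_ge0.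
have cg : cvgn (series g).
  apply: (@is_cvg_dom2 _ _ K) => -[|k].
    by rewrite /g !mul0r normr0 expr0n/= invr0 mulr0.
  rewrite ger0_norm// /g /= mul1r.
  have /andP[v0 v1] := V01 k.+1.
  apply: (@le_trans _ _ (1 * (K / k.+1%:R ^+ 6))).
    apply: ler_wpM2r; first by apply: divr_ge0 => //; exact: exprn_ge0.
    by case: (N %| _)%N; rewrite ?mul1r ?mul0r.
  rewrite mul1r; apply: ler_wpM2l => //.
  rewrite lef_pV2 ?posrE ?exprn_gt0//.
  by apply: ler_weXn2l => //; rewrite ler1n.
have gsum : limn (series g) <= K * N%:R ^- 6 * (1 - sqmod mu N) * 2.
  have gN k : ~~ (N %| k)%N -> g k = 0.
    by move=> kN; rewrite /g (negbTE kN) mulr0 !mul0r.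
  have <- := cvg_lim _ (cvg_series_multiples N g N0 gN cg) => //.
  apply: le_trans (ler_norm _) _; apply: lim_dom2_le.
    have /andP[v0 _] := V01 N.
    by apply: mulr_ge0 => //; apply: mulr_ge0 => //; rewrite invr_ge0; exact: exprn_ge0.
  move=> [|j]; first by rewrite mul0n /g !mul0r normr0 expr0n/= invr0 mulr0.
  rewrite ger0_norm// /g dvdn_mull// mulr1 (_ : (_ != _) = true) ?mul1r; last first.
    by rewrite muln_eq0 /= -lt0n.
  have D := sqmod_dilate mu j.+1 N w0 w1.
  apply: (@le_trans _ _ (j.+1%:R ^+ 2 * (1 - sqmod mu N) * (K / (j.+1 * N)%:R ^+ 6))).
    by apply: ler_wpM2r D; apply: divr_ge0 => //; exact: exprn_ge0.
  have j1 : 1 <= j.+1%:R :> R by rewrite ler1n.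
  rewrite natrM; move: j1; set x := j.+1%:R => j1.
  have x0 : 0 < x by lra.
  have -> : x ^+ 2 * (1 - sqmod mu N) * (K / (x * N%:R) ^+ 6) =
    K * N%:R ^- 6 * (1 - sqmod mu N) * (x ^+ 4)^-1.
    by field; rewrite !gt_eqF.
  apply: ler_wpM2l.
    have /andP[v0 _] := V01 N.
    by apply: mulr_ge0 => //; apply: mulr_ge0 => //; rewrite invr_ge0; exact: exprn_ge0.
  rewrite lef_pV2 ?posrE ?exprn_gt0//.
  by apply: ler_weXn2l.
have step : limn (series (fun k => dcoef N mu k * mcoef jq k%:R)) - limn (series g) <=
    limn (series (fun k => dcoef N mu k * bcoef R k)).
  rewrite -lim_seriesB//; apply: lim_series_le => //; first exact: is_cvg_seriesB.
  move=> k; rewrite !fctE /dcoef /g.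
  case: k => [|[|k]]; first by rewrite /= !mul0r subrr.
    have s1 : sqmod mu 1 = 0.
      by rewrite /sqmod f1 /Normc.normc /= expr0n/= addr0 sqrtr0 expr0n.
    by rewrite s1 dvdn1 (gtn_eqF N2) subrr !mulr0 !mul0r subrr.
  have lo := bcoef_ge (R := R) k.+2 isT; have := bcoef_le (R := R) k.+2 isT.
  rewrite -/K -ler_pdivlMr ?exprn_gt0// => up.
  have /andP[v0 _] := V01 k.+2; have s0 := sqmod_ge0 mu k.+2.
  rewrite /= mul1r; move: lo up; set b := bcoef R _; set m := mcoef _ _; set e := K / _ => lo up.
  case: (N %| _)%N; rewrite /= ?mul1r ?mul0r ?subr0; last exact: ler_wpM2l.
  by nra.
apply: le_trans step; apply: (@le_trans _ _ (1 / 8 * d3 N mu - limn (series g))); last first.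
  by rewrite lerD2r.
rewrite lerD2l lerN2; apply: le_trans gsum _.
have SD := sqmod_defect N mu N200 adm f1.
have -> : 6 * 100 * defect_const * (d3 N mu / N%:R) =
    K * N%:R ^- 6 * (defect_const * (N%:R ^+ 5 * d3 N mu)) * 2.
  by rewrite /K; field; rewrite gt_eqF.
apply: ler_wpM2r => //; apply: ler_wpM2l => //.
by apply: mulr_ge0 => //; rewrite invr_ge0; exact: exprn_ge0.
Qed.

Lemma dB_ge_d3 : exists NKB : nat, forall N mu, (200 <= N)%N -> (NKB <= N)%N ->
  admissible N mu -> fourier mu 1 = 0 -> 1 / 4 * d3 N mu <= 4 * dB N mu.
Proof.
(* Four times the loss in [dB_lower] is (K/4) d_3 / N, hence at most d_3 / 4 once N >= K; this comes
   out of the main term d_3 / 2. *)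
pose K : R := 16 * (6 * 100 * defect_const).
exists (Num.truncn K).+1 => N mu N200 NK adm f1.
have NR : 0 < N%:R :> R by rewrite ltr0n; exact: leq_trans N200.
have KN : K <= N%:R by apply: le_trans (ltW (truncnS_gt K)) _; rewrite ler_nat.
have d0 := d3_ge0 N mu (leq_trans (isT : (10 <= 200)%N) N200) adm f1.
have lo := dB_lower N mu N200 adm f1.
have : K * (d3 N mu / N%:R) <= d3 N mu.
  rewrite mulrCA ler_piMr// ler_pdivrMr// mul1r//.
rewrite /K; lra.
Qed.

End BesselDeficit.

(** * The equality case *)

Section EqualityCase.
Context {R : realType}.
Implicit Types (mu nu : atomic R) (k N : nat).

(** The preimage in the line is the countable set x + 2 pi Z. Thus equality of measures on
    measurable sets determines the point masses. *)
Lemma measurable_circle1 (z : circle R) : measurable [set z].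
Proof.
rewrite -[z]reprK; set x := repr z; change (measurable (@to_circle R @^-1` [set to_circle x])).
have -> : @to_circle R @^-1` [set to_circle x] =
    \bigcup_n ([set x + n%:R * (2 * pi)] `|` [set x - n%:R * (2 * pi)]).
  apply/seteqP; split => [y /= /eqP/to_circleP[m yx]|y [n _ /= H]].
    exists `|m|%N => //=; rewrite -[y](subrK x) yx.
    case: m {yx} => n; [left|right]; first by rewrite addrC.
    by rewrite NegzE abszN mulrNz mulNr addrC.
  apply/eqP/to_circleP; case: H => ->; [exists n%:Z|exists (- n%:Z)].
    by ring.
  by rewrite mulrNz; ring.
by apply: bigcupT_measurable => n; apply: measurableU; exact: measurable_set1.
Qed.

Lemma atomic_measure1 mu z : atomic_measure mu [set z] =
  (\sum_l weight (a := mu) l * (z == to_circle (node l))%:R)%:E.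
Proof.
rewrite /atomic_measure -sumEFin; apply: eq_bigr => l _.
rewrite EFinM diracE.
suff -> : (to_circle (node l) \in [set z]) = (z == to_circle (node l)) by [].
by apply/idP/eqP => [|->]; rewrite inE.
Qed.

(** Expresses a sum over labelled nodes by point masses alone, so that it depends on the measure and
    not on its presentation; [s] may list points that are not nodes, since their mass is 0. *)
Lemma sum_circle mu (F : R -> R) (s : seq (circle R)) :
  (forall x y, to_circle x = to_circle y -> F x = F y) -> uniq s ->
  (forall l, to_circle (node (a := mu) l) \in s) ->
  \sum_l weight (a := mu) l * F (node l) =
  \sum_(z <- s) fine (atomic_measure mu [set z]) * F (repr z).
Proof.
move=> Fcong us ns.
under [RHS]eq_bigr do rewrite atomic_measure1 /= mulr_suml.
rewrite exchange_big/=; apply: eq_bigr => l _.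
rewrite (bigD1_seq _ (ns l) us)/= eqxx mulr1 big1 => [|z /negPf ->].
  by rewrite addr0; congr (_ * _); apply: Fcong; rewrite /to_circle reprK.
by rewrite mulr0 mul0r.
Qed.

Lemma same_measure_sqmod mu nu k : same_measure mu nu -> sqmod mu k = sqmod nu k.
Proof.
move=> mn; rewrite !sqmod_sqr.
pose s := undup ([seq to_circle (node (a := mu) l) | l : 'I_(natoms mu)] ++
                 [seq to_circle (node (a := nu) l) | l : 'I_(natoms nu)]).
have sm l : to_circle (node (a := mu) l) \in s.
  by rewrite mem_undup mem_cat fintype.image_f.
have sn l : to_circle (node (a := nu) l) \in s.
  by rewrite mem_undup mem_cat fintype.image_f ?orbT.
have E (F : R -> R) : (forall x m, F (x + m%:~R * (2 * pi)) = F x) ->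
    \sum_l weight (a := mu) l * F (k%:R * node (a := mu) l) =
    \sum_l weight (a := nu) l * F (k%:R * node (a := nu) l).
  move=> Fp; have Fc x y : to_circle x = to_circle y -> F (k%:R * x) = F (k%:R * y).
    move=> /eqP/to_circleP[m /eqP]; rewrite subr_eq => /eqP ->.
    have -> : k%:R * (m%:~R * (2 * pi) + y) = k%:R * y + (k%:Z * m)%:~R * (2 * pi) :> R.
      by rewrite intrM; ring.
    exact: Fp.
  rewrite (sum_circle mu (fun x => F (k%:R * x)) s Fc (undup_uniq _) sm).
  rewrite (sum_circle nu (fun x => F (k%:R * x)) s Fc (undup_uniq _) sn).
  by apply: eq_bigr => z _; rewrite mn//; exact: measurable_circle1.
by rewrite (E cos (fun x m => cosD2pi_int x m)) (E sin (fun x m => sinD2pi_int x m)).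
Qed.

Lemma same_measure_sigma_deficits N mu gamma : (2 <= N)%N -> admissible N mu ->
  fourier mu 1 = 0 -> same_measure mu (sigma N gamma) ->
  d3 N mu = 0 /\ dB N mu = 0.
Proof.
move=> N2 adm f1 ms.
have c0 k : dcoef N mu k = 0.
  by rewrite /dcoef (same_measure_sqmod _ _ k ms) sqmod_sigma ?(ltnW N2)// subrr mulr0.
have z (b : nat -> R) : limn (series (fun k => dcoef N mu k * b k)) = 0.
  have -> : series (fun k => dcoef N mu k * b k) = fun=> 0.
    by apply/funext => n; rewrite /series/= big1// => k _; rewrite c0 mul0r.
  exact: lim_cst.
by rewrite d3E// (proj2 (dBE N mu N2 adm f1)) !z.
Qed.

(** [stability] at B = 0: all displacements and all weight deviations vanish. *)
Lemma d3_eq0 N mu : (200 <= N)%N -> admissible N mu -> fourier mu 1 = 0 ->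
  d3 N mu = 0 -> exists gamma, same_measure mu (sigma N gamma).
Proof.
move=> N200 adm f1 d0.
have := stability N mu N200 adm f1; rewrite /= d0 mulr0 => /(_ (ltW stab_threshold_gt0)).
move=> [_ [s [gamma [y [[sb st _ _] _ y0 u0]]]]].
exists gamma => A mA; rewrite /atomic_measure (reindex s)/=; last exact: onW_bij.
apply: eq_bigr => j _.
have yj : y j = 0.
  by apply/eqP; rewrite -sqrf_eq0 eq_le sqr_ge0 andbT; have := y0 j; rewrite mul0r mulr0.
have uj : weight (s j) = N%:R^-1.
  apply/eqP; rewrite -subr_eq0 -sqrf_eq0 eq_le sqr_ge0 andbT.
  move: u0; rewrite mulr0 mul0r; apply: le_trans.
  by rewrite (bigD1 j)//= lerDl sumr_ge0// => i _; exact: sqr_ge0.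
rewrite uj st yj addr0; congr (_ * dirac _ A)%E; congr to_circle; ring.
Qed.

End EqualityCase.

Theorem theorem4p8 (R : realType) :
  (exists NKB : nat, forall (N : nat) (mu : atomic R),
      (2 <= N)%N -> (NKB <= N)%N -> admissible N mu -> fourier mu 1 = 0 ->
    [/\ 4 * dB N mu >= 1 / 4 * d3 N mu,
        1 / 4 * d3 N mu >= 0,
        d3 N mu = 0 <-> (exists gamma : R, same_measure mu (sigma N gamma)) &
        dB N mu = 0 <-> (exists gamma : R, same_measure mu (sigma N gamma))])
  /\
  (exists C : R, 0 < C /\
    forall (N : nat -> nat) (mu : nat -> atomic R),
      (forall n, (2 <= N n)%N) ->
      N n @[n --> \oo] --> \oo ->
      (forall n, admissible (N n) (mu n)) ->
      (forall n, fourier (mu n) 1 = 0) ->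
      let B := fun n => (N n)%:R ^+ 4 * d3 (N n) (mu n) in
      B n @[n --> \oo] --> (0 : R) ->
      \forall n \near \oo,
        natoms (mu n) = N n /\
        exists (s : 'I_(N n) -> 'I_(natoms (mu n))) (gamma : R)
               (y : 'I_(N n) -> R),
          let h := 2 * pi / (N n)%:R in
          let u := fun j => weight (s j) - (N n)%:R^-1 in
          [/\ cyclic_lift s (fun j => gamma + j%:R * h + y j),
              \sum_j y j = 0 &
          [/\ \sum_j `|y j| ^+ 2 <= C * B n,
              forall j, `|y j| <= C * Num.sqrt (B n / (N n)%:R),
              \sum_j `|u j| ^+ 2 <= C * B n / (N n)%:R ^+ 2 &
              forall j, `|u j| <= C * Num.sqrt (B n) / (N n)%:R]]).
Proof.
split.
  have [n0 dBd3] := @dB_ge_d3 R.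
  exists (maxn 200 n0) => N mu N2; rewrite geq_max => /andP[N200 Nn0] adm f1.
  have d0 := d3_ge0 N mu (leq_trans (isT : (10 <= 200)%N) N200) adm f1.
  have dB0 := dBd3 N mu N200 Nn0 adm f1.
  have eq_sigma gamma := same_measure_sigma_deficits N mu gamma N2 adm f1.
  split => //; first by apply: mulr_ge0.
    by split => [|[gamma /eq_sigma[]//]]; exact: d3_eq0.
  split => [B0|[gamma /eq_sigma[]//]]; apply: d3_eq0 => //.
  by move: dB0; rewrite B0; lra.
have F1 : 1 <= stab_factor :> R by apply: le_trans stab_const_ge1 stab_factor_ge.
have F0 : 0 < stab_factor :> R by apply: lt_le_trans F1.
exists stab_factor; split => // N mu N2 Noo adm f1 B B0.
have Nlarge : \forall n \near \oo, (200 <= N n)%N by exact: (Noo _ (nbhs_infty_ge 200)).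
have Bsmall : \forall n \near \oo, B n <= stab_threshold.
  exact: (cvgr_le _ B0 _ stab_threshold_gt0).
near=> n; have N200 : (200 <= N n)%N by near: n.
have Bt : B n <= stab_threshold by near: n.
have [NN [s [gamma [y [cl y0 yB uB]]]]] := stability (N n) (mu n) N200 (adm n) (f1 n) Bt.
have NR : 0 < (N n)%:R :> R by rewrite ltr0n; exact: leq_trans N200.
have Bn0 : 0 <= B n.
  apply: mulr_ge0; first by apply: exprn_ge0; exact: ltW.
  exact: d3_ge0 (leq_trans (isT : (10 <= 200)%N) N200) (adm n) (f1 n).
split => //; exists s, gamma, y => /=; split => //.
rewrite -/(B n) in yB uB.
(* As the constant C is at least 1, x^2 <= C a implies x^2 <= C^2 a, so the same constant serves for
   the squared and the unsquared bounds. *)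
have sqr_bound (x a : R) : 0 <= a -> x ^+ 2 <= stab_factor * a ->
    `|x| <= stab_factor * Num.sqrt a.
  move=> a0 xa; have Fs := mulr_ge0 (ltW F0) (sqrtr_ge0 a).
  rewrite -ler_sqr ?nnegrE// real_normK ?num_real// exprMn sqr_sqrtr//.
  apply: le_trans xa _; apply: ler_wpM2r => //.
  by rewrite expr2 ler_peMl// (ltW F0).
split.
- apply: (@le_trans _ _ (\sum_(j < N n) stab_factor * (B n / (N n)%:R))).
    by apply: ler_sum => j _; rewrite real_normK ?num_real//.
  by rewrite sumr_const card_ord -[_ *+ N n]mulr_natl mulrCA [_%:R * _]mulrC divfK// gt_eqF.
- by move=> j; apply: sqr_bound => //; apply: divr_ge0 => //; exact: ltW.
- by under eq_bigr do rewrite real_normK ?num_real//.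
move=> j; have N20 : 0 <= (N n)%:R ^+ 2 :> R by exact: exprn_ge0.
have -> : stab_factor * Num.sqrt (B n) / (N n)%:R =
    stab_factor * Num.sqrt (B n / (N n)%:R ^+ 2).
  by rewrite (sqrtrM _ Bn0) sqrtrV// sqrtr_sqr ger0_norm ?mulrA// ltW.
apply: sqr_bound; first exact: divr_ge0.
rewrite mulrA; apply: le_trans uB.
by rewrite [leRHS](bigD1 j)//= lerDl sumr_ge0// => i _; exact: sqr_ge0.
Unshelve. all: by end_near. Qed.
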